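(* Let $x\in[n]$, let $w\in S_{\hat x}$ and let $m\ge 1$. Then the graph $B(w)$ on the affine factorizations of $w$ with $m$ factors, with the operators $\tilde e_r,\tilde f_r$ ($1\le r<m$) and the weight map described in the context, is a $U_q(A_{m-1})$-crystal, i.e. it is the crystal graph of an integrable $U_q(\mathfrak{sl}_m)$-module (equivalently, it satisfies Stembridge's local axioms for type $A_{m-1}$, so each connected component is isomorphic to the crystal $B(\lambda)$ of an irreducible highest weight module).
   Context: Fix an integer $n\ge 2$; all letters and indices are taken modulo $n$ in $[n]=\{0,1,\dots,n-1\}$. The affine symmetric group $\tilde S_n$ is the Coxeter group generated by $s_0,\dots,s_{n-1}$ with relations $s_i^2=1$, $s_is_{i+1}s_i=s_{i+1}s_is_{i+1}$, and $s_is_j=s_js_i$ for $|i-j|>1$ (indices mod $n$). $\ell(w)$ is the Coxeter length and $\mathrm{con}(w)$ is the set of letters appearing in a reduced word of $w$ (independent of the reduced word). A word $i_1\cdots i_p$ in $[n]$ is cyclically decreasing if no letter repeats and for no $j$ does $j-1$ occur to the left of $j$; an element is cyclically decreasing if it equals $s_{i_1}\cdots s_{i_p}$ for a cyclically decreasing word. A cyclically decreasing element is determined by its content, which is a proper subset of $[n]$, and every proper subset of $[n]$ is the content of a unique cyclically decreasing element. For $w\in\tilde S_n$ and $\alpha=(\alpha_1,\dots,\alpha_m)\in\mathbb Z_{\ge0}^m$ with $\alpha_1+\dots+\alpha_m=\ell(w)$, an affine factorization of $w$ of weight $\alpha$ is a product $w^m\cdots w^1=w$ of cyclically decreasing elements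 with $\ell(w^i)=\alpha_i$; $\mathcal W_{w,\alpha}$ denotes the set of these and $\mathcal W_w$ the set of all affine factorizations of $w$ with $m$ factors (some possibly trivial). For $x\in[n]$ let $S_{\hat x}$ be the subgroup generated by $\{s_i: i\ne x\}$, and totally order $[n]\setminus\{x\}$ by $x-1>x-2>\cdots>1>0>n-1>\cdots>x+1$; all max/min below are for this order. For cyclically decreasing $u,v\in S_{\hat x}$, the $uv$-pairing with respect to $x$ processes the elements $b\in\mathrm{con}(u)$ from largest to smallest, pairing $b$ with the smallest not-yet-paired $a\in\mathrm{con}(v)$ with $a>b$ (if none, $b$ is unpaired); elements of $\mathrm{con}(v)$ never chosen are unpaired. For an affine factorization $w^m\cdots w^1$ of $w\in S_{\hat x}$ (all factors lie in $S_{\hat x}$) and $1\le r<m$, $L_r$ is the set of unpaired elements of $\mathrm{con}(w^{r+1})$ and $R_r$ the set of unpaired elements of $\mathrm{con}(w^r)$ in the $w^{r+1}w^r$-pairing. Operators on a pair $uv$ of cyclically decreasing elements of $S_{\hat x}$: if $L_1(uv)=\emptyset$ then $\tilde e_1(uv)=\mathbf 0$; otherwise with $b=\min L_1(uv)$ and $t=\min\{i\ge0: b-i-1\notin\mathrm{con}(u)\}$, $\tilde e_1(uv)=\tilde u\tilde v$ where $\tilde u,\tilde v$ are cyclically decreasing with $\mathrm{con}(\tilde u)=\mathrm{con}(u)\setminus\{b\}$, $\mathrm{con}(\tilde v)=\mathrm{con}(v)\cup\{b-t\}$. If $R_1(uv)=\emptyset$ then $\tilde f_1(uv)=\mathbf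 0$; otherwise with $a=\max R_1(uv)$ and $s=\min\{i\ge0: a+i+1\notin\mathrm{con}(v)\}$, $\tilde f_1(uv)=\tilde u\tilde v$ with $\mathrm{con}(\tilde u)=\mathrm{con}(u)\cup\{a+s\}$, $\mathrm{con}(\tilde v)=\mathrm{con}(v)\setminus\{a\}$. On $w^m\cdots w^1$, $\tilde e_r$ and $\tilde f_r$ apply $\tilde e_1,\tilde f_1$ to the pair $w^{r+1}w^r$ and leave the other factors unchanged. $B(w)$ is the edge-colored directed graph with vertex set $\mathcal W_w$ (with $m$ factors) and an edge $y\xrightarrow{r}z$ whenever $\tilde f_r y=z$; the weight of a vertex is its weight $\alpha\in\mathbb Z^m$ (simple roots $e_r-e_{r+1}$). *)

(* Defs.v *)
From HB Require Import structures.
From mathcomp Require Import all_boot all_order all_algebra.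
From mathcomp Require Import boolp classical_sets functions.
From Stdlib Require Import Relation_Operators.

Set Implicit Arguments.
Unset Strict Implicit.
Unset Printing Implicit Defensive.

Import GRing.Theory Num.Theory.

(* Words in the generators modulo the Coxeter relations.  For n = 2 the
   group of type affine A_1 has no braid relation, hence the guard 2 < n. *)
Inductive cox_eq (n : nat) : seq 'I_n -> seq 'I_n -> Prop :=
| cox_refl s : cox_eq s s
| cox_sym s t : cox_eq s t -> cox_eq t s
| cox_trans s t u : cox_eq s t -> cox_eq t u -> cox_eq s u
| cox_cat s s' t t' : cox_eq s s' -> cox_eq t t' -> cox_eq (s ++ t) (s' ++ t')
| cox_quad i : cox_eq [:: i; i] [::]
| cox_braid i : 2 < n ->
    cox_eq [:: i; ordS i; i] [:: ordS i; i; ordS i]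
| cox_comm i j : i != j -> i != ordS j -> j != ordS i ->
    cox_eq [:: i; j] [:: j; i].

Section AffineSymmetricGroup.
Variable n : nat.

Definition cox_eqb : rel (seq 'I_n) := fun s t => `[< cox_eq s t >].

Fact cox_eqb_equiv : equiv_class_of cox_eqb.
Proof.
split.
- by move=> s; apply/asboolP; exact: cox_refl.
- move=> s t; apply/idP/idP => /asboolP st; apply/asboolP; exact: cox_sym.
- move=> t s u /asboolP st /asboolP tu; apply/asboolP; exact: cox_trans tu.
Qed.

Canonical cox_equiv := EquivRelPack cox_eqb_equiv.

Definition affS := {eq_quot cox_equiv}%qT.
HB.instance Definition _ : EqQuotient _ cox_equiv affS := EqQuotient.on affS.
HB.instance Definition _ := Choice.on affS.

Definition affS_of (s : seq 'I_n) : affS := \pi_(affS)%qT s.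

Lemma affS_ofP s t : affS_of s = affS_of t <-> cox_eq s t.
Proof. by split=> [/eqquotP/asboolP | st] //; apply/eqquotP/asboolP. Qed.

Lemma affS_ofK (g : affS) : affS_of (repr g) = g.
Proof. exact: reprK. Qed.

Lemma cox_repr s : cox_eq (repr (affS_of s)) s.
Proof. by apply/affS_ofP; rewrite affS_ofK. Qed.

Definition affS_one : affS := affS_of [::].
Definition affS_mul (g h : affS) : affS := affS_of (repr g ++ repr h).
Definition affS_inv (g : affS) : affS := affS_of (rev (repr g)).

Lemma affS_mulE s t : affS_mul (affS_of s) (affS_of t) = affS_of (s ++ t).
Proof. by apply/affS_ofP; apply: cox_cat; exact: cox_repr. Qed.

Fact affS_mulA : associative affS_mul.
Proof.
move=> a b c; rewrite -(affS_ofK a) -(affS_ofK b) -(affS_ofK c).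
by rewrite !affS_mulE catA.
Qed.

Fact affS_mul1 : left_id affS_one affS_mul.
Proof. by move=> a; rewrite -(affS_ofK a) affS_mulE. Qed.

Fact affS_mul1r : right_id affS_one affS_mul.
Proof. by move=> a; rewrite -(affS_ofK a) affS_mulE cats0. Qed.

Lemma cox_rev_cat (s : seq 'I_n) : cox_eq (rev s ++ s) [::].
Proof.
elim: s => [|i s IHs]; first exact: cox_refl.
rewrite rev_cons -cats1 -catA /= -[i :: i :: s]/([:: i; i] ++ s).
apply: cox_trans IHs; apply: cox_cat (cox_refl _) _.
exact: (cox_cat (cox_quad i) (cox_refl s)).
Qed.

Fact affS_mulV : left_inverse affS_one affS_inv affS_mul.
Proof.
move=> a; rewrite /affS_inv -{2}(affS_ofK a) affS_mulE.
by apply/affS_ofP; exact: cox_rev_cat.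
Qed.

Fact affS_mulVr : right_inverse affS_one affS_inv affS_mul.
Proof.
move=> a; rewrite /affS_inv -{1}(affS_ofK a) affS_mulE.
by apply/affS_ofP; rewrite -{1}(revK (repr a)); exact: cox_rev_cat.
Qed.

HB.instance Definition _ := isGroup.Build affS affS_mulA affS_mul1 affS_mul1r
  affS_mulV affS_mulVr.

Definition gen (i : 'I_n) : affS := affS_of [:: i].

Definition word_prod (s : seq 'I_n) : affS := (\prod_(i <- s) gen i)%g.

Lemma word_prodE s : word_prod s = affS_of s.
Proof.
rewrite /word_prod; elim: s => [|i s IHs]; first by rewrite big_nil.
by rewrite big_cons IHs; exact: affS_mulE.
Qed.

Fact word_prod_surj (g : affS) :
  exists k, `[< exists2 s, size s = k & word_prod s = g >].
Proof.
exists (size (repr g)); apply/asboolP; exists (repr g) => //.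
by rewrite word_prodE affS_ofK.
Qed.

Definition cox_length (g : affS) : nat := ex_minn (word_prod_surj g).

Definition reduced_word (g : affS) (s : seq 'I_n) : Prop :=
  word_prod s = g /\ size s = cox_length g.

Definition con (g : affS) : {set 'I_n} :=
  finset (fun i => `[< exists2 s, reduced_word g s & i \in s >]).

Definition cyc_decreasing_word (s : seq 'I_n) : Prop :=
  uniq s /\ forall j, ~~ mem2 s (ord_pred j) j.

Definition cyc_decreasing (g : affS) : Prop :=
  exists2 s, cyc_decreasing_word s & g = word_prod s.

(* The cyclically decreasing element with content A (junk value 1 when A is
   the full set of letters). *)
Definition cyc_of (A : {set 'I_n}) : affS :=
  xget 1%g (fun g => cyc_decreasing g /\ con g = A).

(* As the generators are involutions, the subgroup generated by the s_i, i <> x,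
   consists of the products of words avoiding x. *)
Definition in_parabolic (x : 'I_n) (g : affS) : Prop :=
  exists2 s, x \notin s & g = word_prod s.

(* The order x-1 > x-2 > ... > 0 > n-1 > ... > x+1: [xrank x] sends x+1, ...,
   x-1, x to 0, ..., n-2, n-1. *)
Definition xrank (x a : 'I_n) : nat := (a + n - x.+1) %% n.
Definition xle (x a b : 'I_n) : bool := xrank x a <= xrank x b.
Definition xlt (x a b : 'I_n) : bool := xrank x a < xrank x b.
Definition xincr (x : 'I_n) (A : {set 'I_n}) : seq 'I_n := sort (xle x) (enum A).
Definition xdecr (x : 'I_n) (A : {set 'I_n}) : seq 'I_n := rev (xincr x A).

Fixpoint pair_up (x : 'I_n) (bs avail : seq 'I_n) : seq ('I_n * 'I_n) :=
  if bs is b :: bs' then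
    if [seq a <- avail | xlt x b a] is a :: _
    then (b, a) :: pair_up x bs' (rem a avail)
    else pair_up x bs' avail
  else [::].

Definition uv_pairing (x : 'I_n) (u v : affS) : seq ('I_n * 'I_n) :=
  pair_up x (xdecr x (con u)) (xincr x (con v)).

Definition unpairedL (x : 'I_n) (u v : affS) : {set 'I_n} :=
  finset (fun b => (b \in con u) && (b \notin unzip1 (uv_pairing x u v))).
Definition unpairedR (x : 'I_n) (u v : affS) : {set 'I_n} :=
  finset (fun a => (a \in con v) && (a \notin unzip2 (uv_pairing x u v))).

(* The least i >= 0 with P i, for predicates satisfied by some i < n. *)
Definition least (P : pred nat) : nat := find P (iota 0 n).

Definition e_pair (x : 'I_n) (u v : affS) : option (affS * affS) :=
  if xincr x (unpairedL x u v) is b :: _ then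
    let t := least (fun i => iter i.+1 (@ord_pred n) b \notin con u) in
    Some (cyc_of (con u :\ b), cyc_of (iter t (@ord_pred n) b |: con v))
  else None.

Definition f_pair (x : 'I_n) (u v : affS) : option (affS * affS) :=
  if xdecr x (unpairedR x u v) is a :: _ then
    let s := least (fun i => iter i.+1 (@ordS n) a \notin con v) in
    Some (cyc_of (iter s (@ordS n) a |: con u), cyc_of (con v :\ a))
  else None.

End AffineSymmetricGroup.

(* Colours 1 <= r < m are encoded as 'I_m.-1; colour r : 'I_m.-1 relates the
   positions lo r = r and hi r = r + 1 of 'I_m. *)
Section Colours.
Variable m : nat.

Fact hi_proof (r : 'I_m.-1) : r.+1 < m.
Proof. by rewrite -ltn_predRL. Qed.

Definition lo (r : 'I_m.-1) : 'I_m := widen_ord (leq_pred m) r.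
Definition hi (r : 'I_m.-1) : 'I_m := Ordinal (hi_proof r).

End Colours.

(* A graph coloured by 'I_m.-1, with an edge y -r-> z when cf r y = Some z; only
   the elements of cvert are vertices, and None is the element 0. *)
Record colored_graph (m : nat) := ColoredGraph {
  csort :> Type;
  cvert : set csort;
  ce : 'I_m.-1 -> csort -> option csort;
  cf : 'I_m.-1 -> csort -> option csort;
  cwt : csort -> 'I_m -> int }.

Section AffineFactorizations.
Variables (n m : nat).

(* The factor w^(i+1) is y i, and the product is w^m ... w^1. *)
Definition affine_factorization (w : affS n) (alpha : {ffun 'I_m -> nat})
    (y : {ffun 'I_m -> affS n}) : Prop :=
  [/\ \sum_i alpha i = cox_length w,
      forall i, cyc_decreasing (y i),
      forall i, cox_length (y i) = alpha i
    & (\prod_(i < m) y (rev_ord i))%g = w].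

Definition affine_factorizations (w : affS n) : set {ffun 'I_m -> affS n} :=
  fun y => exists alpha, affine_factorization w alpha y.

Definition set_factors (r : 'I_m.-1) (y : {ffun 'I_m -> affS n})
    (p : affS n * affS n) : {ffun 'I_m -> affS n} :=
  [ffun i => if i == hi r then p.1 else if i == lo r then p.2 else y i].

Definition e_op (x : 'I_n) (r : 'I_m.-1) (y : {ffun 'I_m -> affS n}) :=
  omap (set_factors r y) (e_pair x (y (hi r)) (y (lo r))).
Definition f_op (x : 'I_n) (r : 'I_m.-1) (y : {ffun 'I_m -> affS n}) :=
  omap (set_factors r y) (f_pair x (y (hi r)) (y (lo r))).

Definition fact_graph (x : 'I_n) (w : affS n) : colored_graph m :=
  ColoredGraph (affine_factorizations w) (e_op x) (f_op x)
    (fun y i => Posz (cox_length (y i))).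

End AffineFactorizations.

Section Crystals.
Local Open Scope ring_scope.
Variable m : nat.

Definition cartan (i j : 'I_m.-1) : int :=
  if i == j then 2 else if (i.+1 == j :> nat) || (j.+1 == i :> nat) then -1
  else 0.

Definition simple_root (r : 'I_m.-1) (i : 'I_m) : int :=
  (i == lo r)%:Z - (i == hi r)%:Z.

Definition is_string_length (T : Type) (g : T -> option T) (y : T) (k : nat) :=
  iter k (obind g) (Some y) /\ ~~ iter k.+1 (obind g) (Some y).

Definition string_length (T : Type) (g : T -> option T) (y : T) : nat :=
  xget 0%N (is_string_length g y).

Variable G : colored_graph m.
Implicit Types (y z : G) (r i j : 'I_m.-1).

Definition eps r y : nat := string_length (ce r) y.
Definition phi r y : nat := string_length (cf r) y.

Record crystal_axioms : Prop := CrystalAxioms {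
  crystal_e_vert : forall r y z, cvert y -> ce r y = Some z -> cvert z;
  crystal_f_vert : forall r y z, cvert y -> cf r y = Some z -> cvert z;
  crystal_ef : forall r y z, cvert y -> cvert z ->
    (ce r y = Some z <-> cf r z = Some y);
  crystal_e_fin : forall r y, cvert y -> exists k, is_string_length (ce r) y k;
  crystal_f_fin : forall r y, cvert y -> exists k, is_string_length (cf r) y k;
  crystal_e_wt : forall r y z, cvert y -> ce r y = Some z ->
    forall k, cwt z k = cwt y k + simple_root r k;
  crystal_f_wt : forall r y z, cvert y -> cf r y = Some z ->
    forall k, cwt z k = cwt y k - simple_root r k;
  crystal_phi_eps : forall r y, cvert y ->
    (phi r y)%:Z - (eps r y)%:Z = cwt y (lo r) - cwt y (hi r) }.

(* Stembridge's notation: delta is minus the depth and epsilon is the rise of a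
   vertex (so his epsilon is phi here); Delta_i and Nabla_i are the backward and
   forward differences, meaningful when E_i y, resp. F_i y, is defined. *)
Definition st_delta j y : int := - (eps j y)%:Z.
Definition st_epsilon j y : int := (phi j y)%:Z.
Definition st_Delta (s : G -> int) i y : int :=
  if ce i y is Some z then s z - s y else 0.
Definition st_Nabla (s : G -> int) i y : int :=
  if cf i y is Some z then s y - s z else 0.

Definition path_e (rs : seq 'I_m.-1) y : option G :=
  foldr (fun r => obind (ce r)) (Some y) rs.
Definition path_f (rs : seq 'I_m.-1) y : option G :=
  foldr (fun r => obind (cf r)) (Some y) rs.

(* Stembridge's local axioms (P3), (P4), (P5), (P6), (P5'), (P6').  His (P1) and
   (P2) are part of crystal_axioms. *)
Record stembridge_axioms : Prop := StembridgeAxioms {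
  stembridge_P3 : forall y i j, cvert y -> i != j -> ce i y ->
    st_Delta (st_delta j) i y + st_Delta (st_epsilon j) i y = cartan i j;
  stembridge_P4 : forall y i j, cvert y -> i != j -> ce i y ->
    st_Delta (st_delta j) i y <= 0 /\ st_Delta (st_epsilon j) i y <= 0;
  stembridge_P5 : forall y i j, cvert y -> i != j -> ce i y -> ce j y ->
    st_Delta (st_delta j) i y = 0 ->
    exists z, [/\ path_e [:: i; j] y = Some z, path_e [:: j; i] y = Some z
                & st_Nabla (st_epsilon i) j z = 0];
  stembridge_P6 : forall y i j, cvert y -> i != j -> ce i y -> ce j y ->
    st_Delta (st_delta j) i y = -1 -> st_Delta (st_delta i) j y = -1 ->
    exists z, [/\ path_e [:: i; j; j; i] y = Some z,
                  path_e [:: j; i; i; j] y = Some z,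
                  st_Nabla (st_epsilon j) i z = -1
                & st_Nabla (st_epsilon i) j z = -1];
  stembridge_P5' : forall y i j, cvert y -> i != j -> cf i y -> cf j y ->
    st_Nabla (st_epsilon j) i y = 0 ->
    exists z, [/\ path_f [:: i; j] y = Some z, path_f [:: j; i] y = Some z
                & st_Delta (st_delta i) j z = 0];
  stembridge_P6' : forall y i j, cvert y -> i != j -> cf i y -> cf j y ->
    st_Nabla (st_epsilon j) i y = -1 -> st_Nabla (st_epsilon i) j y = -1 ->
    exists z, [/\ path_f [:: i; j; j; i] y = Some z,
                  path_f [:: j; i; i; j] y = Some z,
                  st_Delta (st_delta j) i z = -1
                & st_Delta (st_delta i) j z = -1] }.

Definition cedge y z : Prop :=
  [/\ cvert y, cvert z & exists r, cf r y = Some z].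

Definition component y : colored_graph m :=
  @ColoredGraph m G (clos_refl_sym_trans G cedge y) (@ce m G) (@cf m G)
    (@cwt m G).

End Crystals.

Definition crystal_iso (m : nat) (G H : colored_graph m) : Prop :=
  exists psi : G -> H,
    set_bij (@cvert m G) (@cvert m H) psi /\
    forall y, cvert y ->
      [/\ cwt (psi y) =1 cwt y,
          forall r, omap psi (ce r y) = ce r (psi y)
        & forall r, omap psi (cf r y) = cf r (psi y)].

(* The Kashiwara-Nakashima model of the crystal B(lam) of the irreducible
   highest weight module: semistandard tableaux of shape lam with entries
   0, ..., m-1, given by their rows from top to bottom. *)
Section TableauCrystal.
Variable m : nat.

Definition is_partition (lam : seq nat) : bool :=
  sorted geq lam && (0 \notin lam).

Definition column_strict (t1 t2 : seq nat) : bool :=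
  (size t2 <= size t1) && all2 ltn (take (size t2) t1) t2.

Definition ssyt (lam : seq nat) (T : seq (seq nat)) : Prop :=
  [/\ shape T = lam, all (sorted leq) T, sorted column_strict T
    & all (all (fun a => a < m)) T].

(* Reading word: rows from bottom to top, each from left to right. *)
Definition reading (T : seq (seq nat)) : seq nat := flatten (rev T).
Definition of_reading (T : seq (seq nat)) (u : seq nat) : seq (seq nat) :=
  rev (reshape (shape (rev T)) u).

(* Bracketing rule: each letter r+1 is an opening bracket and each letter r a
   closing one.  Returns the positions, in decreasing order, of the unmatched
   letters r and of the unmatched letters r+1; p is the current position. *)
Fixpoint bracket (r : nat) (u : seq nat) (p : nat) (closed opened : seq nat)
    : seq nat * seq nat :=
  if u is a :: u' then
    if a == r.+1 then bracket r u' p.+1 closed (p :: opened)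
    else if a == r then
      if opened is _ :: opened' then bracket r u' p.+1 closed opened'
      else bracket r u' p.+1 (p :: closed) [::]
    else bracket r u' p.+1 closed opened
  else (closed, opened).

(* f_r turns the rightmost unmatched r into r+1, and e_r turns the leftmost
   unmatched r+1 into r. *)
Definition tab_f (r : 'I_m.-1) (T : seq (seq nat)) : option (seq (seq nat)) :=
  if (bracket r (reading T) 0 [::] [::]).1 is p :: _
  then Some (of_reading T (set_nth 0 (reading T) p r.+1)) else None.
Definition tab_e (r : 'I_m.-1) (T : seq (seq nat)) : option (seq (seq nat)) :=
  if rev (bracket r (reading T) 0 [::] [::]).2 is p :: _
  then Some (of_reading T (set_nth 0 (reading T) p r)) else None.

Definition tableau_crystal (lam : seq nat) : colored_graph m :=
  ColoredGraph (ssyt lam : set (seq (seq nat))) tab_e tab_f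
    (fun T i => Posz (count_mem (i : nat) (flatten T))).

End TableauCrystal.

(* U_q(A_(m-1))-crystals (with weights in Z^m): crystals satisfying Stembridge's
   axioms, all of whose connected components are crystals B(lam). *)
Definition is_UqA_crystal (m : nat) (G : colored_graph m) : Prop :=
  [/\ crystal_axioms G, stembridge_axioms G
    & forall y : G, cvert y -> exists lam : seq nat,
        [/\ is_partition lam, size lam <= m
          & crystal_iso (component y) (tableau_crystal m lam)]].

(* Main.v *)
Require Import Defs.
From mathcomp Require Import all_boot all_order all_algebra.
From mathcomp Require Import boolp classical_sets.
From mathcomp Require Import zify.
From Stdlib Require Import Relation_Operators.

Set Implicit Arguments.
Unset Strict Implicit.
Unset Printing Implicit Defensive.

Import GRing.Theory Num.Theory.

(* Reading letters through the order in which x is the largest one, a factor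
   becomes a finite set of positive integers, and the pairing of two adjacent
   factors is the parenthesis matching in which the left factor opens and the
   right factor closes.  Reducedness of the product forces the run of the left
   factor below the first unmatched opening to be matched by a run of the right
   factor, so that a raising operator moves one element, preserves the product
   (a braid identity) and removes exactly one unmatched opening.  Stembridge's
   axioms then concern three consecutive sets; the two outer sets can be followed
   explicitly along the two sides of a square or octagon, and the middle set is
   recovered from the product.  The same argument applies to semistandard
   tableaux, encoded by the positions of the letters in the reading word.
   Finally, a crystal satisfying Stembridge's axioms has one highest weight
   vertex in each component, whose weight determines the component up to
   isomorphism; it is the weight of a unique highest weight tableau. *)

(** * Bracketing of two sets of positive integers *)

Implicit Types U V : nat -> bool.

(** For arbitrary sets the operators misbehave: with both factors equal to [{1}], the opening at 1
    is unmatched and raising it merely deletes a letter. What excludes this is that two letters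
    cancel when the factors share a run [[c, b]] with [c - 1] outside the left factor and [b + 1]
    outside the right one; hence the condition [good]. It is not visibly stable under raising, so it
    is never propagated through the combinatorics: every new triple of sets is known to come from a
    vertex, whose product is reduced. This is why the three-factor analysis is stated over an
    abstract class of triples closed under both raising steps. Only raising is analysed. Reversing
    both the positions and the order of the factors exchanges openings with closings, and turns each
    statement on raising into one on lowering. The group is given by generators and relations, so
    upper bounds on lengths are immediate but lower bounds are not; they come from the parity of
    reflections and from an explicit action on integer vectors. *)

Definition rmv U b : nat -> bool := fun k => U k && (k != b).
Definition ins U b : nat -> bool := fun k => U k || (k == b).

Lemma rmv_neq U b k : k != b -> rmv U b k = U k.
Proof. by rewrite /rmv => ->; rewrite andbT. Qed.

Lemma ins_neq U b k : k != b -> ins U b k = U k.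
Proof. by rewrite /ins => /negbTE->; rewrite orbF. Qed.

(* [opens U V k] is the number of unmatched openings among the positions < k,
   when the elements of U are openings, those of V are closings, and the closing
   at a position precedes the opening at the same position. *)
Fixpoint opens U V k :=
  if k is k'.+1 then (opens U V k' - V k') + U k' else 0.

Lemma count_iotaS (P : pred nat) k :
  count P (iota 0 k.+1) = count P (iota 0 k) + P k.
Proof. by rewrite -addn1 iotaD count_cat /= addn0. Qed.

Section Bracketing.
Variable N : nat.

Definition bounded U := forall k, U k -> 0 < k <= N.

Definition flip U : nat -> bool := fun k => U (N.+1 - k).

(* The number of unmatched closings among the positions >= k: reversing the
   positions exchanges openings and closings. *)
Definition closes U V k := opens (flip V) (flip U) (N.+2 - k).

Definition unL U V k := U k && (closes U V k.+1 == 0).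
Definition unR U V k := V k && (opens U V k == 0).
Definition nL U V := count (unL U V) (iota 0 N.+1).
Definition nR U V := count (unR U V) (iota 0 N.+1).
Definition nset U := count U (iota 0 N.+1).

Definition minL U V b := unL U V b /\ forall k, k < b -> ~~ unL U V k.
Definition maxR U V a := unR U V a /\ forall k, a < k -> ~~ unR U V k.

Definition foot U b c :=
  [/\ c <= b, forall k, c <= k <= b -> U k & ~~ U c.-1].
Definition crest V a c :=
  [/\ a <= c, forall k, a <= k <= c -> V k & ~~ V c.+1].

(* The reducedness of the product of the decreasing words on U and V, in the
   form in which it is used. *)
Definition good U V := forall c b, c <= b ->
  (forall k, c <= k <= b -> U k && V k) -> U c.-1 || V b.+1.

Lemma flipK U : bounded U -> flip (flip U) = U.
Proof.
move=> bU; apply: funext => k; rewrite /flip.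
case: (leqP k N.+1) => [kN|kN]; first by congr U; lia.
have -> : N.+1 - (N.+1 - k) = N.+1 by lia.
by apply/idP/idP => /bU; lia.
Qed.

Lemma flip_bounded U : bounded U -> bounded (flip U).
Proof. by move=> bU k; rewrite /flip => /bU; lia. Qed.

Lemma rmv_bounded U b : bounded U -> bounded (rmv U b).
Proof. by move=> bU k /andP[/bU]. Qed.

Lemma ins_bounded U b : bounded U -> 0 < b <= N -> bounded (ins U b).
Proof. by move=> bU bN k /orP[/bU|/eqP->]. Qed.

Lemma rmv_id U b : U b = false -> rmv U b = U.
Proof.
by move=> Ub; apply: funext => k; rewrite /rmv; case: eqP => [->|]; rewrite ?Ub ?andbT.
Qed.

Lemma closes_rec U V k : bounded U -> bounded V ->
  closes U V k = (closes U V k.+1 - U k) + V k.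
Proof.
move=> bU bV; rewrite /closes; case: (leqP k N.+1) => [kN|kN].
  have -> : N.+2 - k = (N.+2 - k.+1).+1 by lia.
  rewrite /= /flip; have -> : N.+1 - (N.+2 - k.+1) = k by lia.
  by [].
have -> : N.+2 - k = 0 by lia.
have -> : N.+2 - k.+1 = 0 by lia.
case Uk: (U k); first by move: Uk => /bU; lia.
case Vk: (V k); first by move: Vk => /bV; lia.
by [].
Qed.

Lemma closes_big U V k : bounded U -> bounded V -> N < k -> closes U V k = 0.
Proof.
move=> bU bV kN; case: (ltnP N.+1 k) => [k2|k2].
  by rewrite /closes; have -> : N.+2 - k = 0 by lia.
rewrite closes_rec //; have -> : closes U V k.+1 = 0.
  by rewrite /closes; have -> : N.+2 - k.+1 = 0 by lia.
by case Vk: (V k); first by move: Vk => /bV; lia.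
Qed.

Section Pair.
Variables U V : nat -> bool.
Hypotheses (bU : bounded U) (bV : bounded V).

(** The closings left over from [k] on match as many of the openings pending at [k] as they can; the
    truncated subtraction is what survives. *)
Lemma count_unL k : count (unL U V) (iota 0 k) = opens U V k - closes U V k.
Proof.
elim: k => [|k IHk]; first by rewrite /= sub0n.
rewrite count_iotaS IHk /unL /=.
rewrite (closes_rec k bU bV); have:= closes_rec k.+1 bU bV.
by case: (U k); case: (V k); case: eqP => /=; lia.
Qed.

Lemma nLE : nL U V = opens U V N.+1.
Proof. by rewrite /nL count_unL closes_big // subn0. Qed.

Lemma count_unR k : k <= N.+1 ->
  count (unR U V) (iota k (N.+1 - k)) = closes U V k - opens U V k.
Proof.
move=> kN; move Em: (N.+1 - k) => m; elim: m k kN Em => [|m IHm] k kN Em /=.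
  by rewrite closes_big //; lia.
rewrite IHm; try lia.
rewrite (closes_rec k bU bV) /= /unR.
by case: (U k); case: (V k); case: eqP => /=; lia.
Qed.

Lemma nRE : nR U V = closes U V 0.
Proof. by have := count_unR (leq0n _); rewrite !subn0. Qed.

(** A matched pair uses one element of each set. In the crystal this becomes the relation between
    phi, epsilon and the weight. *)
Lemma nL_nR : nR U V + nset U = nL U V + nset V.
Proof.
rewrite nLE /nR /nset.
elim: N.+1 => [|k IHk] //.
rewrite !count_iotaS /=; have -> : unR U V k = V k && (opens U V k == 0) by [].
move: IHk; set cR := count (unR _ _) _.
by case: (U k); case: (V k); case: eqP => /=; lia.
Qed.

Lemma nL_gt0 k : unL U V k -> 0 < nL U V.
Proof.
move=> Lk; rewrite -has_count; apply/hasP; exists k => //.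
by rewrite mem_iota; move: Lk => /andP[/bU]; lia.
Qed.

Lemma nL0 : nL U V = 0 -> forall k, ~~ unL U V k.
Proof. by move=> n0 k; apply/negP => /nL_gt0; rewrite n0. Qed.

Lemma nL_min : 0 < nL U V -> exists b, minL U V b.
Proof.
rewrite -has_count => /hasP[k _ Lk].
have exL : exists k, unL U V k by exists k.
case: (ex_minnP exL) => b Lb bm; exists b; split=> // j jb.
by apply/negP => /bm; lia.
Qed.

Lemma nR_gt0 k : unR U V k -> 0 < nR U V.
Proof.
move=> Lk; rewrite -has_count; apply/hasP; exists k => //.
by rewrite mem_iota; move: Lk => /andP[/bV]; lia.
Qed.

Lemma foot_ex b : U b -> exists c, foot U b c.
Proof.
move=> Ub; elim: b {-2}b (leqnn b) Ub => [|n IHn] b bn Ub.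
  by move: (bU Ub); lia.
case Ub1: (U b.-1); last first.
  exists b; split=> //; last by rewrite Ub1.
  by move=> k kb; have -> : k = b by lia.
have b1n : b.-1 <= n by lia.
have [c [cb cU cn]] := IHn _ b1n Ub1.
exists c; split=> //; first lia.
move=> k kb; have [->//|kb'] := eqVneq k b.
by apply: cU; have := bU Ub; lia.
Qed.

End Pair.

Lemma foot_uniq U b c c' : bounded U -> foot U b c -> foot U b c' -> c = c'.
Proof.
move=> bU [cb cU cn] [cb' cU' cn'].
have c0 : 0 < c by have /bU/andP[] : U c by apply: cU; lia.
have c0' : 0 < c' by have /bU/andP[] : U c' by apply: cU'; lia.
have [//|cc'] := eqVneq c c'.
case: (ltnP c c') => lt.
- by move: cn'; rewrite cU //; lia.
- by move: cn; rewrite cU' //; lia.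
Qed.

Lemma closes_above U V U' V' j : bounded U -> bounded V -> bounded U' ->
  bounded V' -> (forall k, j <= k -> U' k = U k) ->
  (forall k, j <= k -> V' k = V k) ->
  forall k, j <= k -> closes U' V' k = closes U V k.
Proof.
move=> bU bV bU' bV' eU eV k jk.
move Em: (N.+1 - k) => m; elim: m k jk Em => [|m IHm] k jk Em.
  by rewrite !closes_big //; lia.
by rewrite !(closes_rec k) // IHm ?eU ?eV //; lia.
Qed.

Lemma closes_below U V U' V' j : bounded U -> bounded V -> bounded U' ->
  bounded V' -> (forall k, k < j -> U' k = U k) ->
  (forall k, k < j -> V' k = V k) ->  closes U' V' j = closes U V j ->
  forall k, k <= j -> closes U' V' k = closes U V k.
Proof.
move=> bU bV bU' bV' eU eV ej k kj.
move Em: (j - k) => m; elim: m k kj Em => [|m IHm] k kj Em.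
  by have -> : k = j by lia.
by rewrite !(closes_rec k) // IHm ?eU ?eV //; lia.
Qed.

Lemma opens_below U V U' V' j : (forall k, k < j -> U' k = U k) ->
  (forall k, k < j -> V' k = V k) ->
  forall k, k <= j -> opens U' V' k = opens U V k.
Proof.
move=> eU eV; elim=> [//|k IHk] kj /=.
by rewrite IHk ?eU ?eV //; lia.
Qed.

(* Losing one closing at [j] frees the innermost opening before [j] whose
   partner is not replaced. *)
Lemma closes_loss U V U' V' j : bounded U -> bounded V -> bounded U' ->
  bounded V' -> (forall k, k < j -> U' k = U k) ->
  (forall k, k < j -> V' k = V k) ->  closes U V j = (closes U' V' j).+1 ->
  (forall k, k <= j -> closes U V k = (closes U' V' k).+1) /\
    (forall k, k < j -> unL U' V' k = unL U V k) \/
  exists q, [/\ q < j, U q, closes U V q.+1 = 1 &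
    [/\ forall k, q < k <= j -> closes U V k = (closes U' V' k).+1,
        forall k, k <= q -> closes U V k = closes U' V' k,
        unL U V q = false &
        forall k, k < j -> unL U' V' k = unL U V k || (k == q)]].
Proof.
move=> bU bV bU' bV' eU eV; elim: j eU eV => [|j IHj] eU eV ej.
  by left; split=> // k; rewrite leqn0 => /eqP->.
have eUj : U' j = U j by apply: eU.
have eVj : V' j = V j by apply: eV.
have eU1 k : k < j -> U' k = U k by move=> kj; apply: eU; lia.
have eV1 k : k < j -> V' k = V k by move=> kj; apply: eV; lia.
case Ug: (U j && (closes U V j.+1 == 1)).
  move: Ug => /andP[Uj /eqP e1]; right; exists j.
  have ejj : closes U' V' j = closes U V j.
    by rewrite !(closes_rec j) // e1 eUj eVj Uj; lia.
  have eb := closes_below bU bV bU' bV' eU1 eV1 ejj.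
  split=> //; split=> //.
  - by move=> k kj; have -> : k = j.+1 by lia.
  - by move=> k kj; rewrite eb.
  - by rewrite /unL e1 andbF.
  move=> k kj; rewrite /unL.
  have [->|kj'] := eqVneq k j; first by rewrite eUj Uj e1; lia.
  by rewrite eU ?eb ?orbF //; lia.
have ejj : closes U V j = (closes U' V' j).+1.
  rewrite !(closes_rec j) // eUj eVj; move: Ug.
  by case: (U j) => /=; lia.
have Lj : unL U' V' j = unL U V j.
  rewrite /unL eUj; move: Ug; case: (U j) => //=.
  by move: ejj; lia.
case: (IHj eU1 eV1 ejj) => [[h1 h2]|[q [qj Uq q1 [h1 h2 h3 h4]]]].
  left; split=> k kj; first by have [->//|?] := eqVneq k j.+1; apply: h1; lia.
  by have [->//|?] := eqVneq k j; apply: h2; lia.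
right; exists q; split=> //; first lia.
split=> //.
- by move=> k kj; have [->//|?] := eqVneq k j.+1; apply: h1; lia.
- move=> k kj; have [->|?] := eqVneq k j; last by apply: h4; lia.
  by rewrite Lj (_ : j == q = false) ?orbF //; lia.
Qed.

Lemma nL_eq U V U' V' : (forall k, unL U' V' k = unL U V k) ->
  nL U' V' = nL U V.
Proof. by move=> e; apply: eq_count. Qed.

Lemma count_add1 (P Q : pred nat) q s : uniq s -> q \in s -> P q = false ->
  (forall k, Q k = P k || (k == q)) -> count Q s = (count P s).+1.
Proof.
move=> us qs Pq e.
have -> : count Q s = count (predU P (pred1 q)) s by apply: eq_count => k; rewrite e.
have := count_predUI P (pred1 q) s.
rewrite count_uniq_mem // qs.
have -> : count (predI P (pred1 q)) s = 0.
  rewrite (eq_count (a2 := pred0)) ?count_pred0 // => k /=.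
  by case: eqP => [->|]; rewrite ?Pq ?andbF.
by rewrite addn1 addn0.
Qed.

Lemma nL_add U V U' V' q : bounded U' -> unL U V q = false ->
  (forall k, unL U' V' k = unL U V k || (k == q)) ->
  nL U' V' = (nL U V).+1.
Proof.
move=> bU' Lq e; apply: (count_add1 (q := q)) => //; first exact: iota_uniq.
have : unL U' V' q by rewrite e eqxx orbT.
by rewrite mem_iota => /andP[/bU' ? _]; lia.
Qed.

(** The partner of the deleted closing takes another one, whose partner must move in turn. Either
    this chain of replacements ends at a closing that was unmatched, and no opening is lost, or it
    frees exactly one opening [q] below [b]. *)
Lemma unL_rmv U V b : bounded U -> bounded V -> V b ->
  (forall k, b < k -> closes U (rmv V b) k = closes U V k) /\
  ((forall k, unL U (rmv V b) k = unL U V k) /\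
   (forall k, k <= b -> closes U V k = (closes U (rmv V b) k).+1) \/
  exists q, [/\ q < b, U q, closes U V q.+1 = 1 &
    [/\ forall k, q < k <= b -> closes U V k = (closes U (rmv V b) k).+1,
        forall k, k <= q -> closes U V k = closes U (rmv V b) k,
        unL U V q = false &
        forall k, unL U (rmv V b) k = unL U V k || (k == q)]]).
Proof.
move=> bU bV Vb; have bV' := rmv_bounded (b := b) bV.
have eab : forall k, b < k -> closes U (rmv V b) k = closes U V k.
  move=> k bk; apply: (closes_above (j := b.+1)) => // l bl; rewrite /rmv.
  by rewrite (_ : l != b) ?andbT //; lia.
split=> //.
have ebl k : k < b -> rmv V b k = V k.
  by move=> kb; rewrite /rmv (_ : k != b) ?andbT //; lia.
have eb : closes U V b = (closes U (rmv V b) b).+1.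
  by rewrite !(closes_rec b) // eab // /rmv Vb eqxx /=; lia.
have Lab k : b <= k -> unL U (rmv V b) k = unL U V k.
  by move=> bk; rewrite /unL eab //; lia.
case: (closes_loss bU bV bU bV' (fun k _ => erefl) ebl eb) => [[h1 h2]|].
  left; split=> // k; case: (ltnP k b) => kb; [exact: h2|exact: Lab].
case=> q [qb Uq q1 [h1 h2 h3 h4]]; right; exists q; split=> //; split=> // k.
case: (ltnP k b) => kb; first exact: h4.
by rewrite Lab // (_ : k == q = false) ?orbF //; lia.
Qed.

(** The new opening competes for a closing. If none is left above [p], it stays unmatched itself;
    otherwise it takes one, and either a spare closing makes up for it below or one opening [q < p]
    is displaced. *)
Lemma unL_ins U V p : bounded U -> bounded V -> 0 < p <= N -> U p = false ->
  (forall k, p < k -> closes (ins U p) V k = closes U V k) /\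
  ((forall k, unL (ins U p) V k = unL U V k) /\
   (0 < closes U V p.+1 /\
   forall k, k <= p -> closes U V k = (closes (ins U p) V k).+1) \/
  exists q, [/\ q <= p, (q = p /\ closes U V p.+1 = 0 \/
                 [/\ q < p, U q & closes U V q.+1 = 1]) &
    [/\ forall k, q < k <= p -> closes U V k = (closes (ins U p) V k).+1,
        forall k, k <= q -> closes U V k = closes (ins U p) V k,
        unL U V q = false &
        forall k, unL (ins U p) V k = unL U V k || (k == q)]]).
Proof.
move=> bU bV pN Up; have bU' := ins_bounded bU pN.
have ea k : p < k -> ins U p k = U k.
  by move=> pk; rewrite /ins (_ : k == p = false) ?orbF //; lia.
have ebl k : k < p -> ins U p k = U k.
  by move=> pk; rewrite /ins (_ : k == p = false) ?orbF //; lia.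
have eab : forall k, p < k -> closes (ins U p) V k = closes U V k.
  by move=> k bk; apply: (closes_above (j := p.+1)) => // l bl; apply: ea.
split=> //.
have Lab k : p < k -> unL (ins U p) V k = unL U V k.
  by move=> bk; rewrite /unL ea ?eab //; lia.
have Up' : ins U p p by rewrite /ins eqxx orbT.
case E0: (closes U V p.+1) => [|e].
  have ep : closes (ins U p) V p = closes U V p.
    by rewrite !(closes_rec p) // eab // Up' Up E0.
  have ek := closes_below bU bV bU' bV ebl (fun k _ => erefl) ep.
  right; exists p; split=> //; first by left.
  split.
  - by move=> k; lia.
  - by move=> k kp; rewrite ek.
  - by rewrite /unL Up.
  move=> k; case: (ltngtP k p) => [kp|kp|->].
  - by rewrite /unL ebl // ek // orbF.
  - by rewrite Lab // orbF.
  - by rewrite /unL Up' Up eab // E0.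
have ep : closes U V p = (closes (ins U p) V p).+1.
  by rewrite !(closes_rec p) // eab // Up' Up E0; lia.
have Lp : unL (ins U p) V p = unL U V p.
  by rewrite /unL eab // E0 !andbF.
case: (closes_loss bU bV bU' bV ebl (fun k _ => erefl) ep) => [[h1 h2]|].
  by left; split=> // k; case: (ltngtP k p) => [|/Lab|->//]; auto.
case=> q [qb Uq q1 [h1 h2 h3 h4]]; right; exists q; split; first lia.
  by right.
split=> // k; case: (ltngtP k p) => [kp|kp|->]; first exact: h4.
  by rewrite Lab // (_ : k == q = false) ?orbF //; lia.
by rewrite Lp (_ : p == q = false) ?orbF //; lia.
Qed.

End Bracketing.

(** * Effect of one raising step on the matching *)

Section EStep.
Variables (N : nat) (U V : nat -> bool) (b c : nat).
Hypotheses (bU : bounded N U) (bV : bounded N V) (gUV : good U V).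
Hypotheses (mb : minL N U V b) (fc : foot U b c).

Let E := closes N U V.

(* On the run of [U] ending at the first unmatched opening [b], every position
   [k] closes the opening at [k.-1]. *)
Lemma minL_chain :
  [/\ E b.+1 = 0, forall k, c < k <= b -> [/\ V k, E k = 1 & opens U V k = 1],
      V c = false, E c = 0 & opens U V c = 0].
Proof.
have [/andP[Ub /eqP Eb1] nb] := mb; have [cb cU cn] := fc.
have Eb : E b = V b by rewrite /E (closes_rec b bU bV) Eb1 Ub.
have Db : opens U V b <= E b.
  have := count_unL bU bV b.
  rewrite (eq_in_count (a2 := pred0)) ?count_pred0; first by rewrite /E; lia.
  by move=> k; rewrite mem_iota => /andP[_ kb]; apply/negbTE/nb; lia.
(* Nothing before [b] is unmatched, so [opens <= closes] at [b]. Going down the run, the opening at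
   each position makes [opens] positive just above it, which forces a closing there and pins both
   counts to 1. *)
have P : forall i, i <= b - c ->
    [/\ opens U V (b - i) <= E (b - i), E (b - i) = V (b - i)
      & forall k, b - i < k <= b -> [/\ V k, E k = 1 & opens U V k = 1]].
  elim=> [|i IHi] ib; first by rewrite subn0; split=> // k; lia.
  have [D1 E1 h] := IHi ltac:(lia).
  have ek : b - i = (b - i.+1).+1 by lia.
  have Uk : U (b - i.+1) by apply: cU; lia.
  have Dk : opens U V (b - i) = (opens U V (b - i.+1) - V (b - i.+1)) + 1.
    by rewrite ek /= Uk.
  have Ek : E (b - i.+1) = (E (b - i) - 1) + V (b - i.+1).
    by rewrite /E (closes_rec (b - i.+1) bU bV) Uk -ek.
  have [Vk Ek1] : V (b - i) /\ E (b - i) = 1.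
    by move: E1 D1; case: (V _) => /=; lia.
  split; [lia | lia |] => k kb.
  have [->|?] := eqVneq k (b - i); last by apply: h; lia.
  by split=> //; lia.
have [D1 E1 h] := P _ (leqnn _).
have ebc : b - (b - c) = c by lia.
rewrite ebc in D1 E1 h.
have Vb1 : V b.+1 = false.
  by move: Eb1; rewrite (closes_rec b.+1 bU bV); case: (V _) => //=; lia.
(* Reducedness enters here: a closing at [c] would complete a common run [[c, b]] that neither
   factor extends in the way [good] requires. *)
have Vc : V c = false.
  apply/negbTE/negP => Vc; suff : U c.-1 || V b.+1 by rewrite (negbTE cn) Vb1.
  apply: gUV => // k kb; rewrite cU //=.
  by have [->//|?] := eqVneq k c; have [] := h k ltac:(lia).
split=> //; lia.
Qed.

Let U' := rmv U b.
Let V' := ins V c.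

Lemma minL_bounds : [/\ 0 < c, c <= b, b <= N & U b].
Proof.
have [/andP[Ub _] _] := mb; have [cb cU _] := fc.
have /bU/andP[-> _] : U c by apply: cU; rewrite leqnn.
by have /andP[_ ->] := bU Ub.
Qed.

Let bU' : bounded N U'. Proof. exact: rmv_bounded. Qed.
Let bV' : bounded N V'.
Proof. by apply: ins_bounded => //; have [] := minL_bounds; lia. Qed.

(** The opening [b] had no closing to absorb, so deleting it alters no count above [c]; the closing
    added at [c] is never absorbed below. *)
Lemma estep_closes :
  (forall k, c < k -> closes N U' V' k = E k) /\
  (forall k, k <= c -> closes N U' V' k = (E k).+1).
Proof.
have [Eb1 chain Vc Ec Dc] := minL_chain; have [c0 cb bN Ub] := minL_bounds.
have [_ cU cn] := fc; have [/andP[_ /eqP _] nb] := mb.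
have eab k : b < k -> closes N U' V' k = E k.
  move=> bk; apply: (closes_above (j := b.+1)) => // l bl; rewrite /U' /V' /rmv /ins.
    by rewrite (_ : l != b) ?andbT //; lia.
  by rewrite (_ : l == c = false) ?orbF //; lia.
have ebelow : forall k, c < k -> closes N U' V' k = E k.
  move=> k ck; case: (ltnP b k) => [|kb]; first exact: eab.
  have Ebb : closes N U' V' b = E b.
    rewrite /E !(closes_rec b) // eab // /U' /V' /rmv /ins eqxx Ub /=.
    by rewrite (_ : b == c = false) ?orbF /E ?Eb1 //; move: Eb1; rewrite /E; lia.
  move Em: (b - k) => m; elim: m k kb ck Em => [|m IHm] k kb ck Em.
    by have -> : k = b by lia.
  have kb' : k != b by apply/eqP; lia.
  have kc' : k != c by apply/eqP; lia.
  have IH := IHm k.+1 ltac:(lia) ltac:(lia) ltac:(lia).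
  rewrite (closes_rec k bU' bV') IH /E (closes_rec k bU bV).
  by rewrite /U' /V' rmv_neq // ins_neq.
have Ecc : closes N U' V' c = (E c).+1.
  rewrite Ec (closes_rec c) // ebelow // /V' /ins eqxx orbT /U' /rmv.
  have [ecb|ncb] := eqVneq c b; first by rewrite ecb Eb1; lia.
  have [_ -> _] := chain c.+1 ltac:(lia).
  by rewrite cU //; lia.
split=> //.
have bel k : k < c -> U k = U' k.
  by move=> kc; rewrite /U' /rmv (_ : k != b) ?andbT //; lia.
have belV k : k < c -> V k = V' k.
  by move=> kc; rewrite /V' /ins (_ : k == c = false) ?orbF //; lia.
(* [closes_loss] is read from the new pair to the old one: an opening freed below [c] would be
   unmatched in [U], [V] before [b], against the minimality of [b]. *)
case: (closes_loss bU' bV' bU bV bel belV Ecc) => [[]//|[q [qc _ _ [_ _ _ h]]]].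
by have := nb q ltac:(lia); rewrite h // eqxx orbT.
Qed.

Lemma estep_unL k : unL N U' V' k = unL N U V k && (k != b).
Proof.
have [Eb1 chain Vc Ec Dc] := minL_chain; have [c0 cb bN Ub] := minL_bounds.
have [ea eb] := estep_closes; have [_ nb] := mb.
case: (ltngtP k b) => [kb|bk|->]; last 2 first.
- by rewrite andbT /unL ea; [rewrite /U' rmv_neq //; lia | lia].
- by rewrite /unL /U' /rmv eqxx !andbF.
rewrite (negbTE (nb k kb)) /unL /=.
case: (ltnP k c) => kc; first by rewrite eb // andbF.
by rewrite ea // ; have [_ -> _] := chain k.+1 ltac:(lia); rewrite andbF.
Qed.

Lemma estep_nL : nL N U V = (nL N U' V').+1.
Proof.
have [Lb _] := mb; apply: (nL_add (q := b)) => //.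
  by rewrite estep_unL eqxx andbF.
by move=> k; rewrite estep_unL; case: eqP => [->|]; rewrite ?Lb ?andbT ?orbF.
Qed.

(** With [estep_crest] and [estep_inv] this makes lowering undo the step: it selects [c], and the
    run of [V'] starting at [c] ends at [b]. *)
Lemma estep_maxR : maxR U' V' c.
Proof.
have [Eb1 chain Vc Ec Dc] := minL_chain; have [c0 cb bN Ub] := minL_bounds.
have [ea _] := estep_closes; have [_ cU cn] := fc.
have Vc' : V' c by rewrite /V' /ins eqxx orbT.
have Dc' : opens U' V' c = 0.
  rewrite -Dc; apply: (opens_below (j := c)) => // k kc.
    by rewrite /U' /rmv (_ : k != b) ?andbT //; lia.
  by rewrite /V' /ins (_ : k == c = false) ?orbF //; lia.
split; first by rewrite /unR Vc' Dc'.
move=> k ck; apply/negP => Rk.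
have kN : k <= N by have /andP[/bV'] := Rk; lia.
(* The count above [c] is [closes - opens] at [c + 1], and there the two numbers cancel: 0 and 0 if
   [c = b], 1 and 1 otherwise. *)
have : 0 < count (unR U' V') (iota c.+1 (N.+1 - c.+1)).
  by rewrite -has_count; apply/hasP; exists k => //; rewrite mem_iota; lia.
rewrite (count_unR bU' bV'); last lia.
rewrite ea //= Dc' Vc' /U' /rmv.
have [ecb|ncb] := eqVneq c b; first by rewrite ecb Eb1.
have [_ -> _] := chain c.+1 ltac:(lia).
by rewrite cU //; lia.
Qed.

Lemma estep_crest : crest V' c b.
Proof.
have [Eb1 chain Vc Ec Dc] := minL_chain; have [c0 cb bN Ub] := minL_bounds.
split=> //; rewrite /V' /ins.
  by move=> k kb; have [|?] := eqVneq k c; rewrite ?orbT //; have [->] := chain k ltac:(lia).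
rewrite (_ : b.+1 == c = false) ?orbF; last lia.
by move: Eb1; rewrite /E (closes_rec b.+1) //; case: (V _) => //=; lia.
Qed.

Lemma estep_inv : ins U' b = U /\ rmv V' c = V.
Proof.
have [Eb1 chain Vc Ec Dc] := minL_chain; have [c0 cb bN Ub] := minL_bounds.
split; apply: funext => k; rewrite /U' /V' /ins /rmv.
  by case: eqP => [->|]; rewrite ?Ub ?andbT ?orbF.
by case: eqP => [->|]; rewrite ?Vc ?andbT ?orbF.
Qed.

End EStep.

(** * Reversal of positions, exchanging openings and closings *)

Section Duality.
Variables (N : nat) (U V : nat -> bool).
Hypotheses (bU : bounded N U) (bV : bounded N V).
Notation fl := (flip N).

Lemma unL_flip k : unL N (fl V) (fl U) k = unR U V (N.+1 - k).
Proof. by rewrite /unL /closes !flipK // subSS. Qed.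

Lemma unR_big k : N < k -> unR U V k = false.
Proof. by move=> Nk; apply/negP => /andP[/bV]; lia. Qed.

Lemma maxR_flip a : maxR U V a -> minL N (fl V) (fl U) (N.+1 - a).
Proof.
move=> [Ra na]; have aN : a <= N by have /andP[/bV] := Ra; lia.
split; first by rewrite unL_flip (_ : _ - _ = a) //; lia.
move=> k ka; rewrite unL_flip; case: (leqP k N.+1) => [kN|?]; last lia.
by apply: na; lia.
Qed.

Lemma minL_flip b : minL N (fl V) (fl U) b -> maxR U V (N.+1 - b).
Proof.
move=> [Lb nb]; split; first by rewrite -unL_flip.
move=> k bk; case: (ltnP N k) => kN; first by rewrite unR_big.
have -> : k = N.+1 - (N.+1 - k) by lia.
by rewrite -unL_flip nb //; lia.
Qed.

Lemma crest_flip a c : 0 < a -> c <= N ->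
  crest V a c -> foot (fl V) (N.+1 - a) (N.+1 - c).
Proof.
move=> a0 cN [ac aV nV]; split; rewrite /flip; first lia.
  by move=> k kb; apply: aV; lia.
by rewrite (_ : N.+1 - _ = c.+1) //; lia.
Qed.

Lemma foot_flip b c : foot (fl V) b c -> crest V (N.+1 - b) (N.+1 - c).
Proof.
move=> [cb cV nV]; have := cV b; rewrite leqnn cb => /(_ isT) /bV ?.
have /bV ? : fl V c by apply: cV; rewrite leqnn.
split; [lia | |].
  move=> k kb; have := cV (N.+1 - k) ltac:(lia); rewrite /flip.
  by rewrite (_ : N.+1 - _ = k) //; lia.
by move: nV; rewrite /flip (_ : N.+1 - c.-1 = (N.+1 - c).+1) //; lia.
Qed.

Lemma good_flip : good U V -> good (fl V) (fl U).
Proof.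
move=> gUV c b cb h.
have /andP[/bV ? _] := h c ltac:(lia); have /andP[/bV ? _] := h b ltac:(lia).
have := gUV (N.+1 - b) (N.+1 - c) ltac:(lia); rewrite orbC /flip.
rewrite (_ : (N.+1 - c).+1 = N.+1 - c.-1); last lia.
rewrite (_ : (N.+1 - b).-1 = N.+1 - b.+1); last lia.
apply=> k kb; have := h (N.+1 - k) ltac:(lia); rewrite /flip andbC.
by rewrite (_ : N.+1 - _ = k) //; lia.
Qed.

Lemma nL_flip : nL N (fl V) (fl U) = nR N U V.
Proof.
rewrite nLE; try exact: flip_bounded.
rewrite nRE // (closes_rec 0) // /closes subn1 /=.
by case U0: (U 0); [move/bU: U0|]; case V0: (V 0); [move/bV: V0| |move/bV: V0|];
  rewrite // subn0 addn0.
Qed.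

Lemma nR_flip : nR N (fl V) (fl U) = nL N U V.
Proof.
rewrite nRE; try exact: flip_bounded.
have bV' := flip_bounded bV; have bU' := flip_bounded bU.
rewrite (closes_rec 0) // nLE // /closes !flipK // subn1 /=.
have -> : flip N V 0 = false by apply/negP => /bV; lia.
have -> : flip N U 0 = false by apply/negP => /bU; lia.
by rewrite subn0 addn0.
Qed.

End Duality.

Lemma rmv_flip N U b : 0 < b <= N -> flip N (rmv U b) = rmv (flip N U) (N.+1 - b).
Proof.
move=> bN; apply: funext => k; rewrite /flip /rmv; congr (_ && ~~ _).
by apply/eqP/eqP; lia.
Qed.

Lemma ins_flip N U b : 0 < b <= N -> flip N (ins U b) = ins (flip N U) (N.+1 - b).
Proof.
move=> bN; apply: funext => k; rewrite /flip /ins; congr (_ || _).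
by apply/eqP/eqP; lia.
Qed.

Lemma nset_flip N U : bounded N U -> nset N (flip N U) = nset N U.
Proof.
move=> bU; have h W : bounded N W -> nset N W = count W (iota 1 N).
  by move=> bW; rewrite /nset /=; case W0: (W 0) => //; move/bW: W0.
rewrite (h _ bU) h; last exact: flip_bounded.
rewrite -(count_map (fun k => N.+1 - k) U).
have pe : perm_eq [seq N.+1 - k | k <- iota 1 N] (iota 1 N).
  apply: uniq_perm; rewrite ?iota_uniq //.
    rewrite map_inj_in_uniq ?iota_uniq // => i j; rewrite !mem_iota; lia.
  move=> k; rewrite mem_iota; apply/mapP/idP => [[j]|kN].
    by rewrite mem_iota => ? ->; lia.
  by exists (N.+1 - k); rewrite ?mem_iota; lia.
by move/permP: pe => ->.
Qed.

(** * Three consecutive factors *)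

Ltac nlia := repeat match goal with
  | H : ?P |- _ => lazymatch type of P with Prop =>
      lazymatch P with
      | is_true (leq _ _) => fail
      | is_true (andb (leq _ _) (leq _ _)) => fail
      | is_true (negb (@eq_op _ _ _)) => fail
      | @eq nat _ _ => fail
      | not (@eq nat _ _) => fail
      | _ => clear H
      end end
  end; lia.

Lemma minL_ext N U V U' V' b : (forall k, unL N U' V' k = unL N U V k) ->
  minL N U V b -> minL N U' V' b.
Proof. by move=> e [Lb nb]; split=> [|k kb]; rewrite e //; apply: nb. Qed.

Lemma foot_ext U U' b c : foot U b c ->
  (forall k, c.-1 <= k <= b -> U' k = U k) -> foot U' b c.
Proof.
move=> [cb cU cn] e; split=> //; last by rewrite e //; lia.
by move=> k kb; rewrite e ?cU //; lia.
Qed.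

Lemma ins_rmv U b k : b != k -> ins (rmv U b) k = rmv (ins U k) b.
Proof.
move=> bk; apply: funext => l; rewrite /ins /rmv; case: eqP => [->|] //=.
by rewrite (negbTE bk) !andbF.
by rewrite !andbT.
Qed.

Lemma insC U b k : ins (ins U b) k = ins (ins U k) b.
Proof. by apply: funext => l; rewrite /ins orbAC. Qed.

Lemma rmvC U b k : rmv (rmv U b) k = rmv (rmv U k) b.
Proof. by apply: funext => l; rewrite /rmv andbAC. Qed.

(* [A], [B], [C] are the contents of three consecutive factors; the first letter
   raises along the pair (B, A) and the second one along the pair (C, B). *)
Section Triple.
Variable N : nat.
Variable Cl : (nat -> bool) -> (nat -> bool) -> (nat -> bool) -> Prop.
Hypothesis Clb : forall A B C, Cl A B C ->
  [/\ bounded N A, bounded N B & bounded N C].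
Hypothesis Clg : forall A B C, Cl A B C -> good B A /\ good C B.
Hypothesis Cl1 : forall A B C b c, Cl A B C -> minL N B A b -> foot B b c ->
  Cl (ins A c) (rmv B b) C.
Hypothesis Cl2 : forall A B C b c, Cl A B C -> minL N C B b -> foot C b c ->
  Cl A (ins B c) (rmv C b).

Variables (A B C : nat -> bool) (b be c ga : nat).
Hypotheses (Cl0 : Cl A B C) (mb : minL N B A b) (fb : foot B b be).
Hypotheses (mc : minL N C B c) (fc : foot C c ga).

Let bA : bounded N A. Proof. by have [] := Clb Cl0. Qed.
Let bB : bounded N B. Proof. by have [] := Clb Cl0. Qed.
Let bC : bounded N C. Proof. by have [] := Clb Cl0. Qed.
Let gBA : good B A. Proof. by have [] := Clg Cl0. Qed.
Let gCB : good C B. Proof. by have [] := Clg Cl0. Qed.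
Let bB1 : bounded N (rmv B b). Proof. exact: rmv_bounded. Qed.
Let bB2 : bounded N (ins B ga). Proof. by have [] := Clb (Cl2 Cl0 mc fc). Qed.

Let Bga : B ga = false.
Proof. by have [] := minL_chain bC bB gCB mc fc. Qed.

Let gaN : 0 < ga <= N.
Proof. by have [? ? ? _] := minL_bounds bC mc fc; lia. Qed.
Let Bb : B b. Proof. by have [/andP[]] := mb. Qed.

(** The middle set closes against [C] and opens towards [A]. Moving one of its elements along one
    pair therefore changes the number of unmatched openings of the other pair by 0 or 1; these cases
    will be the sign condition (P4). *)
Lemma nL_rmv_cases :
  nL N C (rmv B b) = nL N C B \/ nL N C (rmv B b) = (nL N C B).+1.
Proof.
have [_ [[h _]|[q [_ _ _ [_ _ Lq h]]]]] := unL_rmv bC bB Bb.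
  by left; apply: nL_eq.
by right; apply: nL_add Lq h.
Qed.

Lemma nL_ins_cases :
  nL N (ins B ga) A = nL N B A \/ nL N (ins B ga) A = (nL N B A).+1.
Proof.
have [_ [[h _]|[q [_ _ [_ _ Lq h]]]]] := unL_ins bB bA gaN Bga.
  by left; apply: nL_eq.
by right; apply: nL_add Lq h.
Qed.

Lemma b_neq_ga : b != ga.
Proof. by apply/eqP => e; move: Bga; rewrite -e Bb. Qed.

(** If deleting [b] frees nothing, a spare closing of the pair (C, B) is present at every position
    up to [b]; at [ga] there is none, so [b < ga]. Since no closing of [A] is left above [b], the
    opening that becomes unmatched when [ga] is inserted lies above [b], and [b] is still the first
    one. *)
Lemma square_rmv : nL N C (rmv B b) = nL N C B ->
  [/\ minL N C (rmv B b) c, minL N (ins B ga) A b, foot (ins B ga) b be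
    & nL N (ins B ga) A = (nL N B A).+1].
Proof.
move=> nLC.
have [_ [[h hE]|[q [_ _ _ [_ _ Lq h]]]]] := unL_rmv bC bB Bb; last first.
  by move: nLC; rewrite (nL_add bC Lq h); lia.
have [Ec1 chain _ Ega _] := minL_chain bC bB gCB mc fc.
have [bec Bbe nbe] := fb; have [gac Cga nga] := fc.
have bga : b < ga.
  rewrite ltnNge; apply/negP => gab; have := hE ga gab; rewrite Ega; lia.
have [Eb1 _ _ _ _] := minL_chain bB bA gBA mb fb.
have nL1 : forall k, k <= b -> unL N (ins B ga) A k = unL N B A k /\
   nL N (ins B ga) A = (nL N B A).+1.
  have [eab [[_ [e1 hE1]]|[q [qg hq [h1 h2 Lq h']]]]] := unL_ins bB bA gaN Bga.
    by have := hE1 b.+1 ltac:(lia); rewrite Eb1.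
  have bq : b < q.
    rewrite ltnNge; apply/negP => qb; case: hq => [|[qga Uq q1]]; first lia.
    by have := h1 b.+1 ltac:(lia); rewrite Eb1.
  move=> k kb; split; last exact: nL_add Lq h'.
  by rewrite h' (_ : k == q = false) ?orbF //; lia.
have [Lb nb] := mb.
split.
- exact: minL_ext mc.
- split; first by rewrite (nL1 b _).1.
  by move=> k kb; rewrite (nL1 k _).1 ?nb //; lia.
- by apply: foot_ext fb _ => k kb; apply: ins_neq; lia.
- by have [] := nL1 b (leqnn _).
Qed.

(** Now the pair (B, A) has a spare closing at every position up to [ga + 1] and none at [be], so
    [ga + 1 < be]. As [B] contains [(ga, c]] but not [be - 1], also [c < b]; the opening of [C]
    freed by deleting [b] is then above [c]. *)
Lemma square_ins : nL N (ins B ga) A = nL N B A ->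
  [/\ minL N C (rmv B b) c, minL N (ins B ga) A b, foot (ins B ga) b be
    & nL N C (rmv B b) = (nL N C B).+1].
Proof.
move=> nLB.
have [_ [[h [e1 hE]]|[q [_ _ [_ _ Lq h]]]]] := unL_ins bB bA gaN Bga; last first.
  by move: nLB; rewrite (nL_add bB2 Lq h); lia.
have [Eb1 chain1 _ Ebe _] := minL_chain bB bA gBA mb fb.
have [Ec1 chain _ Ega _] := minL_chain bC bB gCB mc fc.
have [bec Bbe nbe] := fb; have [gac Cga nga] := fc.
have gabe : ga.+1 < be.
  rewrite ltnNge; apply/negP => gab.
  have [e|ne] := eqVneq be ga.+1; first by move: e1; rewrite -e Ebe.
  by have := hE be ltac:(lia); rewrite Ebe; lia.
have cb : c < b.
  rewrite ltnNge; apply/negP => cb.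
  have [e|ne] := eqVneq ga.+1 be; first lia.
  by have [Bk _ _] := chain be.-1 ltac:(lia); rewrite Bk in nbe.
have nL1 : forall k, k <= c -> unL N C (rmv B b) k = unL N C B k /\
   nL N C (rmv B b) = (nL N C B).+1.
  have [eab [[_ hE1]|[q [qg Uq q1 [h1 h2 Lq h']]]]] := unL_rmv bC bB Bb.
    by have := hE1 c.+1 ltac:(lia); rewrite Ec1.
  have bq : c < q.
    rewrite ltnNge; apply/negP => qb.
    have [e|ne] := eqVneq q c; first by move: q1; rewrite e Ec1.
    by have := h1 c.+1 ltac:(lia); rewrite Ec1.
  move=> k kb; split; last exact: nL_add Lq h'.
  by rewrite h' (_ : k == q = false) ?orbF //; lia.
have [Lc nc] := mc.
split.
- split; first by rewrite (nL1 c _).1.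
  by move=> k kc; rewrite (nL1 k _).1 ?nc //; lia.
- exact: minL_ext mb.
- by apply: foot_ext fb _ => k kb; apply: ins_neq; lia.
- by have [] := nL1 c (leqnn _).
Qed.

(** The twelve numbers are the elements removed and added in the six steps that follow the first
    one: three on the path that starts with the pair (B, A), three on the path that starts with (C,
    B). Only the outer sets are compared at the end. The last conjunct gives the differences -1
    required in (P6). *)
Definition octagon_paths := exists c1 g1 c2 g2 d1 e1 b1 f1 b2 f2 c3 g3,
  let B1 := rmv B b in let B2 := ins B1 g1 in let B3 := ins B2 g2 in
  let A1 := ins A be in let C2 := rmv C c1 in
  let D1 := ins B ga in let D2 := rmv D1 b1 in let D3 := rmv D2 b2 in
  let F1 := rmv C c in let F2 := ins A f1 in
  [/\ minL N C B1 c1 /\ foot C c1 g1, minL N C2 B2 c2 /\ foot C2 c2 g2,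
      minL N B3 A1 d1 /\ foot B3 d1 e1, minL N D1 A b1 /\ foot D1 b1 f1
    & [/\ minL N D2 F2 b2 /\ foot D2 b2 f2, minL N F1 D3 c3 /\ foot F1 c3 g3,
        ins A1 e1 = ins F2 f2, rmv C2 c2 = rmv F1 c3
      & nL N B3 A1 = (nL N B1 A1).+1 /\ nL N F1 D3 = (nL N F1 D1).+1]].

Hypothesis gainR : nL N C (rmv B b) = (nL N C B).+1.
Hypothesis gainI : nL N (ins B ga) A = (nL N B A).+1.

Let Cy1 : Cl (ins A be) (rmv B b) C. Proof. exact: Cl1. Qed.
Let Cz1 : Cl A (ins B ga) (rmv C c). Proof. exact: Cl2. Qed.
Let bA1 : bounded N (ins A be). Proof. by have [] := Clb Cy1. Qed.
Let bC1 : bounded N (rmv C c). Proof. exact: rmv_bounded. Qed.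

Let Bb' : ins B ga b. Proof. by rewrite ins_neq // b_neq_ga. Qed.

Let L1lt k : k < b -> unL N B A k = false.
Proof. by have [_ h] := mb; move=> /h/negbTE. Qed.
Let L2lt k : k < c -> unL N C B k = false.
Proof. by have [_ h] := mc; move=> /h/negbTE. Qed.

(** [q] is the opening of [C] that loses its partner when [b] leaves [B]; in [gainIE], [p] is the
    opening of [B] left unmatched when [ga] enters. *)
Let gainRE : exists q, [/\ q < b, C q, closes N C B q.+1 = 1 &
  [/\ forall k, q < k <= b -> closes N C B k = (closes N C (rmv B b) k).+1,
      forall k, b < k -> closes N C (rmv B b) k = closes N C B k,
      unL N C B q = false &
      forall k, unL N C (rmv B b) k = unL N C B k || (k == q)]].
Proof.
have [h0 [[h _]|[q [q1 q2 q3 [h1 h2 Lq h]]]]] := unL_rmv bC bB Bb.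
  by move: gainR; rewrite (nL_eq (U := C) (V := B)) //; lia.
by exists q.
Qed.

Let gainIE : exists p, [/\ p <= ga, p = ga /\ closes N B A ga.+1 = 0 \/
                    [/\ p < ga, B p & closes N B A p.+1 = 1] &
  [/\ forall k, p < k <= ga -> 0 < closes N B A k,
      forall k, ga < k -> closes N (ins B ga) A k = closes N B A k,
      unL N B A p = false &
      forall k, unL N (ins B ga) A k = unL N B A k || (k == p)]].
Proof.
have [h0 [[h _]|[q [q1 q2 [h1 h2 Lq h]]]]] := unL_ins bB bA gaN Bga.
  by move: gainI; rewrite (nL_eq (U := B) (V := A)) //; lia.
by exists q; split=> //; split=> // k kq; rewrite h1.
Qed.

(** Raising along (C, B) has created a spare closing for all positions up to [ga], and it
    compensates for the loss of [d]. An opening freed nevertheless would already have been unmatched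
    before [c]. *)
Let rmv_no_gain d : ins B ga d -> d <= ga ->
  (forall k, unL N (rmv C c) (rmv (ins B ga) d) k = unL N C B k && (k != c)) /\
  [/\ forall k, d < k <= ga ->
        closes N (rmv C c) (rmv (ins B ga) d) k = (closes N C B k).+1,
      forall k, k <= d ->
        closes N (rmv C c) (rmv (ins B ga) d) k = closes N C B k &
      forall k, ga < k ->
        closes N (rmv C c) (rmv (ins B ga) d) k = closes N C B k].
Proof.
move=> Bd dga; have [gac Cga nga] := fc.
have [ea eb] := estep_closes bC bB gCB mc fc.
have el := estep_unL bC bB gCB mc fc.
have [h0 [[h h']|[q [qd Cq q1 _]]]] := unL_rmv bC1 bB2 Bd.
  split=> [k|]; first by rewrite h el.
  split=> k kd.
  - by rewrite h0 ?eb //; nlia.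
  - by have := h' k kd; rewrite eb; nlia.
  - by rewrite h0 ?ea //; nlia.
have : unL N C B q by move: Cq q1 => /andP[Cq _]; rewrite eb /unL ?Cq //=; nlia.
by rewrite L2lt //; nlia.
Qed.

(** The counterpart for (B, A): the spare closing created at [be] serves the new opening [d]. An
    opening displaced nevertheless would already have been unmatched before [b]. *)
Let ins_no_gain d : 0 < d -> B d = false -> d < be ->
  (forall k, unL N (ins (rmv B b) d) (ins A be) k = unL N B A k && (k != b)) /\
  [/\ forall k, d < k <= be ->
        closes N (ins (rmv B b) d) (ins A be) k = (closes N B A k).+1,
      forall k, k <= d ->
        closes N (ins (rmv B b) d) (ins A be) k = closes N B A k &
      forall k, be < k ->
        closes N (ins (rmv B b) d) (ins A be) k = closes N B A k].
Proof.
move=> d0 Bd dbe; have [bec Bbe nbe] := fb.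
have [_ _ bN _] := minL_bounds bB mb fb.
have [ea eb] := estep_closes bB bA gBA mb fb.
have el := estep_unL bB bA gBA mb fb.
have dN : 0 < d <= N by nlia.
have Bd' : rmv B b d = false by rewrite /rmv Bd.
have [h0 [[h [h' h'']]|[q [qd [[-> q1]|[qd' Bq q1]] _]]]] := unL_ins bB1 bA1 dN Bd'.
- split=> [k|]; first by rewrite h el.
  split=> k kd.
  + by rewrite h0 ?eb //; nlia.
  + by have := h'' k kd; rewrite eb; nlia.
  + by rewrite h0 ?ea //; nlia.
- by move: q1; rewrite eb //; nlia.
have : unL N B A q by move: Bq q1 => /andP[Bq _]; rewrite eb /unL ?Bq //=; nlia.
by rewrite L1lt //; nlia.
Qed.

(** The freed opening [q] is above [c], so [c] stays first; [e] is the next unmatched opening of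
    [C]. Both paths take [c] before [e] in [C], while in [B] one takes [b] then [p] and the other
    [p] then [b]. *)
Let octagon_above : c < b -> octagon_paths.
Proof.
move=> cb.
have [Eb1 chain1 Abe Ebe _] := minL_chain bB bA gBA mb fb.
have [Ec1 chain2 _ Ega _] := minL_chain bC bB gCB mc fc.
have [bec Bbe nbe] := fb; have [gac Cga nga] := fc.
have [Lb _] := mb; have [Lc _] := mc.
have gabe : ga < be.
  by rewrite ltnNge; apply/negP => h; have := Bbe ga ltac:(nlia); rewrite Bga.
have [q [qb Cq Eq1 [Eq _ Lq hq]]] := gainRE.
have [p [pga Hp [Ep Ep' Lp hp]]] := gainIE.
have cq : c < q.
  rewrite ltnNge; apply/negP => qc.
  have [e|ne] := eqVneq q c; first by move: Eq1; rewrite e Ec1.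
  by have := Eq c.+1 ltac:(nlia); rewrite Ec1.
have m1 : minL N C (rmv B b) c.
  split; first by rewrite hq Lc.
  by move=> k kc; rewrite hq L2lt //=; nlia.
have Cy2 := Cl2 Cy1 m1 fc.
have [_ bY2 _] := Clb Cy2; have [_ gY1] := Clg Cy1; have [_ gY2] := Clg Cy2.
have ly2 k : unL N (rmv C c) (ins (rmv B b) ga) k =
    (unL N C B k || (k == q)) && (k != c).
  by rewrite (estep_unL bC bB1 gY1 m1 fc) hq.
have Lq2 : unL N (rmv C c) (ins (rmv B b) ga) q by rewrite ly2 eqxx orbT /=; nlia.
have [e me] := nL_min (nL_gt0 bC1 Lq2).
have [Le ne] := me.
have [ec eq] : c < e /\ e <= q.
  split; last by rewrite leqNgt; apply/negP => /ne; rewrite Lq2.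
  move: Le; rewrite ly2 => /andP[/orP[Le|/eqP->//] enc].
  by case: (ltngtP e c) enc => // /L2lt; rewrite Le.
have Ce : rmv C c e by have /andP[] := Le.
have [ep fe] := foot_ex bC1 Ce.
have [epe Cep nep] := fe.
have cep : c < ep.
  rewrite ltnNge; apply/negP => h; have := Cep c ltac:(nlia).
  by rewrite /rmv eqxx andbF.
have [_ _ Bep _ _] := minL_chain bC1 bY2 gY2 me fe.
have Bep' : B ep = false.
  by move: Bep; rewrite ins_neq ?rmv_neq //; nlia.
have epbe : ep < be.
  by rewrite ltnNge; apply/negP => h; have := Bbe ep ltac:(nlia); rewrite Bep'.
have Cy3 := Cl2 Cy2 me fe.
have [_ bY3 _] := Clb Cy3.
have gaN0 : 0 < ga by nlia.
have [ly2' [E2a E2b E2c]] := ins_no_gain gaN0 Bga gabe.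
have [_ _ bN _] := minL_bounds bB mb fb.
have epN : 0 < ep <= N by nlia.
have Lp' : unL N (ins B ga) A p by rewrite hp eqxx orbT.
have := unL_ins bY2 bA1 epN Bep.
set B3 := ins (ins (rmv B b) ga) ep => - [h0 hcase].
(* The spare closing at [be] is used up by the opening inserted at [ep], so up to [ga] the matching
   is that of [ins B ga] against [A]. *)
have E3ga : closes N B3 (ins A be) ga.+1 = closes N B A ga.+1.
  case: hcase => [[_ [_ h]]|[q' [q'ep hq' [h1 _ _ _]]]].
    by have := h ga.+1 ltac:(nlia); rewrite E2a; nlia.
  suff q'ga : q' <= ga by have := h1 ga.+1 ltac:(nlia); rewrite E2a; nlia.
  rewrite leqNgt; apply/negP => gaq'.
  case: hq' => [[eqep ]|[q'ep' Bq']]; first by rewrite E2a //; nlia.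
  rewrite E2a; last nlia.
  move: Bq'; rewrite ins_neq ?rmv_neq => *; try nlia.
  have : unL N B A q' by rewrite /unL; apply/andP; split=> //; nlia.
  by rewrite L1lt //; nlia.
have l3 k : k <= ga -> unL N B3 (ins A be) k = unL N (ins B ga) A k.
  have eU j : j < ga.+1 -> B3 j = ins B ga j.
    move=> jga; rewrite /B3 ins_neq; last nlia.
    by rewrite ins_rmv ?b_neq_ga // rmv_neq //; nlia.
  have eV j : j < ga.+1 -> ins A be j = A j by move=> jga; rewrite ins_neq //; nlia.
  move=> kga; have e' : closes N B3 (ins A be) ga.+1 = closes N (ins B ga) A ga.+1.
    by rewrite E3ga Ep'.
  by rewrite /unL eU ?(closes_below bB2 bA bY3 bA1 eU eV e') //; nlia.
have Lp3 : unL N B3 (ins A be) p by rewrite l3.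
have mp3 : minL N B3 (ins A be) p.
  by split=> // k kp; rewrite l3 ?hp ?L1lt //=; nlia.
have mp : minL N (ins B ga) A p.
  by split=> // k kp; rewrite hp L1lt //=; nlia.
have Bp : ins B ga p by have /andP[] := Lp'.
have [pi fpi] := foot_ex bB2 Bp.
have fpi3 : foot B3 p pi.
  apply: foot_ext fpi _ => k kp; rewrite /B3 ins_neq; last nlia.
  by rewrite ins_rmv ?b_neq_ga // rmv_neq //; nlia.
have nY3 : nL N B3 (ins A be) = (nL N (rmv B b) (ins A be)).+1.
  have eY2 : nL N (ins (rmv B b) ga) (ins A be) = nL N (rmv B b) (ins A be).
    by apply: nL_eq => k; rewrite ly2' (estep_unL bB bA gBA mb fb).
  case: hcase => [[h _]|[q' [_ _ [_ _ Lq' h]]]]; last by rewrite (nL_add bY3 Lq' h) eY2.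
  by move: Lp3; rewrite h ly2' Lp.
have [gz1 _] := Clg Cz1.
have Cz2 := Cl1 Cz1 mp fpi.
have lz2 k : unL N (rmv (ins B ga) p) (ins A pi) k = unL N B A k.
  rewrite (estep_unL bB2 bA gz1 mp fpi) hp.
  by case: eqP => [->|_]; rewrite ?andbF ?Lp // orbF andbT.
have mb2 : minL N (rmv (ins B ga) p) (ins A pi) b by apply: minL_ext mb.
have fb2 : foot (rmv (ins B ga) p) b be.
  apply: foot_ext fb _ => k kb; have [ek|nk] := eqVneq k ga.
    have pe : p = ga.
      have : unL N (ins B ga) A ga.
        rewrite /unL Ep' // /ins eqxx orbT /=.
        by rewrite (_ : ga.+1 = be) ?Ebe //; clear -gabe kb ek; lia.
      by rewrite hp /unL Bga /= => /eqP.
    by rewrite ek pe /rmv eqxx andbF Bga.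
  by rewrite rmv_neq ?ins_neq //; nlia.
have [lz3 [E3a E3b E3c]] := rmv_no_gain Bp pga.
have bZ2 : bounded N (rmv (ins B ga) p) by exact: rmv_bounded.
have Bb2 : rmv (ins B ga) p b by rewrite rmv_neq //; nlia.
have := unL_rmv bC1 bZ2 Bb2; set D3 := rmv (rmv (ins B ga) p) b => - [h0' hcase'].
have Lq3 : unL N (rmv C c) D3 q.
  have eU j : c.+1 <= j -> rmv C c j = C j by move=> cj; rewrite rmv_neq //; nlia.
  have eV j : c.+1 <= j -> D3 j = rmv B b j.
    move=> cj; rewrite /D3 /rmv /ins (_ : j == ga = false); last nlia.
    by rewrite (_ : j != p) ?orbF ?andbT //; nlia.
  have bD3 : bounded N D3 by exact: rmv_bounded.
  rewrite /unL eU // (closes_above bC bB1 bC1 bD3 eU eV); last nlia.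
  by have := hq q; rewrite eqxx orbT.
have [lz4 nz4] : (forall k, unL N (rmv C c) D3 k =
      (unL N C B k || (k == q)) && (k != c)) /\
    nL N (rmv C c) D3 = (nL N (rmv C c) (ins B ga)).+1.
  case: hcase' => [[h _]|[q' [_ _ _ [_ _ Lq' h]]]].
    by move: Lq3; rewrite h lz3 Lq.
  have eqq : q' = q by move: Lq3; rewrite h lz3 Lq /= => /eqP.
  split=> [k|].
    rewrite h lz3 eqq; have [->|_] := eqVneq k q; last by rewrite !orbF.
    by rewrite !orbT /=; nlia.
  rewrite (nL_add bC1 Lq' h); congr _.+1; apply: nL_eq => k.
  by rewrite lz3 (estep_unL bC bB gCB mc fc).
have me3 : minL N (rmv C c) D3 e.
  by apply: minL_ext me => k; rewrite lz4 ly2.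
exists c, ga, e, ep, p, pi, p, pi, b, be, e, ep; cbv zeta.
split=> //; split=> //; exact: insC.
Qed.

(** Now [q < b < p]: in [B] both paths take [b] before [d], the next unmatched opening, while in [C]
    one takes [q] then [c] and the other [c] then [q]. *)
Let octagon_below : b < ga -> octagon_paths.
Proof.
move=> bga.
have [Eb1 chain1 Abe Ebe _] := minL_chain bB bA gBA mb fb.
have [Ec1 chain2 _ Ega _] := minL_chain bC bB gCB mc fc.
have [bec Bbe nbe] := fb; have [gac Cga nga] := fc.
have [Lb _] := mb; have [Lc _] := mc.
have [q [qb Cq Eq1 [Eq Eq' Lq hq]]] := gainRE.
have [p [pga Hp [Ep Ep' Lp hp]]] := gainIE.
have bp : b < p.
  rewrite ltnNge; apply/negP => pb; case: Hp => [[? _]|[pga' _ Ep1]]; first nlia.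
  have [e|ne] := eqVneq p b; first by move: Ep1; rewrite e Eb1.
  by have := Ep b.+1 ltac:(nlia); rewrite Eb1.
have m1 : minL N C (rmv B b) q.
  split; first by rewrite hq eqxx orbT.
  by move=> k kq; rewrite hq L2lt //=; nlia.
have [eta fe] := foot_ex bC Cq.
have [etq Ceta neta] := fe.
have [_ gY1] := Clg Cy1.
have [_ _ Beta _ _] := minL_chain bC bB1 gY1 m1 fe.
have Beta' : B eta = false by move: Beta; rewrite rmv_neq //; nlia.
have etbe : eta < be.
  by rewrite ltnNge; apply/negP => h; have := Bbe eta ltac:(nlia); rewrite Beta'.
have et0 : 0 < eta by have /bC/andP[] : C eta by apply: Ceta; nlia.
have Cy2 := Cl2 Cy1 m1 fe.
have [_ bY2 bC2] := Clb Cy2.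
have ly2 k : unL N (rmv C q) (ins (rmv B b) eta) k = unL N C B k.
  rewrite (estep_unL bC bB1 gY1 m1 fe) hq.
  by case: eqP => [->|_]; rewrite ?andbF ?Lq // orbF andbT.
have m2 : minL N (rmv C q) (ins (rmv B b) eta) c by apply: minL_ext mc.
have f2 : foot (rmv C q) c ga.
  by apply: foot_ext fc _ => k kc; rewrite rmv_neq //; nlia.
have Cy3 := Cl2 Cy2 m2 f2.
have [_ bY3 _] := Clb Cy3.
have [ly2' _] := ins_no_gain et0 Beta' etbe.
have Bga2 : ins (rmv B b) eta ga = false by rewrite ins_neq ?rmv_neq //; nlia.
have Lp' : unL N (ins B ga) A p by rewrite hp eqxx orbT.
have := unL_ins bY2 bA1 gaN Bga2.
set B3 := ins (ins (rmv B b) eta) ga => - [h0 hcase].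
have eB3 k : k != b -> k != eta -> B3 k = ins B ga k.
  by move=> kb ke; rewrite /B3 insC ins_neq // ins_rmv ?b_neq_ga // rmv_neq.
have Lp3 : unL N B3 (ins A be) p.
  have eU j : b.+1 <= j -> B3 j = ins B ga j by move=> bj; apply: eB3; nlia.
  have eV j : b.+1 <= j -> ins A be j = A j by move=> bj; rewrite ins_neq //; nlia.
  rewrite /unL eU // (closes_above bB2 bA bY3 bA1 eU eV); last nlia.
  by move: Lp'.
have [lz3 nY3] : (forall k, unL N B3 (ins A be) k =
      (unL N B A k || (k == p)) && (k != b)) /\
    nL N B3 (ins A be) = (nL N (rmv B b) (ins A be)).+1.
  case: hcase => [[h _]|[p' [_ _ [_ _ Lp'' h]]]].
    by move: Lp3; rewrite h ly2' Lp.
  have epp : p' = p by move: Lp3; rewrite h ly2' Lp /= => /eqP.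
  split=> [k|].
    rewrite h ly2' epp; have [->|_] := eqVneq k p; last by rewrite !orbF.
    by rewrite !orbT /=; nlia.
  rewrite (nL_add bY3 Lp'' h); congr _.+1; apply: nL_eq => k.
  by rewrite ly2' (estep_unL bB bA gBA mb fb).
have [d md] := nL_min (nL_gt0 bY3 Lp3).
have [Ld nd] := md.
have dp : d <= p by rewrite leqNgt; apply/negP => /nd; rewrite Lp3.
have bd : b < d.
  move: Ld; rewrite lz3 => /andP[/orP[Ld|/eqP->//] dnb].
  by case: (ltngtP d b) dnb => // /L1lt; rewrite Ld.
have Bd : B3 d by have /andP[] := Ld.
have [de fd] := foot_ex bY3 Bd.
have [dde Bde nde] := fd.
have bde : b < de.
  rewrite ltnNge; apply/negP => h; have := Bde b ltac:(nlia).
  by rewrite /B3 ins_neq ?ins_neq ?b_neq_ga ?/rmv ?eqxx ?andbF //; nlia.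
have mz1 : minL N (ins B ga) A b.
  split; first by rewrite hp Lb.
  by move=> k kb; rewrite hp L1lt //=; nlia.
have fz1 : foot (ins B ga) b be.
  by apply: foot_ext fb _ => k kb; rewrite ins_neq //; nlia.
have [gz1 _] := Clg Cz1.
have md2 : minL N (rmv (ins B ga) b) (ins A be) d.
  apply: minL_ext md => k.
  by rewrite (estep_unL bB2 bA gz1 mz1 fz1) hp lz3.
have fd2 : foot (rmv (ins B ga) b) d de.
  apply: foot_ext fd _ => k kd; rewrite /B3 insC ins_neq; last nlia.
  by rewrite ins_rmv ?b_neq_ga.
have Bb2 : ins B ga b by rewrite ins_neq ?b_neq_ga.
have bga' : b <= ga by nlia.
have [lz2 [E2a E2b E2c]] := rmv_no_gain Bb2 bga'.
have bZ2 : bounded N (rmv (ins B ga) b) by exact: rmv_bounded.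
have Bd2 : rmv (ins B ga) b d by have [/andP[]] := md2.
have := unL_rmv bC1 bZ2 Bd2; set D3 := rmv (rmv (ins B ga) b) d => - [h0' hcase'].
have bD3 : bounded N D3 by exact: rmv_bounded.
(* The spare closing created at [ga] makes up for the deletion of [d], so up to [b] the matching is
   that of [C] against [rmv B b]. *)
have E3b : closes N (rmv C c) D3 b.+1 = closes N C (rmv B b) b.+1.
  rewrite Eq' //.
  suff h : closes N (rmv C c) (rmv (ins B ga) b) b.+1 =
           (closes N (rmv C c) D3 b.+1).+1.
    by move: h; rewrite E2a; nlia.
  case: hcase' => [[_ h]|[q' [q'd Cq' q1 [h1 _ _ _]]]]; first by apply: h; nlia.
  apply: h1; suff : q' <= b by nlia.
  rewrite leqNgt; apply/negP => bq'; move: q1; rewrite E2a; last nlia.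
  case=> q1; have : unL N C B q' by move: Cq' => /andP[Cq' _]; rewrite /unL Cq' q1.
  by rewrite L2lt //; nlia.
have Lq3 : unL N (rmv C c) D3 q.
  have eU j : j < b.+1 -> rmv C c j = C j by move=> cj; rewrite rmv_neq //; nlia.
  have eV j : j < b.+1 -> D3 j = rmv B b j.
    move=> cj; rewrite /D3 rmv_neq; last nlia.
    by rewrite -ins_rmv ?b_neq_ga // ins_neq //; nlia.
  rewrite /unL eU ?(closes_below bC bB1 bC1 bD3 eU eV E3b); try nlia.
  by have := hq q; rewrite eqxx orbT.
have [lz4 nz4] : (forall k, unL N (rmv C c) D3 k =
      (unL N C B k && (k != c)) || (k == q)) /\
    nL N (rmv C c) D3 = (nL N (rmv C c) (ins B ga)).+1.
  case: hcase' => [[h _]|[q' [_ _ _ [_ _ Lq' h]]]].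
    by move: Lq3; rewrite h lz2 Lq.
  have eqq : q' = q by move: Lq3; rewrite h lz2 Lq /= => /eqP.
  split=> [k|]; first by rewrite h lz2 eqq.
  rewrite (nL_add bC1 Lq' h); congr _.+1; apply: nL_eq => k.
  by rewrite lz2 (estep_unL bC bB gCB mc fc).
have mq3 : minL N (rmv C c) D3 q.
  split=> // k kq; rewrite lz4 L2lt //=; nlia.
have fq3 : foot (rmv C c) q eta.
  by apply: foot_ext fe _ => k kq; rewrite rmv_neq //; nlia.
exists q, eta, c, ga, d, de, b, be, d, de, q, eta; cbv zeta.
by split=> //; split=> //; exact: rmvC.
Qed.

(** The two runs overlap: [B] contains [(ga, c]], which forces [be = ga + 1], [p = ga] and
    [q = b - 1]. Each path brings the middle set back to an earlier value, [ins B ga] on one side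
    and [B] on the other. *)
Let octagon_middle : ga < b <= c -> octagon_paths.
Proof.
move=> gabc.
have [Eb1 chain1 Abe Ebe _] := minL_chain bB bA gBA mb fb.
have [Ec1 chain2 _ Ega _] := minL_chain bC bB gCB mc fc.
have [bec Bbe nbe] := fb; have [gac Cga nga] := fc.
have [Lb _] := mb; have [Lc _] := mc.
have bebga : be = ga.+1.
  apply: (foot_uniq bB fb); split; [nlia | |by rewrite Bga].
  by move=> k kb; have [] := chain2 k ltac:(nlia).
have [q [qb Cq Eq1 [Eq Eq' Lq hq]]] := gainRE.
have [p [pga Hp [Ep Ep' Lp hp]]] := gainIE.
have epga : p = ga.
  have : unL N (ins B ga) A ga by rewrite /unL Ep' // /ins eqxx orbT -bebga Ebe.
  by rewrite hp /unL Bga /= => /eqP.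
have {}hp k : unL N (ins B ga) A k = unL N B A k || (k == ga).
  by rewrite hp epga.
have eqb : q = b.-1.
  have Eb : closes N C B b = 1 by have [] := chain2 b ltac:(nlia).
  have eb : b.-1.+1 = b by nlia.
  have : unL N C (rmv B b) b.-1.
    rewrite /unL Cga /= ?eb; last nlia.
    by have := Eq b ltac:(nlia); rewrite Eb; nlia.
  by rewrite hq L2lt /= => [/eqP|]; nlia.
have m1 : minL N C (rmv B b) b.-1.
  split; first by rewrite hq eqb eqxx orbT.
  by move=> k kq; rewrite hq L2lt //=; nlia.
have f1 : foot C b.-1 ga.
  by split=> [|k kb|//]; [nlia|apply: Cga; nlia].
have [_ gY1] := Clg Cy1.
have ly2 k : unL N (rmv C b.-1) (ins (rmv B b) ga) k = unL N C B k.
  rewrite (estep_unL bC bB1 gY1 m1 f1) hq eqb.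
  by case: eqP => [->|_]; rewrite ?andbF -?eqb ?Lq // orbF andbT.
have m2 : minL N (rmv C b.-1) (ins (rmv B b) ga) c by apply: minL_ext mc.
have f2 : foot (rmv C b.-1) c b.
  split; first nlia; last by rewrite /rmv eqxx andbF.
  by move=> k kb; rewrite rmv_neq ?Cga //; nlia.
have eB3 : ins (ins (rmv B b) ga) b = ins B ga.
  apply: funext => k; rewrite /ins /rmv; case: eqP => [->|_].
    by rewrite Bb !orbT.
  by rewrite andbT orbF.
have eD2 : rmv (ins B ga) ga = B.
  apply: funext => k; rewrite /ins /rmv; case: eqP => [->|_].
    by rewrite Bga orbT.
  by rewrite orbF andbT.
have l3 k : unL N (ins B ga) (ins A be) k = unL N B A k.
  have eU j : be.+1 <= j -> ins B ga j = B j by move=> bj; rewrite ins_neq //; nlia.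
  have eV j : be.+1 <= j -> ins A be j = A j by move=> bj; rewrite ins_neq //; nlia.
  have Eab := closes_above bB bA bB2 bA1 eU eV.
  have Ebe3 : closes N (ins B ga) (ins A be) be = 1.
    move: Ebe; rewrite !(closes_rec be) // Eab // Abe /ins eqxx orbT.
    by rewrite (_ : be == ga = false) ?orbF; nlia.
  have Ega3 : closes N (ins B ga) (ins A be) ga = closes N B A ga.
    rewrite !(closes_rec ga) // -bebga Ebe Ebe3 /ins eqxx Bga.
    by rewrite (_ : ga == be = false) ?orbF //; nlia.
  case: (ltngtP k ga) => [kga|kga|->].
  - have eU' j : j < ga -> ins B ga j = B j by move=> bj; rewrite ins_neq //; nlia.
    have eV' j : j < ga -> ins A be j = A j by move=> bj; rewrite ins_neq //; nlia.
    by rewrite /unL eU' ?(closes_below bB bA bB2 bA1 eU' eV' Ega3) //; nlia.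
  - by rewrite /unL Eab ?ins_neq //; nlia.
  - by rewrite /unL -bebga Ebe3 Bga andbF.
have mb3 : minL N (ins B ga) (ins A be) b by apply: minL_ext mb.
have [pi fpi] : exists pi, foot (ins B ga) ga pi.
  by apply: (foot_ex bB2); rewrite /ins eqxx orbT.
(* Inserting [ga] joins the run of [B] that ends at [b] to the run below [ga], so [b] and [ga] have
   the same foot. *)
have fpib : foot (ins B ga) b pi.
  have [piga Bpi npi] := fpi; split=> //; first nlia.
  move=> k kb; case: (leqP k ga) => kga; first by apply: Bpi; nlia.
  by rewrite ins_neq; [apply: Bbe|]; nlia.
have mz1 : minL N (ins B ga) A ga.
  split; first by rewrite hp eqxx orbT.
  by move=> k kga; rewrite hp L1lt //=; nlia.
have [gz1 _] := Clg Cz1.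
have Lga : unL N B A ga = false by rewrite L1lt //; nlia.
have mz2 : minL N B (ins A pi) b.
  apply: minL_ext mb => k; rewrite -{1}eD2 (estep_unL bB2 bA gz1 mz1 fpi) hp.
  by case: eqP => [->|_]; rewrite ?andbF ?Lga // orbF andbT.
have Bga2 : ins B ga ga by rewrite /ins eqxx orbT.
have [lz2 [E2a E2b E2c]] := rmv_no_gain Bga2 (leqnn ga).
rewrite eD2 in lz2 E2a E2b E2c.
have [h0 hcase] := unL_rmv bC1 bB Bb.
have Ezb : closes N (rmv C c) B b = 1.
  by rewrite E2c; [have [] := chain2 b ltac:(nlia) | nlia].
have Lb1 : unL N (rmv C c) B b.-1 = false by rewrite lz2 L2lt //; nlia.
have Ez3 : closes N (rmv C c) B b = (closes N (rmv C c) (rmv B b) b).+1 ->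
    unL N (rmv C c) (rmv B b) b.-1.
  rewrite Ezb /unL (_ : b.-1.+1 = b); last nlia.
  by case=> <-; rewrite rmv_neq ?Cga //; nlia.
have [lz4 nz4] : (forall k, unL N (rmv C c) (rmv B b) k =
      (unL N C B k && (k != c)) || (k == b.-1)) /\
    nL N (rmv C c) (rmv B b) = (nL N (rmv C c) (ins B ga)).+1.
  case: hcase => [[h h']|[q' [q'b _ _ [h1 _ Lq' h]]]].
    by have := Ez3 (h' b (leqnn b)); rewrite h Lb1.
  have := Ez3 (h1 b ltac:(nlia)); rewrite h Lb1 /= => /eqP eq'.
  split=> [k|]; first by rewrite h lz2 eq'.
  rewrite (nL_add bC1 Lq' h); congr _.+1; apply: nL_eq => k.
  by rewrite lz2 (estep_unL bC bB gCB mc fc).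
have m3 : minL N (rmv C c) (rmv B b) b.-1.
  split; first by rewrite lz4 eqxx orbT.
  by move=> k kq; rewrite lz4 L2lt //=; nlia.
have f3 : foot (rmv C c) b.-1 ga.
  by apply: foot_ext f1 _ => k kb; rewrite rmv_neq //; nlia.
exists b.-1, ga, c, b, b, pi, ga, pi, b, be, b.-1, ga; cbv zeta.
rewrite eB3 eD2; split=> //; split=> //; first exact: insC.
  exact: rmvC.
split=> //; rewrite (nL_eq (U := B) (V := A)) //.
exact: estep_nL fb.
Qed.

Lemma octagon : octagon_paths.
Proof.
case: (ltnP c b) => cb; first exact: octagon_above.
case: (ltnP b ga) => bga; first exact: octagon_below.
by apply: octagon_middle; have := b_neq_ga; nlia.
Qed.

End Triple.

(** * Crystals of tuples of finite sets *)

Lemma string_lengthE T (g : T -> option T) y k :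
  is_string_length g y k -> string_length g y = k.
Proof.
have none n j : ~~ iter n (obind g) (Some y) -> ~~ iter (n + j) (obind g) (Some y).
  move=> h; elim: j => [|j IHj]; rewrite ?addn0 // addnS iterS.
  by case: (iter _ _ _) IHj.
move=> hk; rewrite /string_length; case: xgetP => [l _ hl|/(_ k)//].
case: hk hl => [k1 k2] [l1 l2]; case: (ltngtP l k) => // lk.
- by have := none _ (k - l.+1) l2; rewrite subnKC // k1.
- by have := none _ (l - k.+1) k2; rewrite subnKC // l1.
Qed.

Lemma is_string_lengthS T (g : T -> option T) y z k : g y = Some z ->
  is_string_length g z k -> is_string_length g y k.+1.
Proof. by move=> e [h1 h2]; split; rewrite iterSr /= e. Qed.

Lemma is_string_length0 T (g : T -> option T) y : g y = None ->
  is_string_length g y 0.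
Proof. by move=> e; split=> //=; rewrite e. Qed.

Lemma nset_rmv N U b : bounded N U -> U b -> nset N U = (nset N (rmv U b)).+1.
Proof.
move=> bU Ub; have bN := bU _ Ub.
apply: (count_add1 (q := b)); rewrite ?iota_uniq ?mem_iota //; first lia.
  by rewrite /rmv eqxx andbF.
by move=> k; rewrite /rmv; case: eqP => [->|]; rewrite ?Ub ?andbT ?orbF.
Qed.

Lemma nset_ins N V c : 0 < c <= N -> V c = false ->
  nset N (ins V c) = (nset N V).+1.
Proof.
move=> cN Vc.
by apply: (count_add1 (q := c)); rewrite ?iota_uniq ?mem_iota //; lia.
Qed.

Section Model.
Variables m N : nat.

(* What factorizations (with the ranks of the letters of each factor) and
   tableaux (with the positions of each letter in the reading word) have in
   common; both crystal structures are derived from it.  By [sm_inj] all the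
   sets but one determine the vertex. *)
Record set_model (G : colored_graph m) (enc : G -> 'I_m -> nat -> bool) : Prop :=
  SetModel {
    sm_bounded : forall y i, cvert y -> bounded N (enc y i);
    sm_good : forall y r, cvert y -> good (enc y (hi r)) (enc y (lo r));
    sm_e0 : forall y r, cvert y ->
      nL N (enc y (hi r)) (enc y (lo r)) = 0 -> ce r y = None;
    sm_eS : forall y r b c, cvert y ->
      minL N (enc y (hi r)) (enc y (lo r)) b -> foot (enc y (hi r)) b c ->
      exists z, [/\ ce r y = Some z, cvert z & forall i, enc z i =
        if i == hi r then rmv (enc y i) b
        else if i == lo r then ins (enc y i) c else enc y i];
    sm_f0 : forall y r, cvert y ->
      nR N (enc y (hi r)) (enc y (lo r)) = 0 -> cf r y = None;
    sm_fS : forall y r a c, cvert y ->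
      maxR (enc y (hi r)) (enc y (lo r)) a -> crest (enc y (lo r)) a c ->
      exists z, [/\ cf r y = Some z, cvert z & forall i, enc z i =
        if i == hi r then ins (enc y i) c
        else if i == lo r then rmv (enc y i) a else enc y i];
    sm_inj : forall y z i0, cvert y -> cvert z ->
      (forall i, i != i0 -> enc y i = enc z i) -> y = z;
    sm_wt : forall y i, cvert y -> cwt y i = Posz (nset N (enc y i)) }.

Arguments sm_bounded {G enc} _ {y} i _.
Arguments sm_good {G enc} _ {y} r _.

Lemma lo_neq_hi (r : 'I_m.-1) : (lo r == hi r) = false.
Proof. by apply/negbTE/eqP => /(congr1 val) /=; lia. Qed.

Lemma hi_rev (r : 'I_m.-1) : hi (rev_ord r) = rev_ord (lo r).
Proof. by apply: val_inj => /=; have := ltn_ord r; lia. Qed.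

Lemma lo_rev (r : 'I_m.-1) : lo (rev_ord r) = rev_ord (hi r).
Proof. by apply: val_inj => /=; have := ltn_ord r; lia. Qed.

Lemma hi_inj : injective (@hi m).
Proof. by move=> i j /(congr1 val) [] /val_inj. Qed.

Lemma lo_inj : injective (@lo m).
Proof. by move=> i j /(congr1 val) /= /val_inj. Qed.

Section Raising.
Variables (G : colored_graph m) (enc : G -> 'I_m -> nat -> bool).
Hypothesis M : set_model enc.
Implicit Types (y z : G) (r i j : 'I_m.-1).

Notation nLr r y := (nL N (enc y (hi r)) (enc y (lo r))).

Lemma model_e y z r : cvert y -> ce r y = Some z ->
  exists b c, [/\ minL N (enc y (hi r)) (enc y (lo r)) b, foot (enc y (hi r)) b c,
    cvert z & forall i : 'I_m, enc z i =
        if i == hi r then rmv (enc y i) b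
        else if i == lo r then ins (enc y i) c else enc y i].
Proof.
move=> vy eyz; have [n0|np] := posnP (nLr r y).
  by move: eyz; rewrite (sm_e0 M).
have [b mb] := nL_min np; have [/andP[Ub _] _] := mb.
have [c fc] := foot_ex (sm_bounded M (hi r) vy) Ub.
have [z' [ez' vz' hz']] := sm_eS M vy mb fc.
by move: eyz; rewrite ez' => -[<-]; exists b, c.
Qed.

Lemma model_e_vert y z r : cvert y -> ce r y = Some z -> cvert z.
Proof. by move=> vy /(model_e vy)[b [c []]]. Qed.

Lemma model_e_hi y z r b c : cvert y -> (forall i : 'I_m, enc z i =
        if i == hi r then rmv (enc y i) b
        else if i == lo r then ins (enc y i) c else enc y i) ->
  enc z (hi r) = rmv (enc y (hi r)) b /\ enc z (lo r) = ins (enc y (lo r)) c.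
Proof. by move=> vy h; rewrite !h !eqxx lo_neq_hi. Qed.

Lemma model_e_nL y z r : cvert y -> ce r y = Some z -> nLr r y = (nLr r z).+1.
Proof.
move=> vy /(model_e vy)[b [c [mb fc vz /(model_e_hi vy)[-> ->]]]].
exact: (estep_nL (sm_bounded M _ vy) (sm_bounded M _ vy) (sm_good M r vy) mb fc).
Qed.

Lemma model_eP y r : cvert y -> 0 < nLr r y -> exists z, ce r y = Some z.
Proof.
move=> vy np; have [b mb] := nL_min np; have [/andP[Ub _] _] := mb.
have [c fc] := foot_ex (sm_bounded M (hi r) vy) Ub.
by have [z' [ez' _ _]] := sm_eS M vy mb fc; exists z'.
Qed.

Lemma model_string y r : cvert y -> is_string_length (ce r) y (nLr r y).
Proof.
move En : (nLr r y) => n; elim: n y En => [|n IHn] y En vy.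
  by apply: is_string_length0; apply: (sm_e0 M).
have [z eyz] : exists z, ce r y = Some z by apply: model_eP => //; rewrite En.
apply: (is_string_lengthS eyz); apply: IHn (model_e_vert vy eyz).
by have := model_e_nL vy eyz; rewrite En => -[].
Qed.

Lemma model_eps y r : cvert y -> eps r y = nLr r y.
Proof. by move=> vy; apply/string_lengthE/model_string. Qed.

Lemma model_inv y z r : cvert y -> ce r y = Some z -> cf r z = Some y.
Proof.
move=> vy eyz; have [b [c [mb fc vz hz]]] := model_e vy eyz.
have [eh el] := model_e_hi vy hz.
have bU := sm_bounded M (hi r) vy; have bV := sm_bounded M (lo r) vy.
have gUV := sm_good M r vy.
have mz : maxR (enc z (hi r)) (enc z (lo r)) c.
  by rewrite eh el; apply: (estep_maxR bU bV gUV mb fc).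
have cz : crest (enc z (lo r)) c b.
  by rewrite el; apply: (estep_crest bU bV gUV mb fc).
have [y' [ey' vy' hy']] := sm_fS M vz mz cz.
(* It is enough to restore the set at [lo r]; the one at [hi r] is then determined. *)
rewrite ey'; congr Some; apply: (sm_inj M (i0 := hi r)) => // i ih.
have [h1 h2] := estep_inv bU bV gUV mb fc.
rewrite hy' hz (negbTE ih); case: eqP => // ->.
exact: h2.
Qed.

Lemma model_e_wt y z r : cvert y -> ce r y = Some z ->
  forall k, (cwt z k = cwt y k + simple_root r k)%R.
Proof.
move=> vy eyz k; have [b [c [mb fc vz hz]]] := model_e vy eyz.
have bU := sm_bounded M (hi r) vy; have bV := sm_bounded M (lo r) vy.
have [? ? ? Ub] := minL_bounds bU mb fc.
have [_ _ Vc _ _] := minL_chain bU bV (sm_good M r vy) mb fc.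
rewrite !(sm_wt M) // hz /simple_root.
have [->|kh] := eqVneq k (hi r).
  rewrite eq_sym lo_neq_hi (nset_rmv bU Ub); lia.
have [->|kl] := eqVneq k (lo r); last by lia.
rewrite nset_ins //; lia.
Qed.

End Raising.

(** The weight is reversed and not negated: lowering with colour [r] adds to position [r + 1] and
    subtracts from position [r], which is what raising with the reversed colour does to the reversed
    weight. *)
Definition dual_graph (G : colored_graph m) : colored_graph m :=
  @ColoredGraph m G (@cvert m G) (fun r => cf (rev_ord r))
    (fun r => ce (rev_ord r)) (fun y i => cwt y (rev_ord i)).

Definition dual_enc (G : colored_graph m) (enc : G -> 'I_m -> nat -> bool) :
    dual_graph G -> 'I_m -> nat -> bool :=
  fun y i => flip N (enc y (rev_ord i)).

Lemma dual_model (G : colored_graph m) (enc : G -> 'I_m -> nat -> bool) :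
  set_model enc -> set_model (dual_enc enc).
Proof.
move=> M; have bd y i (vy : cvert y) := sm_bounded M i vy; have dE y i : dual_enc enc y i =
  flip N (enc y (rev_ord i)) by [].
split=> /=.
- by move=> y i vy; apply: flip_bounded; apply: bd.
- move=> y r vy; rewrite !dE -hi_rev -lo_rev.
  exact: (good_flip (bd _ _ vy) (sm_good M (rev_ord r) vy)).
- move=> y r vy; rewrite !dE -hi_rev -lo_rev nL_flip; try exact: bd.
  exact: (sm_f0 M).
- move=> y r b c vy; rewrite !dE -hi_rev -lo_rev => mb fc.
  have mR := minL_flip (bd _ _ vy) (bd _ _ vy) mb.
  have cR := foot_flip (bd _ _ vy) fc.
  have [z [ez vz hz]] := sm_fS M vy mR cR.
  exists z; split=> // i; rewrite !dE hz.
  have [/andP[Ub _] _] := mb; have := bd _ _ vy _ Ub => bN.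
  have cN : 0 < N.+1 - c <= N.
    have [cb cU _] := fc; have /(bd _ _ vy) ? : enc y (lo (rev_ord r)) (N.+1 - c).
      by apply: cU; lia.
    lia.
  rewrite hi_rev lo_rev !(inj_eq rev_ord_inj).
  have [->|ih] := eqVneq i (lo r).
    by rewrite lo_neq_hi ins_flip // (_ : N.+1 - (N.+1 - c) = c) //; lia.
  case: eqP => [->|//]; rewrite rmv_flip //.
  by rewrite (_ : N.+1 - (N.+1 - b) = b) //; lia.
- move=> y r vy; rewrite !dE -hi_rev -lo_rev nR_flip; try exact: bd.
  exact: (sm_e0 M).
- move=> y r a c vy; rewrite !dE -hi_rev -lo_rev => mb cr.
  have [ac aV nV] := cr.
  have [/andP[Va _] _] := mb; have := bd _ _ vy _ Va => aN.
  have Vc : flip N (enc y (hi (rev_ord r))) c by apply: aV; lia.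
  have cN := bd _ _ vy _ Vc.
  have mb' := maxR_flip (flip_bounded (bd _ _ vy)) (flip_bounded (bd _ _ vy)) mb.
  rewrite !flipK in mb'; try exact: bd.
  have fb' : foot (enc y (hi (rev_ord r))) (N.+1 - a) (N.+1 - c).
    rewrite -(flipK (bd y (hi (rev_ord r)) vy)); apply: crest_flip => //; lia.
  have [z [ez vz hz]] := sm_eS M vy mb' fb'.
  exists z; split=> // i; rewrite !dE hz hi_rev lo_rev !(inj_eq rev_ord_inj).
  have [->|ih] := eqVneq i (lo r).
    by rewrite lo_neq_hi rmv_flip // (_ : N.+1 - (N.+1 - a) = a) //; lia.
  case: eqP => [->|//]; rewrite ins_flip //.
  by rewrite (_ : N.+1 - (N.+1 - c) = c) //; lia.
- move=> y z i0 vy vz h; apply: (sm_inj M (i0 := rev_ord i0)) => // i ii.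
  rewrite -(flipK (bd y i vy)) -(flipK (bd z i vz)); congr flip.
  have := h (rev_ord i); rewrite !dE rev_ordK; apply.
  by apply: contraNneq ii => <-; rewrite rev_ordK.
- by move=> y i vy; rewrite (sm_wt M) // dE nset_flip //; apply: bd.
Qed.

End Model.

Arguments sm_bounded {m N G enc} _ {y} i _.
Arguments sm_good {m N G enc} _ {y} r _.

(** * Crystal axioms and Stembridge's local axioms for set models *)

Section LocalAxioms.
Variables m N : nat.

Section PhiCrystal.
Variables (G : colored_graph m) (enc : G -> 'I_m -> nat -> bool).
Hypothesis M : set_model N enc.
Implicit Types (y z : G) (r i j : 'I_m.-1).

Lemma dual_vertex y : cvert y -> @cvert m (dual_graph G) y. Proof. by []. Qed.

Lemma phi_dual r y : phi r y = @eps m (dual_graph G) (rev_ord r) y.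
Proof. by rewrite /eps /= rev_ordK. Qed.

Lemma model_f_string y r : cvert y ->
  is_string_length (cf r) y (nR N (enc y (hi r)) (enc y (lo r))).
Proof.
move=> vy; have := model_string (dual_model M) (rev_ord r) (dual_vertex vy).
rewrite /dual_enc -hi_rev -lo_rev /= rev_ordK nL_flip //; exact: (sm_bounded M).
Qed.

Lemma model_phi y r : cvert y -> phi r y = nR N (enc y (hi r)) (enc y (lo r)).
Proof. by move=> vy; apply/string_lengthE/model_f_string. Qed.

Lemma model_f_vert y z r : cvert y -> cf r y = Some z -> cvert z.
Proof.
move=> vy fyz; have := @model_e_vert m N _ _ (dual_model M) y z (rev_ord r) vy.
by rewrite /= rev_ordK; apply.
Qed.

Lemma model_f_inv y z r : cvert y -> cf r y = Some z -> ce r z = Some y.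
Proof.
move=> vy fyz; have := @model_inv m N _ _ (dual_model M) y z (rev_ord r) vy.
by rewrite /= rev_ordK; apply.
Qed.

Lemma model_phi_eps r y : cvert y ->
  ((phi r y)%:Z - (eps r y)%:Z = cwt y (lo r) - cwt y (hi r))%R.
Proof.
move=> vy; rewrite model_phi // (model_eps M) // !(sm_wt M) //.
by have := nL_nR (sm_bounded M (hi r) vy) (sm_bounded M (lo r) vy); lia.
Qed.

Lemma model_crystal : crystal_axioms G.
Proof.
split.
- by move=> r y z; apply: (model_e_vert M).
- by move=> r y z; apply: model_f_vert.
- by move=> r y z vy vz; split; [apply: (model_inv M)|apply: model_f_inv].
- by move=> r y vy; exists (nL N (enc y (hi r)) (enc y (lo r))); apply: (model_string M).
- by move=> r y vy; eexists; apply: model_f_string.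
- by move=> r y z vy; apply: (model_e_wt M).
- move=> r y z vy fyz k; have vz := model_f_vert vy fyz.
  by rewrite (model_e_wt M vz (model_f_inv vy fyz)) addrK.
- by move=> r y; apply: model_phi_eps.
Qed.

Lemma simple_root_cartan (i j : 'I_m.-1) : i != j ->
  (simple_root i (lo j) - simple_root i (hi j) = cartan i j)%R.
Proof.
move=> ij; rewrite /simple_root /cartan (negbTE ij).
have ji : (j == i) = false by rewrite eq_sym (negbTE ij).
rewrite (inj_eq (@lo_inj m)) (inj_eq (@hi_inj m)) ji -!val_eqE /=.
by rewrite (eq_sym (j : nat)); case: eqP; case: eqP => /=; lia.
Qed.

(** The difference of phi and epsilon is read off the weight, whose variation is known; hence (P3),
    and from here on only [eps] has to be followed. *)
Lemma phi_change i j y z : cvert y -> i != j -> ce i y = Some z ->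
  ((phi j z)%:Z - (phi j y)%:Z = (eps j z)%:Z - (eps j y)%:Z + cartan i j)%R.
Proof.
move=> vy ij eyz; rewrite -simple_root_cartan //.
have := model_phi_eps j vy; have := model_phi_eps j (model_e_vert M vy eyz).
by rewrite !(model_e_wt M vy eyz); lia.
Qed.

Definition far i j := ~~ ((i.+1 == j :> nat) || (j.+1 == i :> nat)).

Lemma far_pos i j : i != j -> far i j ->
  [/\ (hi j == hi i) = false, (hi j == lo i) = false,
      (lo j == hi i) = false & (lo j == lo i) = false].
Proof.
move=> /eqP ij /norP[/eqP h1 /eqP h2].
have h : (i : nat) <> j by move/val_inj.
by split; apply/negbTE/eqP => /(congr1 val) /=; lia.
Qed.

Lemma cartan_far i j : i != j -> cartan i j = if far i j then 0%R else (-1)%R.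
Proof. by move=> ij; rewrite /cartan (negbTE ij) /far; case: ifP. Qed.

Lemma far_sym i j : far i j = far j i.
Proof. by rewrite /far orbC. Qed.

Section Adjacent.
Variables i j : 'I_m.-1.
Hypothesis ij : i.+1 = j :> nat.

Let lj : lo j = hi i. Proof. exact: val_inj. Qed.
Let hji : (hi j == hi i) = false.
Proof. by apply/negbTE/eqP => /(congr1 val) /=; lia. Qed.
Let hjl : (hi j == lo i) = false.
Proof. by apply/negbTE/eqP => /(congr1 val) /=; lia. Qed.
Let hij : (hi i == hi j) = false. Proof. by rewrite eq_sym hji. Qed.
Let lij : (lo i == hi j) = false. Proof. by rewrite eq_sym hjl. Qed.
Let lhi : (lo i == hi i) = false. Proof. exact: lo_neq_hi. Qed.

Let triple y A B C :=
  [/\ cvert y, enc y (lo i) = A, enc y (hi i) = B & enc y (hi j) = C].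

(** The class of triples realized by vertices. Its closure under both steps is just that raising
    preserves vertices, and it makes [good] available after each step. *)
Let Cl A B C := exists y, triple y A B C.

Let other (k : 'I_m) := [&& k != lo i, k != hi i & k != hi j].

Let step_i y A B C b c : triple y A B C -> minL N B A b -> foot B b c ->
  exists z, [/\ ce i y = Some z, triple z (ins A c) (rmv B b) C &
    forall k, other k -> enc z k = enc y k].
Proof.
move=> [vy eA eB eC]; rewrite -eA -eB -eC => mb fc.
have [z [ez vz hz]] := sm_eS M vy mb fc; exists z; split=> //.
  by split=> //; rewrite hz ?eqxx ?lhi ?hji ?hjl.
by move=> k /and3P[/negbTE kl /negbTE kh _]; rewrite hz kh kl.
Qed.

Let step_j y A B C b c : triple y A B C -> minL N C B b -> foot C b c ->
  exists z, [/\ ce j y = Some z, triple z A (ins B c) (rmv C b) &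
    forall k, other k -> enc z k = enc y k].
Proof.
move=> [vy eA eB eC]; rewrite -eA -eB -eC -{1 2}lj => mb fc.
have [z [ez vz hz]] := sm_eS M vy mb fc; exists z; split=> //.
  by split=> //; rewrite hz ?lj ?eqxx ?lij ?hij ?lhi.
by move=> k /and3P[_ /negbTE kl /negbTE kh]; rewrite hz lj kh kl.
Qed.

Let from_e_i y z A B C : triple y A B C -> ce i y = Some z ->
  exists b c, [/\ minL N B A b, foot B b c, triple z (ins A c) (rmv B b) C &
    forall k, other k -> enc z k = enc y k].
Proof.
move=> ty ez; have [vy eA eB eC] := ty; have [b [c [mb fc _ _]]] := model_e M vy ez.
rewrite eA eB in mb fc; have [z' [ez' tz' oz']] := step_i ty mb fc.
by exists b, c; move: ez; rewrite ez' => -[<-].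
Qed.

Let from_e_j y z A B C : triple y A B C -> ce j y = Some z ->
  exists b c, [/\ minL N C B b, foot C b c, triple z A (ins B c) (rmv C b) &
    forall k, other k -> enc z k = enc y k].
Proof.
move=> ty ez; have [vy eA eB eC] := ty; have [b [c [mb fc _ _]]] := model_e M vy ez.
rewrite lj eC eB in mb fc; have [z' [ez' tz' oz']] := step_j ty mb fc.
by exists b, c; move: ez; rewrite ez' => -[<-].
Qed.

Let Clb A B C : Cl A B C -> [/\ bounded N A, bounded N B & bounded N C].
Proof. by move=> [y [vy <- <- <-]]; split; apply: (sm_bounded M). Qed.

Let Clg A B C : Cl A B C -> good B A /\ good C B.
Proof.
move=> [y [vy <- <- <-]]; split; first exact: (sm_good M).
by have := sm_good M j vy; rewrite lj.
Qed.

Let Cl1 A B C b c : Cl A B C -> minL N B A b -> foot B b c ->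
  Cl (ins A c) (rmv B b) C.
Proof. by move=> [y ty] mb fc; have [z [_ tz _]] := step_i ty mb fc; exists z. Qed.

Let Cl2 A B C b c : Cl A B C -> minL N C B b -> foot C b c ->
  Cl A (ins B c) (rmv C b).
Proof. by move=> [y ty] mb fc; have [z [_ tz _]] := step_j ty mb fc; exists z. Qed.

Let eps_i y A B C : triple y A B C -> eps i y = nL N B A.
Proof. by move=> [vy <- <- _]; rewrite (model_eps M). Qed.

Let eps_j y A B C : triple y A B C -> eps j y = nL N C B.
Proof. by move=> [vy _ <- <-]; rewrite (model_eps M) // lj. Qed.

Let triple_inj y z A B B' C : triple y A B C -> triple z A B' C ->
  (forall k, other k -> enc y k = enc z k) -> y = z.
Proof.
move=> [vy ey1 _ ey3] [vz ez1 _ ez3] h; apply: (sm_inj M (i0 := hi i)) => // k kh.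
have [->|kl] := eqVneq k (lo i); first by rewrite ey1 ez1.
have [->|kj] := eqVneq k (hi j); first by rewrite ey3 ez3.
by apply: h; rewrite /other kl kh kj.
Qed.

Lemma adjacent_eps_i y z : cvert y -> ce i y = Some z ->
  eps j z = eps j y \/ eps j z = (eps j y).+1.
Proof.
move=> vy ez; have ty : triple y (enc y (lo i)) (enc y (hi i)) (enc y (hi j)) by [].
have [b [c [mb fc tz _]]] := from_e_i ty ez.
have Cy : Cl (enc y (lo i)) (enc y (hi i)) (enc y (hi j)) by exists y.
by rewrite (eps_j tz) (eps_j ty); apply: (nL_rmv_cases Clb Cy mb).
Qed.

Lemma adjacent_eps_j y z : cvert y -> ce j y = Some z ->
  eps i z = eps i y \/ eps i z = (eps i y).+1.
Proof.
move=> vy ez; have ty : triple y (enc y (lo i)) (enc y (hi i)) (enc y (hi j)) by [].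
have [b [c [mb fc tz _]]] := from_e_j ty ez.
have Cy : Cl (enc y (lo i)) (enc y (hi i)) (enc y (hi j)) by exists y.
by rewrite (eps_i tz) (eps_i ty); apply: (nL_ins_cases Clb Clg Cl2 Cy mb fc).
Qed.

Lemma adjacent_square y y1 z1 : cvert y -> ce i y = Some y1 -> ce j y = Some z1 ->
  eps j y1 = eps j y \/ eps i z1 = eps i y ->
  exists z, [/\ ce j y1 = Some z, ce i z1 = Some z &
    (eps j y1 = eps j y -> eps i z1 = (eps i y).+1) /\
    (eps i z1 = eps i y -> eps j y1 = (eps j y).+1)].
Proof.
move=> vy ey1 ez1 hyp; have ty : triple y (enc y (lo i)) (enc y (hi i)) (enc y (hi j)) by [].
have [b [be [mb fb ty1 oy1]]] := from_e_i ty ey1.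
have [c [ga [mc fc tz1 oz1]]] := from_e_j ty ez1.
have Cy : Cl (enc y (lo i)) (enc y (hi i)) (enc y (hi j)) by exists y.
rewrite (eps_j ty1) (eps_j ty) (eps_i tz1) (eps_i ty) in hyp *.
have sR := square_rmv Clb Clg Cl2 Cy mb fb mc fc.
have sI := square_ins Clb Clg Cl2 Cy mb fb mc fc.
have [m1 m2 f2] : [/\ minL N (enc y (hi j)) (rmv (enc y (hi i)) b) c,
    minL N (ins (enc y (hi i)) ga) (enc y (lo i)) b &
    foot (ins (enc y (hi i)) ga) b be].
  by case: hyp => [/sR|/sI] [].
have [w1 [ew1 tw1 ow1]] := step_j ty1 m1 fc.
have [w2 [ew2 tw2 ow2]] := step_i tz1 m2 f2.
have ww : w1 = w2.
  by apply: triple_inj tw1 tw2 _ => k ok; rewrite ow1 // ow2 // oy1 // oz1.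
exists w1; split; [by []|by rewrite ew2 ww|].
by split=> [/sR|/sI] [].
Qed.

Lemma adjacent_octagon y y1 z1 : cvert y -> ce i y = Some y1 -> ce j y = Some z1 ->
  eps j y1 = (eps j y).+1 -> eps i z1 = (eps i y).+1 ->
  exists y2 y3 z2 z3 z, [/\ ce j y1 = Some y2, ce j y2 = Some y3,
     ce i y3 = Some z, ce i z1 = Some z2 &
   [/\ ce i z2 = Some z3, ce j z3 = Some z,
     eps i y3 = (eps i y1).+1 & eps j z3 = (eps j z1).+1]].
Proof.
move=> vy ey1 ez1; have ty : triple y (enc y (lo i)) (enc y (hi i)) (enc y (hi j)) by [].
have [b [be [mb fb ty1 oy1]]] := from_e_i ty ey1.
have [c [ga [mc fc tz1 oz1]]] := from_e_j ty ez1.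
have Cy : Cl (enc y (lo i)) (enc y (hi i)) (enc y (hi j)) by exists y.
rewrite (eps_j ty1) (eps_j ty) (eps_i tz1) (eps_i ty) => gR gI.
have [c1 [g1 [c2 [g2 [d1 [e1 [b1 [f1 [b2 [f2 [c3 [g3]]]]]]]]]]]] :=
  octagon Clb Clg Cl1 Cl2 Cy mb fb mc fc gR gI.
cbv zeta => -[[m1 h1] [m2 h2] [m3 h3] [m4 h4] [[m5 h5] [m6 h6] eA eC [nY nZ]]].
have [y2 [ey2 ty2 oy2]] := step_j ty1 m1 h1.
have [y3 [ey3 ty3 oy3]] := step_j ty2 m2 h2.
have [y4 [ey4 ty4 oy4]] := step_i ty3 m3 h3.
have [z2 [ez2 tz2 oz2]] := step_i tz1 m4 h4.
have [z3 [ez3 tz3 oz3]] := step_i tz2 m5 h5.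
have [z4 [ez4 tz4 oz4]] := step_j tz3 m6 h6.
have ww : y4 = z4.
  rewrite eA eC in ty4; apply: triple_inj ty4 tz4 _ => k ok.
  by rewrite oy4 // oy3 // oy2 // oy1 // oz4 // oz3 // oz2 // oz1.
exists y2, y3, z2, z3, y4; split=> //; split=> //; first by rewrite ww.
  by rewrite (eps_i ty3) (eps_i ty1).
by rewrite (eps_j tz3) (eps_j tz1).
Qed.

End Adjacent.

Lemma far_model_e i j y z : i != j -> far i j -> cvert y -> ce i y = Some z ->
  enc z (hi j) = enc y (hi j) /\ enc z (lo j) = enc y (lo j).
Proof.
move=> ij fij vy ez; have [h1 h2 h3 h4] := far_pos ij fij.
by have [b [c [_ _ _ hz]]] := model_e M vy ez; rewrite !hz h1 h2 h3 h4.
Qed.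

Lemma far_eps i j y z : i != j -> far i j -> cvert y -> ce i y = Some z ->
  eps j z = eps j y.
Proof.
move=> ij fij vy ez; have vz := model_e_vert M vy ez.
by rewrite !(model_eps M) //; have [-> ->] := far_model_e ij fij vy ez.
Qed.

Lemma far_square i j y y1 z1 : i != j -> far i j -> cvert y ->
  ce i y = Some y1 -> ce j y = Some z1 ->
  exists z, ce j y1 = Some z /\ ce i z1 = Some z.
Proof.
move=> ij fij vy ey1 ez1.
have ji : j != i by rewrite eq_sym.
have fji : far j i by rewrite far_sym.
have [b [be [mb fb vy1 hy1]]] := model_e M vy ey1.
have [c [ga [mc fc vz1 hz1]]] := model_e M vy ez1.
have [e1 e2] := far_model_e ij fij vy ey1.
have [e3 e4] := far_model_e ji fji vy ez1.
rewrite -e1 -e2 in mc; rewrite -e1 in fc; rewrite -e3 -e4 in mb; rewrite -e3 in fb.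
have [w1 [ew1 vw1 hw1]] := sm_eS M vy1 mc fc.
have [w2 [ew2 vw2 hw2]] := sm_eS M vz1 mb fb.
exists w1; split=> //; rewrite ew2; congr Some; symmetry.
apply: (sm_inj M (i0 := hi i)) => // k /negbTE kh.
have [h1 h2 h3 h4] := far_pos ij fij.
rewrite hw1 hw2 hy1 hz1 kh; case: (eqVneq k (hi j)) => [->|_]; first by rewrite h2.
by case: (eqVneq k (lo j)) => [->|_]; rewrite ?h4.
Qed.

Lemma eps_change i j y z : i != j -> cvert y -> ce i y = Some z ->
  eps j z = eps j y \/ ~~ far i j /\ eps j z = (eps j y).+1.
Proof.
move=> ij vy ez; case fij: (far i j); first by left; apply: far_eps ez.
move: fij => /negbFE /orP[] /eqP e.
- by have [] := adjacent_eps_i e vy ez; [left|right].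
- by have [] := adjacent_eps_j e vy ez; [left|right].
Qed.

(** The hypothesis singles out [j] while adjacent colours come in two orders, hence the appeal to
    one or the other half of [adjacent_square]. The last equation becomes the vanishing difference
    of phi in (P5). *)
Lemma square i j y y1 z1 : i != j -> cvert y -> ce i y = Some y1 ->
  ce j y = Some z1 -> eps j y1 = eps j y ->
  exists z, [/\ ce j y1 = Some z, ce i z1 = Some z &
    ((eps i z1)%:Z - (eps i y)%:Z + cartan j i = 0)%R].
Proof.
move=> ij vy ey1 ez1 h; have ji : j != i by rewrite eq_sym.
rewrite cartan_far // far_sym; case fij: (far i j).
  have [z [e1 e2]] := far_square ij fij vy ey1 ez1; exists z; split=> //.
  have fji : far j i by rewrite far_sym.
  by rewrite (far_eps ji fji vy ez1); lia.
move: fij => /negbFE /orP[] /eqP e.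
- have [z [e1 e2 [h1 _]]] := adjacent_square e vy ey1 ez1 (or_introl h).
  by exists z; split=> //; rewrite h1 //; lia.
- have [z [e1 e2 [_ h1]]] := adjacent_square e vy ez1 ey1 (or_intror h).
  by exists z; split=> //; rewrite h1 //; lia.
Qed.

Lemma octagon_model i j y y1 z1 : i != j -> cvert y -> ce i y = Some y1 ->
  ce j y = Some z1 -> eps j y1 = (eps j y).+1 -> eps i z1 = (eps i y).+1 ->
  exists y2 y3 z2 z3 z, [/\ ce j y1 = Some y2, ce j y2 = Some y3,
     ce i y3 = Some z, ce i z1 = Some z2 &
   [/\ ce i z2 = Some z3, ce j z3 = Some z,
     eps i y3 = (eps i y1).+1 & eps j z3 = (eps j z1).+1]].
Proof.
move=> ij vy ey1 ez1 h1 h2; case fij: (far i j).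
  by move: h1; rewrite (far_eps ij fij vy ey1); lia.
move: fij => /negbFE /orP[] /eqP e; first exact: (adjacent_octagon e vy ey1 ez1 h1 h2).
have [y2 [y3 [z2 [z3 [z [a1 a2 a3 a4 [a5 a6 a7 a8]]]]]]] :=
  adjacent_octagon e vy ez1 ey1 h2 h1.
by exists z2, z3, y2, y3, z.
Qed.

Lemma eps_e r y z : cvert y -> ce r y = Some z -> eps r y = (eps r z).+1.
Proof.
move=> vy ez; have vz := model_e_vert M vy ez.
by rewrite !(model_eps M) // (model_e_nL M vy ez).
Qed.

Lemma nabla_e i j y z : cvert y -> ce j y = Some z ->
  (st_Nabla (st_epsilon i) j z = (phi i z)%:Z - (phi i y)%:Z)%R.
Proof. by move=> vy ez; rewrite /st_Nabla (model_inv M vy ez). Qed.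

Lemma model_P3 y i j : cvert y -> i != j -> ce i y ->
  (st_Delta (@st_delta m G j) i y + st_Delta (st_epsilon j) i y = cartan i j)%R.
Proof.
move=> vy ij; case ez: (ce i y) => [z|//] _.
rewrite /st_Delta ez /st_delta /st_epsilon.
by have := phi_change vy ij ez; lia.
Qed.

Lemma model_P4 y i j : cvert y -> i != j -> ce i y ->
  (st_Delta (@st_delta m G j) i y <= 0 /\ st_Delta (st_epsilon j) i y <= 0)%R.
Proof.
move=> vy ij; case ez: (ce i y) => [z|//] _.
rewrite /st_Delta ez /st_delta /st_epsilon.
have := phi_change vy ij ez; rewrite cartan_far //.
by have [->|[/negbTE-> ->]] := eps_change ij vy ez; [case: ifP|]; lia.
Qed.

Lemma model_P5 y i j : cvert y -> i != j -> ce i y -> ce j y ->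
  st_Delta (@st_delta m G j) i y = 0%R ->
  exists z, [/\ path_e [:: i; j] y = Some z, path_e [:: j; i] y = Some z
                & st_Nabla (st_epsilon i) j z = 0%R].
Proof.
move=> vy ij; case ey1: (ce i y) => [y1|//] _; case ez1: (ce j y) => [z1|//] _.
rewrite /st_Delta ey1 /st_delta => h.
have h' : eps j y1 = eps j y by move: h; clear; lia.
have [z [e1 e2 hc]] := square ij vy ey1 ez1 h'.
have vy1 := model_e_vert M vy ey1; have vz1 := model_e_vert M vy ez1.
have ji : j != i by rewrite eq_sym.
exists z; split; rewrite /path_e /= ?ez1 ?ey1 //.
rewrite (nabla_e _ vy1 e1) (phi_change vy1 ji e1).
by have := eps_e vy ey1; have := eps_e vz1 e2; lia.
Qed.

Lemma model_P6 y i j : cvert y -> i != j -> ce i y -> ce j y ->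
  st_Delta (@st_delta m G j) i y = (-1)%R ->
  st_Delta (@st_delta m G i) j y = (-1)%R ->
  exists z, [/\ path_e [:: i; j; j; i] y = Some z,
                path_e [:: j; i; i; j] y = Some z,
                st_Nabla (st_epsilon j) i z = (-1)%R
              & st_Nabla (st_epsilon i) j z = (-1)%R].
Proof.
move=> vy ij; case ey1: (ce i y) => [y1|//] _; case ez1: (ce j y) => [z1|//] _.
rewrite /st_Delta ey1 ez1 /st_delta => hi hj.
have hi' : eps j y1 = (eps j y).+1 by lia.
have hj' : eps i z1 = (eps i y).+1 by lia.
have [y2 [y3 [z2 [z3 [z [a1 a2 a3 a4 [a5 a6 a7 a8]]]]]]] :=
  octagon_model ij vy ey1 ez1 hi' hj'.
have vy1 := model_e_vert M vy ey1; have vz1 := model_e_vert M vy ez1.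
have vy2 := model_e_vert M vy1 a1; have vy3 := model_e_vert M vy2 a2.
have vz2 := model_e_vert M vz1 a4; have vz3 := model_e_vert M vz2 a5.
have ji : j != i by rewrite eq_sym.
have fij : far i j = false.
  by apply/negbTE/negP => f; move: hi'; rewrite (far_eps ij f vy ey1); lia.
have cij : cartan i j = (-1)%R by rewrite cartan_far // fij.
have cji : cartan j i = (-1)%R by rewrite cartan_far // far_sym fij.
exists z; split; rewrite /path_e /= ?ey1 ?ez1 /= ?a1 ?a4 /= ?a2 ?a5 //=.
- rewrite (nabla_e _ vy3 a3) (phi_change vy3 ij a3) cij.
  by have := eps_e vy1 a1; have := eps_e vy2 a2; have := eps_e vz3 a6;
    have := eps_e vy ez1; lia.
- rewrite (nabla_e _ vz3 a6) (phi_change vz3 ji a6) cji.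
  by have := eps_e vz1 a4; have := eps_e vz2 a5; have := eps_e vy3 a3;
    have := eps_e vy ey1; lia.
Qed.

End PhiCrystal.

Section DualOperators.
Variable G : colored_graph m.
Implicit Types (y : G) (i j r : 'I_m.-1).

Lemma dual_Delta i j y :
  (@st_Delta m (dual_graph G) (@st_delta m (dual_graph G) (rev_ord j))
    (rev_ord i) y = st_Nabla (st_epsilon j) i y)%R.
Proof.
rewrite /st_Delta /st_Nabla /st_delta /st_epsilon /= rev_ordK.
by case: (cf i y) => [z|//]; rewrite -!phi_dual; lia.
Qed.

Lemma dual_Nabla i j y :
  (@st_Nabla m (dual_graph G) (@st_epsilon m (dual_graph G) (rev_ord j))
    (rev_ord i) y = st_Delta (@st_delta m G j) i y)%R.
Proof.
rewrite /st_Delta /st_Nabla /st_delta /st_epsilon /= rev_ordK.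
case: (ce i y) => [z|//]; rewrite /phi /eps /= rev_ordK; lia.
Qed.

End DualOperators.

(** (P5') and (P6') are (P5) and (P6) of the dual graph: duality exchanges the forward differences
    of phi with the backward differences of minus epsilon. *)
Lemma model_stembridge (G : colored_graph m) (enc : G -> 'I_m -> nat -> bool) :
  set_model N enc -> stembridge_axioms G.
Proof.
move=> M; have M' := dual_model M.
have rv (i j : 'I_m.-1) : i != j -> rev_ord i != rev_ord j.
  by rewrite (inj_eq rev_ord_inj).
split; [exact: model_P3 M|exact: model_P4 M|exact: model_P5 M|exact: model_P6 M|..].
- move=> y i j vy ij fi fj hD.
  have := @model_P5 _ _ M' y (rev_ord i) (rev_ord j) vy (rv _ _ ij).
  rewrite dual_Delta /= !rev_ordK => /(_ fi fj hD)[z [h1 h2 h3]]; exists z; split.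
  + exact: h1.
  + exact: h2.
  + by rewrite -h3 -dual_Nabla.
- move=> y i j vy ij fi fj hD hD'.
  have := @model_P6 _ _ M' y (rev_ord i) (rev_ord j) vy (rv _ _ ij).
  rewrite !dual_Delta /= !rev_ordK => /(_ fi fj hD hD')[z [h1 h2 h3 h4]].
  exists z; split.
  + exact: h1.
  + exact: h2.
  + by rewrite -h3 -dual_Nabla.
  + by rewrite -h4 -dual_Nabla.
Qed.

End LocalAxioms.

(** * Stembridge's uniqueness theorem *)

(** The height makes raising terminate, which, besides local confluence, is what a confluence
    argument requires. *)
Record regular_crystal (m : nat) (G : colored_graph m) : Prop := RegularCrystal {
  rc_crystal : crystal_axioms G;
  rc_stembridge : stembridge_axioms G;
  rc_height : exists mu : G -> nat, forall r (y z : G),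
    cvert y -> ce r y = Some z -> mu z < mu y }.

Definition highest (m : nat) (G : colored_graph m) (h : G) :=
  cvert h /\ forall r, ce r h = None.

Definition descends (m : nat) (G : colored_graph m) (h y : G) :=
  exists rs, path_f rs h = Some y.

Section Regular.
Variables (m : nat) (G : colored_graph m).
Hypothesis R : regular_crystal G.
Implicit Types (y z u v h : G) (r i j : 'I_m.-1).

Let CA := rc_crystal R.
Let SA := rc_stembridge R.

Lemma rc_e_vert r y z : cvert y -> ce r y = Some z -> cvert z.
Proof. exact: (crystal_e_vert CA). Qed.

Lemma rc_f_vert r y z : cvert y -> cf r y = Some z -> cvert z.
Proof. exact: (crystal_f_vert CA). Qed.

Lemma rc_ef r y z : cvert y -> ce r y = Some z -> cf r z = Some y.
Proof. by move=> vy ez; apply/(crystal_ef CA) => //; apply: rc_e_vert ez. Qed.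

Lemma rc_fe r y z : cvert y -> cf r y = Some z -> ce r z = Some y.
Proof. by move=> vy ez; apply/(crystal_ef CA) => //; apply: rc_f_vert ez. Qed.

Lemma string_length_Some (g : G -> option G) y z k : is_string_length g z k ->
  g y = Some z -> string_length g y = (string_length g z).+1.
Proof.
move=> hk e; rewrite (string_lengthE hk).
exact: string_lengthE (is_string_lengthS e hk).
Qed.

Lemma rc_eps_Some r y z : cvert y -> ce r y = Some z -> eps r y = (eps r z).+1.
Proof.
move=> vy ez; have [k hk] := crystal_e_fin CA r (rc_e_vert vy ez).
exact: string_length_Some hk ez.
Qed.

Lemma rc_phi_Some r y z : cvert y -> cf r y = Some z -> phi r y = (phi r z).+1.
Proof.
move=> vy ez; have [k hk] := crystal_f_fin CA r (rc_f_vert vy ez).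
exact: string_length_Some hk ez.
Qed.

Lemma rc_eps_None r y : ce r y = None -> eps r y = 0.
Proof. by move=> e; apply/string_lengthE/is_string_length0. Qed.

Lemma rc_phi_None r y : cf r y = None -> phi r y = 0.
Proof. by move=> e; apply/string_lengthE/is_string_length0. Qed.

(** By (P3) and (P4) two nonpositive integers add up to a Cartan entry 0 or -1, so each difference
    is 0 or -1. If one of the two vanishes, (P5) applies in the corresponding order; otherwise (P6)
    does. *)
Lemma rc_diamond i j y u v : i != j -> cvert y -> ce i y = Some u ->
  ce j y = Some v ->
  (exists z, [/\ ce j u = Some z, ce i v = Some z &
     st_Nabla (st_epsilon i) j z = 0%R \/ st_Nabla (st_epsilon j) i z = 0%R]) \/
  exists u1 u2 v1 v2 z, [/\ ce j u = Some u1, ce j u1 = Some u2,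
    ce i u2 = Some z, ce i v = Some v1 &
    [/\ ce i v1 = Some v2, ce j v2 = Some z,
      st_Nabla (st_epsilon j) i z = (-1)%R &
      st_Nabla (st_epsilon i) j z = (-1)%R]].
Proof.
move=> ij vy eu ev; have ji : j != i by rewrite eq_sym.
have su : ce i y by rewrite eu.
have sv : ce j y by rewrite ev.
have cart (k l : 'I_m.-1) : k != l -> cartan k l = 0%R \/ cartan k l = (-1)%R.
  by move=> kl; rewrite /cartan (negbTE kl); case: ifP; auto.
have dich (k l : 'I_m.-1) : k != l -> ce k y ->
    st_Delta (@st_delta m G l) k y = 0%R \/ st_Delta (@st_delta m G l) k y = (-1)%R.
  move=> kl sk; have := stembridge_P3 SA vy kl sk.
  have := stembridge_P4 SA vy kl sk; have := cart k l kl; lia.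
case: (dich i j ij su) => hij.
  have [z [h1 h2 h3]] := stembridge_P5 SA vy ij su sv hij.
  move: h1 h2; rewrite /path_e /= eu ev /= => h1 h2.
  by left; exists z; split=> //; left.
case: (dich j i ji sv) => hji.
  have [z [h1 h2 h3]] := stembridge_P5 SA vy ji sv su hji.
  move: h1 h2; rewrite /path_e /= eu ev /= => h1 h2.
  by left; exists z; split=> //; right.
have [z [h1 h2 h3 h4]] := stembridge_P6 SA vy ij su sv hij hji.
move: h1 h2; rewrite /path_e /= eu ev /=.
case eu1: (ce j u) => [u1|//] /=; case eu2: (ce j u1) => [u2|//] /= ez.
case ev1: (ce i v) => [v1|//] /=; case ev2: (ce i v1) => [v2|//] /= ez'.
by right; exists u1, u2, v1, v2, z.
Qed.

Lemma path_f_vert rs h y : cvert h -> path_f rs h = Some y -> cvert y.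
Proof.
elim: rs y => [|r rs IHrs] y vh /=; first by case=> <-.
by case e: (path_f rs h) => [z|//] /= /rc_f_vert; apply; apply: IHrs.
Qed.

Lemma descends_f r h y z : descends h y -> cf r y = Some z -> descends h z.
Proof. by move=> [rs e] ez; exists (r :: rs); rewrite /= e. Qed.

Lemma descends_e r h y z : descends h z -> cvert y -> ce r y = Some z ->
  descends h y.
Proof. by move=> hz vy /(rc_ef vy); apply: descends_f. Qed.

Lemma highest_ex y : cvert y -> exists h, highest h /\ descends h y.
Proof.
have [mu hmu] := rc_height R; move En: (mu y) => n.
elim/ltn_ind: n y En => n IHn y En vy.
have [[r er]|nr] := pselect (exists r, ce r y).
  case ez: (ce r y) er => [z|//] _.
  have zn : mu z < n by rewrite -En; apply: hmu ez.
  have [h [hh hz]] := IHn _ zn _ erefl (rc_e_vert vy ez).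
  by exists h; split=> //; apply: descends_e ez.
exists y; split; last by exists [::].
by split=> // r; case e: (ce r y) => [z|//]; case: nr; exists r; rewrite e.
Qed.

Lemma descends_inv h y : cvert h -> descends h y ->
  h = y \/ exists r z, [/\ cvert z, ce r y = Some z, cvert y & descends h z].
Proof.
move=> vh [[|r rs] /=]; first by case; left.
case e: (path_f rs h) => [z|//] /= ez; right; exists r, z.
have vz := path_f_vert vh e.
by split=> //; [apply: rc_fe|apply: rc_f_vert ez|exists rs].
Qed.

(* Newman's lemma: (P5) and (P6) are the local confluence of the raising
   operators. *)
Lemma highest_uniq h1 h2 y : highest h1 -> highest h2 ->
  descends h1 y -> descends h2 y -> h1 = h2.
Proof.
have [mu hmu] := rc_height R; move En: (mu y) => n.
elim/ltn_ind: n y h1 h2 En => n IHn y h1 h2 En hw1 hw2 d1 d2.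
have [v1 e1] := hw1; have [v2 e2] := hw2.
case: (descends_inv v1 d1) => [e|[i [u [vu eu vy du]]]].
  case: (descends_inv v2 d2) => [->//|[j [v [vv ev _ _]]]].
  by move: ev; rewrite -e e1.
case: (descends_inv v2 d2) => [e|[j [v [vv ev _ dv]]]].
  by move: eu; rewrite -e e2.
have un : mu u < n by rewrite -En; apply: hmu eu.
have vn : mu v < n by rewrite -En; apply: hmu ev.
have [eij|ij] := eqVneq i j.
  by subst j; move: ev; rewrite eu => -[uv]; subst v; apply: (IHn _ un u).
(* A highest vertex above [z] is above both [u] and [v], where induction identifies it with [h1] and
   with [h2]. *)
have [z [vz zu zv]] : exists z, [/\ cvert z, descends z u & descends z v].
  have [[z [h3 h4 _]]|] := rc_diamond ij vy eu ev.
    have vz := rc_e_vert vu h3; exists z; split=> //.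
      by exists [:: j]; rewrite /= (rc_ef vu h3).
    by exists [:: i]; rewrite /= (rc_ef vv h4).
  move=> [u1 [u2 [w1 [w2 [z [a1 a2 a3 a4 [a5 a6 _ _]]]]]]].
  have vu1 := rc_e_vert vu a1; have vu2 := rc_e_vert vu1 a2.
  have vw1 := rc_e_vert vv a4; have vw2 := rc_e_vert vw1 a5.
  exists z; split; first exact: rc_e_vert a3.
    by exists [:: j; j; i]; rewrite /= (rc_ef vu2 a3) /= (rc_ef vu1 a2) /= (rc_ef vu a1).
  by exists [:: i; i; j]; rewrite /= (rc_ef vw2 a6) /= (rc_ef vw1 a5) /= (rc_ef vv a4).
have [h [hh hz]] := highest_ex vz.
have trans w : descends z w -> descends h w.
  move=> [rs]; elim: rs w => [|r rs IHrs] w /=; first by case=> <-.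
  by case e: (path_f rs z) => [w'|//] /= ew; apply: descends_f (IHrs _ e) ew.
have -> : h1 = h by apply: (IHn _ un u) => //; apply: trans.
by symmetry; apply: (IHn _ vn v) => //; apply: trans.
Qed.

(** A zigzag cannot leave the set below [h]: going up an edge, the new vertex is below some highest
    vertex, which is above the old one too and hence equals [h]. *)
Lemma component_descends h y0 : highest h -> descends h y0 ->
  forall y, clos_refl_sym_trans G (@cedge m G) y0 y <-> descends h y.
Proof.
move=> hh d0 y; have [vh _] := hh; split.
- have P a b : clos_refl_sym_trans G (@cedge m G) a b ->
    (descends h a <-> descends h b).
    elim=> {a b} [a b [va vb [r fab]]|a|a b _ IH|a b c _ IH1 _ IH2] //.
    + split=> [da|db]; first exact: descends_f fab.
      have [h' [hh' d']] := highest_ex va.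
      by have -> : h = h' by apply: (highest_uniq hh hh' db); apply: descends_f fab.
    + by rewrite IH.
    + by rewrite IH1.
  by move=> /P [h1 _]; apply: h1.
- have Q a : descends h a -> clos_refl_sym_trans G (@cedge m G) h a.
    move=> [rs]; elim: rs a => [|r rs IHrs] a /=; first by case=> <-; apply: rst_refl.
    case e: (path_f rs h) => [w|//] /= ew; apply: rst_trans (IHrs _ e) _.
    have vw := path_f_vert vh e; apply: rst_step; split=> //; last by exists r.
    exact: rc_f_vert ew.
  move=> /Q dy; apply: rst_trans dy; exact/rst_sym/Q.
Qed.

End Regular.

(** * Synchronized descent in two regular crystals *)

Section Comparison.
Variables (m : nat).

(** The same lowering word leads from [g] to [y] and from [h] to [T]. Since different words may lead
    to one vertex, this is at first only a relation; [level_uniq] makes it a function. *)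
Definition level (G H : colored_graph m) (g : G) (h : H) d (y : G) (T : H) :=
  exists rs, [/\ size rs = d, path_f rs g = Some y & path_f rs h = Some T].

Lemma level_sym (G H : colored_graph m) (g : G) (h : H) d y T :
  level g h d y T -> level h g d T y.
Proof. by move=> [rs [h1 h2 h3]]; exists rs. Qed.

Lemma level_f (G H : colored_graph m) (g : G) (h : H) d r y T y' T' :
  level g h d y T -> cf r y = Some y' -> cf r T = Some T' ->
  level g h d.+1 y' T'.
Proof.
move=> [rs [h1 h2 h3]] e1 e2.
by exists (r :: rs); rewrite /= h1 h2 h3 /= e1 e2.
Qed.

Definition compared (G H : colored_graph m) (g : G) (h : H) d :=
  forall y T, level g h d y T -> (forall r, eps r y = eps r T) /\
    forall r z, ce r y = Some z -> exists Z k,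
      [/\ d = k.+1, ce r T = Some Z & level g h k z Z].

Section Step.
Variables (G H : colored_graph m) (g : G) (h : H).
Hypotheses (RG : regular_crystal G) (RH : regular_crystal H).
Hypotheses (vg : cvert g) (vh : cvert h) (wgh : forall k, cwt g k = cwt h k).

Lemma level_vert d y T : level g h d y T -> cvert y /\ cvert T.
Proof.
by move=> [rs [_ e1 e2]]; split; [apply: path_f_vert e1|apply: path_f_vert e2].
Qed.

Lemma level_wt d y T : level g h d y T -> forall k, cwt y k = cwt T k.
Proof.
move=> [rs [_ e1 e2]] k; elim: rs y T e1 e2 => [|r rs IHrs] y T /=.
  by case=> <- [<-].
case e1: (path_f rs g) => [y'|//]; case e2: (path_f rs h) => [T'|//] /= f1 f2.
rewrite (crystal_f_wt (rc_crystal RG) (path_f_vert RG vg e1) f1).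
rewrite (crystal_f_wt (rc_crystal RH) (path_f_vert RH vh e2) f2).
by rewrite (IHrs _ _ e1 e2).
Qed.

Lemma level_phi d y T : compared g h d -> level g h d y T ->
  forall r, phi r y = phi r T.
Proof.
move=> C l r; have [vy vT] := level_vert l; have [eC _] := C _ _ l.
have := crystal_phi_eps (rc_crystal RG) r vy.
have := crystal_phi_eps (rc_crystal RH) r vT.
by rewrite !(level_wt l) eC; lia.
Qed.

Lemma level_f_ex d r y T z : compared g h d -> level g h d y T ->
  cf r y = Some z -> exists Z, cf r T = Some Z /\ level g h d.+1 z Z.
Proof.
move=> C l e; have [vy vT] := level_vert l.
have := level_phi C l r; rewrite (rc_phi_Some RG vy e).
case e' : (cf r T) => [Z|]; last by rewrite (rc_phi_None e').
by exists Z; split=> //; apply: level_f l e e'.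
Qed.

(** (P5) and (P6) in [H] cannot be used at [T], as they presuppose that [ce j T] exists. Instead the
    top [z] of the figure over [y] in [G] is transported to a vertex [Z] of [H], and (P5') or (P6')
    at [Z] closes the figure downwards, through a vertex that lowers to [T]. Their hypotheses only
    involve phi, which agrees on levels already compared. *)
Lemma compared_e d : (forall k, k <= d -> compared g h k) ->
  forall y T, level g h d.+1 y T -> forall r z, ce r y = Some z ->
  exists Z, ce r T = Some Z /\ level g h d z Z.
Proof.
move=> C y T ly j v ev; have [vy vT] := level_vert ly.
case: ly => -[|i rs] [//= [srs]].
case eu: (path_f rs g) => [u|//]; case eU: (path_f rs h) => [U|//] /= fu fU.
have lu : level g h d u U by exists rs.
clear srs.
have [vu vU] := level_vert lu.
have euy := rc_fe RG vu fu; have eUT := rc_fe RH vU fU.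
have [eij|ij] := eqVneq i j.
  by subst j; move: ev; rewrite euy => -[<-]; exists U.
have vv := rc_e_vert RG vy ev.
have fT (V : H) : cvert V -> cf j V = Some T -> ce j T = Some V by apply: rc_fe.
have [_ Cu] := C d (leqnn d) _ _ lu.
(* [i] is the last letter of the word leading to [y], so [u] is one level up and the raisings of [u]
   are already known to correspond. *)
have [[z [e1 e2 hz]]|] := rc_diamond RG ij vy euy ev.
  have [Z [k [dk eZ lz]]] := Cu _ _ e1; subst d.
  have Ck : compared g h k by apply: C; lia.
  have [vz vZ] := level_vert lz.
  have fz := rc_ef RG vv e2; have fz' := rc_ef RG vu e1.
  have fZ' := rc_ef RH vU eZ.
  have [V [fZ lv]] := level_f_ex Ck lz fz.
  exists V; split=> //; apply: fT; first by have [] := level_vert lv.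
  have sZi : cf i Z by rewrite fZ.
  have sZj : cf j Z by rewrite fZ'.
  have ji : j != i by rewrite eq_sym.
  have Ck1 : compared g h k.+1 by exact: C.
  case: hz; rewrite /st_Nabla ?fz ?fz' /st_epsilon.
  + rewrite (level_phi Ck lz) (level_phi Ck1 lu) => hz.
    have [|W [w1 w2 _]] := stembridge_P5' (rc_stembridge RH) vZ ji sZj sZi.
      by rewrite /st_Nabla fZ'.
    by move: w1 w2; rewrite /path_f /= fZ fZ' /= fU => -> [->].
  + rewrite (level_phi Ck lz) (level_phi Ck1 lv) => hz.
    have [|W [w1 w2 _]] := stembridge_P5' (rc_stembridge RH) vZ ij sZi sZj.
      by rewrite /st_Nabla fZ.
    by move: w1 w2; rewrite /path_f /= fZ fZ' /= fU => -[->] ->.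
move=> [u1 [u2 [v1 [v2 [z [a1 a2 a3 a4 [a5 a6 n1 n2]]]]]]].
have vu1 := rc_e_vert RG vu a1; have vu2 := rc_e_vert RG vu1 a2.
have vv1 := rc_e_vert RG vv a4; have vv2 := rc_e_vert RG vv1 a5.
have [U1 [k1 [d1 A1 l1]]] := Cu _ _ a1; subst d.
have [_ Cu1] := C k1 ltac:(lia) _ _ l1.
have [U2 [k2 [d2 A2 l2]]] := Cu1 _ _ a2; subst k1.
have [_ Cu2] := C k2 ltac:(lia) _ _ l2.
have [Z [k3 [d3 A3 l3]]] := Cu2 _ _ a3; subst k2.
have [_ vU1] := level_vert l1; have [_ vU2] := level_vert l2.
have [_ vZ] := level_vert l3.
have Ck3 : compared g h k3 by apply: C; lia.
have Ck31 : compared g h k3.+1 by apply: C; lia.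
have fz := rc_ef RG vv2 a6; have fz' := rc_ef RG vu2 a3.
have [V2 [fZ lv2]] := level_f_ex Ck3 l3 fz.
have fZ' := rc_ef RH vU2 A3.
have sZi : cf i Z by rewrite fZ'.
have sZj : cf j Z by rewrite fZ.
have [||W [w1 w2 _ _]] := stembridge_P6' (rc_stembridge RH) vZ ij sZi sZj.
- move: n1; rewrite /st_Nabla fz' fZ' /st_epsilon.
  by rewrite (level_phi Ck3 l3) (level_phi Ck31 l2).
- move: n2; rewrite /st_Nabla fz fZ /st_epsilon.
  by rewrite (level_phi Ck3 l3) (level_phi Ck31 lv2).
move: w1 w2; rewrite /path_f /= fZ' fZ /= (rc_ef RH vU1 A2) /= (rc_ef RH vU A1) /= fU.
move=> -[<-]; case fV2: (cf i V2) => [V1|//] /=; case fV1: (cf i V1) => [V|//] /= fV.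
have lv1 := level_f lv2 (rc_ef RG vv1 a5) fV2.
have lv := level_f lv1 (rc_ef RG vv a4) fV1.
by exists V; split=> //; apply: fT => //; have [] := level_vert lv.
Qed.

End Step.
(** The two directions go together: epsilon agrees only if a raising undefined at one vertex is
    undefined at its counterpart as well. *)
Lemma compared_all (G H : colored_graph m) (g : G) (h : H) :
  regular_crystal G -> regular_crystal H -> highest g -> highest h ->
  (forall k, cwt g k = cwt h k) ->
  forall d, compared g h d /\ compared h g d.
Proof.
move=> RG RH [vg hg] [vh hh] w; elim/ltn_ind => -[|d] IHd.
  have z0 r : eps r g = eps r h by rewrite !rc_eps_None.
  by split=> y T [[|r rs] [//= _ [<-] [<-]]]; split=> // r z; rewrite ?hg ?hh.
have w' k : cwt h k = cwt g k by [].
have C1 k : k <= d -> compared g h k by move=> kd; have [] := IHd k kd.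
have C2 k : k <= d -> compared h g k by move=> kd; have [] := IHd k kd.
have e1 := compared_e RG RH vg vh w C1.
have e2 := compared_e RH RG vh vg w' C2.
have eE y T : level g h d.+1 y T -> forall r, eps r y = eps r T.
  move=> l r; have [vy vT] := level_vert RG RH vg vh l.
  case ey: (ce r y) => [z|].
    have [Z [eT lz]] := e1 _ _ l _ _ ey.
    rewrite (rc_eps_Some RG vy ey) (rc_eps_Some RH vT eT).
    by congr _.+1; have [] := C1 d (leqnn d) _ _ lz.
  case eT: (ce r T) => [Z|]; last by rewrite !rc_eps_None.
  by have [z [ez _]] := e2 _ _ (level_sym l) _ _ eT; rewrite ez in ey.
split=> y T l; split.
- exact: eE.
- by move=> r z ez; have [Z [eZ lZ]] := e1 _ _ l _ _ ez; exists Z, d.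
- by move=> r; rewrite (eE _ _ (level_sym l)).
- by move=> r z ez; have [Z [eZ lZ]] := e2 _ _ l _ _ ez; exists Z, d.
Qed.

(** Undo the last lowering of the first word. By comparison along the second word, this raising
    exists at [T'] too and leads to a vertex associated with the same [u]; induction on the first
    length applies there. *)
Lemma level_uniq (G H : colored_graph m) (g : G) (h : H) :
  regular_crystal G -> regular_crystal H -> highest g -> highest h ->
  (forall k, cwt g k = cwt h k) ->
  forall d d' y T T', level g h d y T -> level g h d' y T' -> T = T'.
Proof.
move=> RG RH hg hh w; have [vg eg] := hg; have [vh eh] := hh.
elim=> [|d IHd] d' y T T' l l'.
  case: l => -[|r rs] [//= _ [ey] [eT]].
  case: l' => -[|r rs] [/= _]; first by move=> _ [<-].
  case e: (path_f rs g) => [u|//] /= fu _.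
  have := rc_fe RG (path_f_vert RG vg e) fu.
  by rewrite -ey eg.
case: l => -[|i rs] [//= [srs]].
case eu: (path_f rs g) => [u|//]; case eU: (path_f rs h) => [U|//] /= fu fU.
have [vu vU] := (path_f_vert RG vg eu, path_f_vert RH vh eU).
have [C _] := compared_all RG RH hg hh w d'.
have [_ /(_ i u (rc_fe RG vu fu))[U' [k [dk eU' lU']]]] := C _ _ l'.
have eUU : U = U' by apply: IHd lU'; exists rs.
have [_ vT'] := level_vert RG RH vg vh l'.
by have := rc_ef RH vT' eU'; rewrite -eUU fU => -[].
Qed.

Theorem component_iso (G H : colored_graph m) (g y0 : G) (h : H) :
  regular_crystal G -> regular_crystal H -> highest g -> highest h ->
  (forall k, cwt g k = cwt h k) -> descends g y0 ->
  (forall T : H, cvert T -> descends h T) -> crystal_iso (component y0) H.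
Proof.
move=> RG RH hg hh w dy0 dH; have [vg eg] := hg; have [vh eh] := hh.
have w' k : cwt h k = cwt g k by [].
have cmpd := compared_all RG RH hg hh w.
have compP := component_descends RG hg dy0.
pose S y T := exists d, level g h d y T.
have S_path y : descends g y -> exists T, S y T.
  move=> [rs]; elim: rs y => [|r rs IHrs] y /=.
    by case=> <-; exists h, 0, [::].
  case e: (path_f rs g) => [u|//] /= fu; have [T [d lT]] := IHrs _ e.
  have [C _] := cmpd d.
  by have [Z [_ lZ]] := level_f_ex RG RH vg vh w C lT fu; exists Z, d.+1.
have S_path' T : descends h T -> exists y, S y T.
  move=> [rs]; elim: rs T => [|r rs IHrs] T /=.
    by case=> <-; exists g, 0, [::].
  case e: (path_f rs h) => [u|//] /= fu; have [y [d lT]] := IHrs _ e.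
  have [_ C] := cmpd d.
  have [Z [_ lZ]] := level_f_ex RH RG vh vg w' C (level_sym lT) fu.
  by exists Z, d.+1; apply: level_sym.
have S_uniq y T T' : S y T -> S y T' -> T = T'.
  by move=> [d l] [d' l']; apply: (level_uniq RG RH hg hh w l l').
have S_uniq' y y' T : S y T -> S y' T -> y = y'.
  move=> [d l] [d' l'].
  exact: (level_uniq RH RG hh hg w' (level_sym l) (level_sym l')).
have S_desc y T : S y T -> descends g y by move=> [d [rs [_ e _]]]; exists rs.
have S_vert y T : S y T -> cvert y /\ cvert T.
  by move=> [d l]; apply: (level_vert RG RH vg vh l).
pose psi (y : G) : H :=
  if pselect (exists T, S y T) is left p then sval (cid p) else h.
have psiS y : descends g y -> S y (psi y).
  by move=> /S_path eT; rewrite /psi; case: pselect => // p; case: cid.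
have psiE y T : S y T -> psi y = T.
  by move=> ST; apply: S_uniq (psiS _ (S_desc _ _ ST)) ST.
exists psi; split.
  split.
  - by move=> y /compP /psiS /S_vert[].
  - move=> y y' /set_mem /compP /psiS Sy /set_mem /compP /psiS Sy' e.
    by move: Sy'; rewrite -e; apply: S_uniq'.
  - move=> T /dH /S_path' [y Sy]; exists y; last exact: psiE.
    exact/compP/(S_desc _ _ Sy).
move=> y /compP dy; have Sy := psiS y dy; have [vy vT] := S_vert _ _ Sy.
have [d l] := Sy; have [C C'] := cmpd d.
split.
- by move=> k; rewrite /= (level_wt RG RH vg vh w l).
- move=> r /=; case ez: (ce r y) => [z|] /=.
    have [_ /(_ _ _ ez)[Z [k [_ -> lz]]]] := C _ _ l.
    by congr Some; apply: psiE; exists k.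
  case eZ: (ce r (psi y)) => [Z|//].
  have [_ /(_ _ _ eZ)[z [k [_ ez' lz]]]] := C' _ _ (level_sym l).
  by rewrite ez' in ez.
- move=> r /=; case ez: (cf r y) => [z|] /=.
    have [Z [-> lz]] := level_f_ex RG RH vg vh w C l ez.
    by congr Some; apply: psiE; exists d.+1.
  case eZ: (cf r (psi y)) => [Z|//].
  have [z [ez' lz]] := level_f_ex RH RG vh vg w' C' (level_sym l) eZ.
  by rewrite ez' in ez.
Qed.

End Comparison.

(** * Tableaux *)

Definition wpos (w : seq nat) a : nat -> bool :=
  fun p => (0 < p <= size w) && (nth 0 w p.-1 == a).

Local Arguments opens : simpl never.

Lemma opensS (U V : nat -> bool) k : opens U V k.+1 = (opens U V k - V k) + U k.
Proof. by []. Qed.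

Section WordBrackets.
Variable r : nat.
Implicit Types w u : seq nat.

Fixpoint wcloses w :=
  if w is a :: u then (wcloses u - (a == r.+1)) + (a == r) else 0.

Fixpoint wopens d w :=
  if w is a :: u then wopens ((d - (a == r)) + (a == r.+1)) u else d.

Lemma wpos_bounded w a : bounded (size w) (wpos w a).
Proof. by move=> k /andP[]. Qed.

Let U w := wpos w r.+1.
Let V w := wpos w r.

Lemma wpos_disjoint w k : U w k -> V w k = false.
Proof. by move=> /andP[_ /eqP e]; rewrite /V /wpos e; apply/negP; lia. Qed.

Lemma closes_word w k : closes (size w) (U w) (V w) k.+1 = wcloses (drop k w).
Proof.
move Em : (size w - k) => n; elim: n k Em => [|n IHn] k Em.
  rewrite drop_oversize; last lia.
  by apply: closes_big; [exact: wpos_bounded|exact: wpos_bounded|lia].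
have kw : k < size w by lia.
rewrite (drop_nth 0 kw) closes_rec; try exact: wpos_bounded.
by rewrite IHn /=; [rewrite /U /V /wpos /= kw|lia].
Qed.

Lemma opens_word w k : k <= size w ->
  opens (U w) (V w) k.+1 = wopens 0 (take k w).
Proof.
have wop_rcons d u a : wopens d (rcons u a) =
    (wopens d u - (a == r)) + (a == r.+1).
  by elim: u d => //= b u IHu d; rewrite IHu.
elim: k => [|k IHk] kw; first by rewrite take0 opensS /U /V /wpos.
by rewrite opensS (take_nth 0) // wop_rcons IHk 1?ltnW // /U /V /wpos /= kw.
Qed.

(** A prefix with more letters [r] than [r + 1] contains an unmatched [r], whatever follows. This
    inequality and its mirror [wopens_cat] refute the failures of column strictness. *)
Lemma wcloses_cat w1 w2 :
  count_mem r w1 <= wcloses (w1 ++ w2) + count_mem r.+1 w1.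
Proof. by elim: w1 => //= a w1 IHw; case: eqP; case: eqP; lia. Qed.

Lemma wopens_ge d w : d + count_mem r.+1 w <= wopens d w + count_mem r w.
Proof.
elim: w d => [|a w IHw] d //=; have := IHw ((d - (a == r)) + (a == r.+1)).
by set W := wopens _ w; clearbody W; case: (a == r); case: (a == r.+1) => /=; lia.
Qed.

Lemma wopens_cat w1 w2 :
  count_mem r.+1 w2 <= wopens 0 (w1 ++ w2) + count_mem r w2.
Proof.
have -> : wopens 0 (w1 ++ w2) = wopens (wopens 0 w1) w2.
  by elim: w1 0 => //= a w1 IHw d; rewrite IHw.
by have := wopens_ge (wopens 0 w1) w2; lia.
Qed.

(** Invariant of the scan: [op] stacks the pending openings, innermost first, so it has [opens]
    elements; the unmatched closings of the remaining suffix pop as many of them, hence the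
    [drop]. *)
Lemma bracketE w u p cl op : u = drop p w -> p <= size w ->
  size op = opens (U w) (V w) p.+1 ->
  (bracket r u p cl op).1 =
    rev [seq x <- iota p (size u) | unR (U w) (V w) x.+1] ++ cl /\
  (bracket r u p cl op).2 =
    rev [seq x <- iota p (size u) | unL (size w) (U w) (V w) x.+1] ++
    drop (closes (size w) (U w) (V w) p.+1) op.
Proof.
elim: u p cl op => [|a u IHu] p cl op eu pw so.
  have spw : size w <= p by rewrite -subn_eq0 -size_drop -eu.
  by split; rewrite /= ?closes_word ?(drop_oversize spw) /= ?drop0.
have pw' : p < size w by rewrite -subn_gt0 -size_drop -eu.
have [ea eu'] : a = nth 0 w p /\ u = drop p.+1 w.
  by move: eu; rewrite (drop_nth 0 pw') => -[].
have Up : U w p.+1 = (a == r.+1) by rewrite /U /wpos /= pw' -ea.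
have Vp : V w p.+1 = (a == r) by rewrite /V /wpos /= pw' -ea.
have eO : opens (U w) (V w) p.+2 = (size op - (a == r)) + (a == r.+1).
  by rewrite opensS -so Up Vp.
have eC : closes (size w) (U w) (V w) p.+1 =
    (closes (size w) (U w) (V w) p.+2 - (a == r.+1)) + (a == r).
  by rewrite closes_rec; [rewrite Up Vp|exact: wpos_bounded..].
have fR : [seq x <- iota p (size (a :: u)) | unR (U w) (V w) x.+1] =
   (if (a == r) && (size op == 0) then [:: p] else [::]) ++
   [seq x <- iota p.+1 (size u) | unR (U w) (V w) x.+1].
  by rewrite /= {1}/unR Vp -so; case: ifP.
have fL : [seq x <- iota p (size (a :: u)) | unL (size w) (U w) (V w) x.+1] =
   (if (a == r.+1) && (closes (size w) (U w) (V w) p.+2 == 0) then [:: p] else [::]) ++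
   [seq x <- iota p.+1 (size u) | unL (size w) (U w) (V w) x.+1].
  by rewrite /= {1}/unL Up; case: ifP.
rewrite fR fL !rev_cat -!catA eC [bracket _ _ _ _ _]/=.
case: (eqVneq a r.+1) eO => [ar|nar] eO /=.
  have nr : (a == r) = false by rewrite ar; lia.
  rewrite nr /= in eO *.
  have [-> ->] := IHu p.+1 cl (p :: op) eu' pw' ltac:(rewrite eO /=; lia).
  split=> //; case: eqP => [->|n0] //=; rewrite ?drop0 //.
  by case: (closes _ _ _ p.+2) n0 => //= n _; rewrite subn1 addn0.
case: (eqVneq a r) eO => [ar|nr] /= eO; last first.
  have [-> ->] := IHu p.+1 cl op eu' pw' ltac:(rewrite eO /=; lia).
  by rewrite subn0 addn0.
case: op so eO fR => [|o op] so /= eO fR.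
  have [-> ->] := IHu p.+1 (p :: cl) [::] eu' pw' ltac:(rewrite eO /=; lia).
  by [].
have [-> ->] := IHu p.+1 cl op eu' pw' ltac:(rewrite eO /=; lia).
by rewrite subn0 addn1.
Qed.

End WordBrackets.

Lemma filter_iota_min (P : pred nat) n q : q < n -> P q ->
  (forall x, x < q -> ~~ P x) -> exists s, [seq x <- iota 0 n | P x] = q :: s.
Proof.
move=> qn Pq nP; rewrite -(subnKC (ltnW qn)) iotaD filter_cat.
rewrite (eq_in_filter (a2 := pred0)) ?filter_pred0.
  rewrite add0n (_ : n - q = (n - q.+1).+1) /=; last lia.
  by rewrite Pq; eexists.
by move=> x; rewrite mem_iota => ?; apply/negbTE/nP; lia.
Qed.

Lemma filter_iota_max (P : pred nat) n q : q < n -> P q ->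
  (forall x, q < x -> ~~ P x) ->
  exists s, rev [seq x <- iota 0 n | P x] = q :: s.
Proof.
move=> qn Pq nP; rewrite -(subnKC (ltnW qn)) iotaD filter_cat.
rewrite add0n (_ : n - q = (n - q.+1).+1) /=; last lia.
have -> : [seq x <- iota q.+1 (n - q.+1) | P x] = [::].
  rewrite (eq_in_filter (a2 := pred0)) ?filter_pred0 // => x.
  by rewrite mem_iota => hx; apply/negbTE/nP; lia.
by rewrite Pq rev_cat /=; eexists.
Qed.

Lemma sorted_mid (A : Type) (e : rel A) s1 x s2 : sorted e (s1 ++ x :: s2) <->
  [/\ sorted e s1, forall y t, s1 = rcons t y -> e y x,
      forall y t, s2 = y :: t -> e x y & sorted e s2].
Proof.
have H2 : path e x s2 <-> (forall y t, s2 = y :: t -> e x y) /\ sorted e s2.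
  case: s2 => [|y t]; first by split.
  by split=> /= [/andP[h1 h2]|[h1 h2]]; [split=> // ? ? [<-] | rewrite h2 (h1 y t)].
case/lastP: s1 => [|t y].
  by split=> /= [/H2[h1 h2]|[_ _ h1 h2]]; [split=> // ? []|apply/H2].
have -> : sorted e (rcons t y ++ x :: s2) = sorted e (rcons t y) && (e y x && path e x s2).
  by case: t => [|z t] //=; rewrite cat_path last_rcons.
split=> [/and3P[h1 h2 /H2[h3 h4]]|[h1 h2 h3 h4]].
  by split=> // z u /rcons_inj[_ <-].
by apply/and3P; split=> //; [apply: (h2 y t)|apply/H2].
Qed.

Lemma column_strictP t1 t2 : reflect (size t2 <= size t1 /\
  forall j, j < size t2 -> nth 0 t1 j < nth 0 t2 j) (column_strict t1 t2).
Proof.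
apply: (iffP andP) => -[st h]; split=> //.
  elim: t2 t1 st h => [|b t2 IHt] [|a t1] //= st /andP[ab h] [|j] //= jt.
  exact: IHt.
elim: t2 t1 st h => [|b t2 IHt] [|a t1] //= st h.
by rewrite (h 0) //=; apply: IHt => // j jt; apply: (h j.+1).
Qed.

Lemma nth_mid (s1 s2 : seq nat) a b j : nth 0 (s1 ++ b :: s2) j =
  if j == size s1 then b else nth 0 (s1 ++ a :: s2) j.
Proof.
rewrite !nth_cat; case: (ltngtP j (size s1)) => // [lt|->]; last by rewrite subnn.
by case e: (j - size s1) => [|k] //; lia.
Qed.

Lemma set_nth_mid (s1 s2 : seq nat) a b :
  set_nth 0 (s1 ++ a :: s2) (size s1) b = s1 ++ b :: s2.
Proof. by elim: s1 => //= c s1 ->. Qed.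

Lemma flatten_split (ss : seq (seq nat)) p : p < size (flatten ss) ->
  exists ss1 s1 a s2 ss2, ss = ss1 ++ (s1 ++ a :: s2) :: ss2 /\
    p = size (flatten ss1) + size s1.
Proof.
elim: ss p => [|s ss IHss] p //=; rewrite size_cat => ps.
case: (ltnP p (size s)) => [lt|ge].
  exists [::], (take p s), (nth 0 s p), (drop p.+1 s), ss.
  by rewrite /= -(drop_nth 0 lt) cat_take_drop size_take lt.
have [ss1 [s1 [a [s2 [ss2 [-> ep]]]]]] := IHss (p - size s) ltac:(lia).
by exists (s :: ss1), s1, a, s2, ss2; rewrite /= size_cat; split=> //; lia.
Qed.

(** * Crystal operators on semistandard tableaux *)

Section TableauOperators.
Variables (m : nat) (lam : seq nat).
Implicit Types (T : seq (seq nat)).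

Lemma ssyt_mid ss1 row ss2 : ssyt m lam (rev (ss1 ++ row :: ss2)) ->
  [/\ sorted leq row, all (fun a => a < m) row,
      forall low t, ss1 = rcons t low -> column_strict row low &
      forall up t, ss2 = up :: t -> column_strict up row].
Proof.
move=> [_]; rewrite !all_rev !all_cat rev_sorted /= => /and3P[_ h1 _] h2 /and3P[_ h3 _].
have [_ h4 h5 _] := (sorted_mid _ _ _ _).1 h2.
by split.
Qed.

Lemma ssyt_change ss1 s1 a b s2 ss2 :
  ssyt m lam (rev (ss1 ++ (s1 ++ a :: s2) :: ss2)) -> b < m ->
  sorted leq (s1 ++ b :: s2) ->
  (forall low t, ss1 = rcons t low -> column_strict (s1 ++ b :: s2) low) ->
  (forall up t, ss2 = up :: t -> column_strict up (s1 ++ b :: s2)) ->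
  ssyt m lam (rev (ss1 ++ (s1 ++ b :: s2) :: ss2)).
Proof.
move=> [hs]; rewrite !all_rev !all_cat rev_sorted /= => /and3P[g1 _ g2] h2.
rewrite !all_cat /= => /and3P[k1 /and3P[k2 _ k3] k4] bm h3 h4 h5.
split; rewrite ?all_rev ?all_cat ?rev_sorted /= ?all_cat /=.
- move: hs; rewrite /shape !map_rev !map_cat /=.
  by rewrite (_ : size (s1 ++ b :: s2) = size (s1 ++ a :: s2)) // !size_cat.
- by rewrite g1 h3.
- have [h6 _ _ h7] := (sorted_mid _ _ _ _).1 h2.
  by apply/sorted_mid.
- by rewrite k1 k2 bm k3.
Qed.

Lemma reading_mid ss1 s1 a s2 ss2 : reading (rev (ss1 ++ (s1 ++ a :: s2) :: ss2)) =
  (flatten ss1 ++ s1) ++ a :: (s2 ++ flatten ss2).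
Proof. by rewrite /reading revK flatten_cat /= -!catA. Qed.

Lemma of_reading_mid ss1 s1 a b s2 ss2 p :
  p = size (flatten ss1) + size s1 ->
  of_reading (rev (ss1 ++ (s1 ++ a :: s2) :: ss2))
    (set_nth 0 (reading (rev (ss1 ++ (s1 ++ a :: s2) :: ss2))) p b) =
  rev (ss1 ++ (s1 ++ b :: s2) :: ss2).
Proof.
move=> ep; rewrite /of_reading reading_mid revK ep -size_cat set_nth_mid.
rewrite (_ : shape _ = shape (ss1 ++ (s1 ++ b :: s2) :: ss2)); last first.
  by rewrite /shape !map_cat /= !size_cat.
by rewrite -!catA -cat_cons (catA s1) -(flatten_cat ss1 ((s1 ++ b :: s2) :: ss2)) flattenK.
Qed.

Lemma sorted_run_right a s : sorted leq (a :: s) ->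
  exists k s', s = nseq k a ++ s' /\ all (fun c => a < c) s'.
Proof.
elim: s => [|c s IHs] /=; first by exists 0, [::].
move=> /andP[ac pcs]; have [eac|nac] := eqVneq a c.
  subst c; have [k [s' [-> h]]] := IHs pcs.
  by exists k.+1, s'.
exists 0, (c :: s); split=> //=; have lac : a < c by lia.
rewrite lac /=; have := order_path_min leq_trans pcs.
by apply: sub_all => d /=; lia.
Qed.

Lemma sorted_run_left a s : sorted leq (rcons s a) ->
  exists k s', s = s' ++ nseq k a /\ all (fun c => c < a) s'.
Proof.
elim: s => [|c s IHs]; first by exists 0, [::].
rewrite rcons_cons /= => h; have [k [s' [es hs']]] := IHs (path_sorted h).
have := order_path_min leq_trans h; rewrite all_rcons => /andP[ca cs].
case: s' es hs' => [|d s'] /= es hs'; last first.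
  exists k, [:: c, d & s']; rewrite es /= hs'; split=> //.
  move: cs hs'; rewrite es /= => /andP[cd _] /andP[da _].
  by rewrite andbT (leq_ltn_trans cd da).
have [eca|nca] := eqVneq c a; first by exists k.+1, [::]; rewrite es eca.
by exists k, [:: c]; rewrite es /= andbT ltn_neqAle nca ca.
Qed.

Lemma minL_word r w b : minL (size w) (wpos w r.+1) (wpos w r) b ->
  [/\ 0 < b <= size w, nth 0 w b.-1 = r.+1, wcloses r (drop b w) = 0 &
     1 < b -> nth 0 w b.-2 != r.+1].
Proof.
move=> [/andP[Ub Eb] nb]; have /andP[bw /eqP eb] := Ub.
have E0 : closes (size w) (wpos w r.+1) (wpos w r) b.+1 = 0 by apply/eqP.
split=> //; first by rewrite -closes_word E0.
move=> b1; apply/negP => e1.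
have U1 : wpos w r.+1 b.-1 by rewrite /wpos e1; lia.
have /negP := nb b.-1 ltac:(lia); apply; rewrite /unL U1 /=.
rewrite (_ : b.-1.+1 = b); last lia.
by rewrite closes_rec; [rewrite E0 Ub wpos_disjoint|exact: wpos_bounded..].
Qed.

Lemma maxR_word r w a : maxR (wpos w r.+1) (wpos w r) a ->
  [/\ 0 < a <= size w, nth 0 w a.-1 = r, wopens r 0 (take a.-1 w) = 0 &
     a < size w -> nth 0 w a != r].
Proof.
move=> [/andP[Va /eqP Da] na]; have /andP[aw /eqP ea] := Va.
have ea' : a.-1.+1 = a by lia.
split=> //; first by rewrite -opens_word ?ea' //; lia.
move=> a1; apply/negP => e1.
have V1 : wpos w r a.+1 by rewrite /wpos /= e1 a1.
have /negP := na a.+1 (leqnn _); apply; rewrite /unR V1 opensS Da Va /=.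
by apply/eqP; case Ua: (wpos w r.+1 a) => //; move: Va; rewrite wpos_disjoint.
Qed.

Lemma ssyt_row ss1 row ss2 : ssyt m lam (rev (ss1 ++ row :: ss2)) -> sorted leq row.
Proof. by move=> /ssyt_mid[]. Qed.

Lemma sorted_nth_le s i j : sorted leq s -> i <= j < size s -> nth 0 s i <= nth 0 s j.
Proof.
by move=> h ij; apply: (sorted_leq_nth leq_trans leqnn) => //; rewrite ?inE; lia.
Qed.

Lemma take_run s a i k : i + k <= size s ->
  (forall l, i <= l < i + k -> nth 0 s l = a) -> take k (drop i s) = nseq k a.
Proof.
move=> ik h; have sz : size (take k (drop i s)) = k.
  by rewrite size_takel // size_drop; lia.
apply: (@eq_from_nth _ 0); rewrite ?size_nseq // sz => l lk.
by rewrite nth_take // nth_drop nth_nseq lk h //; lia.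
Qed.

(** Only an [r] directly above the changed cell could do harm. Then the whole run of [k + 1] letters
    [r + 1] starting at that cell lies under letters [r]; these are read later, after only [k]
    openings and no further [r + 1], so one of them would close the chosen letter. *)
Lemma raise_ssyt r ss1 s1 s2 ss2 : r.+1 < m ->
  ssyt m lam (rev (ss1 ++ (s1 ++ r.+1 :: s2) :: ss2)) ->
  wcloses r (s2 ++ flatten ss2) = 0 ->
  (forall t, s1 <> rcons t r.+1) ->
  ssyt m lam (rev (ss1 ++ (s1 ++ r :: s2) :: ss2)).
Proof.
move=> rm sT Eb nb; have [h1 h2 h3 h4] := ssyt_mid sT.
have [k1 k2 k3 k4] := (sorted_mid _ _ _ _).1 h1.
apply: (ssyt_change sT); first lia.
- apply/sorted_mid; split=> // y t e; last by have := k3 y t e; lia.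
  have := k2 y t e; have [e'|] := eqVneq y r.+1; last lia.
  by case: (nb t); rewrite e e'.
- move=> low t e; have /column_strictP[g1 g2] := h3 low t e.
  apply/column_strictP; split=> [|j jl]; first by move: g1; rewrite !size_cat.
  rewrite (nth_mid _ _ r.+1); case: eqP => [ej|_]; last exact: g2.
  have := g2 j jl; rewrite ej nth_cat ltnn subnn /=; lia.
move=> up t e; have /column_strictP[g1 g2] := h4 up t e.
apply/column_strictP; split=> [|j jl]; first by move: g1; rewrite !size_cat.
have jl' : j < size (s1 ++ r.+1 :: s2) by move: jl; rewrite !size_cat.
rewrite (nth_mid _ _ r.+1); case: eqP => [ej|_]; last exact: g2.
have := g2 j jl'; rewrite {2}ej nth_cat ltnn subnn /= ltnS => upj.
rewrite ltn_neqAle upj andbT; apply/eqP => eup.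
have su : sorted leq up.
  by apply: (@ssyt_row (ss1 ++ [:: s1 ++ r.+1 :: s2]) up t); rewrite -catA /= -e.
have [k [s3 [es2 hs3]]] : exists k s', s2 = nseq k r.+1 ++ s' /\ all (fun c => r.+1 < c) s'.
  by apply: sorted_run_right; apply/(path_sorted (x := 0))=> /=;
    case: (s2) k3 k4 => //= c s k3' ->; rewrite (k3' c s).
have szu : j + k.+1 <= size up.
  by move: g1; rewrite es2 !size_cat /= size_cat size_nseq -ej; lia.
have run : take k.+1 (drop j up) = nseq k.+1 r.
  apply: take_run => // l jlk; apply/eqP; rewrite eqn_leq.
  have upl := sorted_nth_le su (i := j) (j := l) ltac:(lia).
  rewrite eup in upl; rewrite upl andbT.
  have lr : l < size (s1 ++ r.+1 :: s2).
    by rewrite es2 !size_cat /= size_cat size_nseq -ej; lia.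
  have := g2 l lr; rewrite nth_cat -ej (_ : l < j = false); last lia.
  case el : (l - j) => [|l']; first by rewrite /=; lia.
  rewrite /= es2 nth_cat size_nseq (_ : l' < k); last lia.
  by rewrite nth_nseq (_ : l' < k); lia.
have c0 : count_mem r.+1 (take j up) = 0.
  apply/count_memPn/negP => /(nthP 0)[i]; rewrite size_takel; last first.
    by apply: leq_trans szu; apply: leq_addr.
  move=> ij; rewrite nth_take // => ei.
  have := sorted_nth_le su (i := i) (j := j) ltac:(lia); rewrite ei eup; lia.
have c3 : count_mem r.+1 s3 = 0.
  by apply/count_memPn/negP => /(allP hs3); lia.
have := wcloses_cat r (s2 ++ take (j + k.+1) up) (drop (j + k.+1) up ++ flatten t).
rewrite -catA (catA (take _ _)) cat_take_drop; move: Eb; rewrite e /= => ->.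
rewrite !count_cat takeD run !count_cat c0 es2 !count_cat c3 !count_nseq /= eqxx.
have e1 : (r == r.+1) = false by apply/eqP; lia.
have e2 : (r.+1 == r) = false by apply/eqP; lia.
by rewrite ?e1 ?e2 ?eqxx /=; lia.
Qed.

(** Mirror argument: an [r + 1] directly below puts a run of [k + 1] letters [r + 1] under the run
    of [r] ending at the cell. They are read earlier and only [k] letters [r] come in between, so an
    opening would still be pending at the cell. *)
Lemma lower_ssyt r ss1 s1 s2 ss2 : r.+1 < m ->
  ssyt m lam (rev (ss1 ++ (s1 ++ r :: s2) :: ss2)) ->
  wopens r 0 (flatten ss1 ++ s1) = 0 ->
  (forall t, s2 <> r :: t) ->
  ssyt m lam (rev (ss1 ++ (s1 ++ r.+1 :: s2) :: ss2)).
Proof.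
move=> rm sT Eb nb; have [h1 h2 h3 h4] := ssyt_mid sT.
have [k1 k2 k3 k4] := (sorted_mid _ _ _ _).1 h1.
apply: (ssyt_change sT) => //.
- apply/sorted_mid; split=> // y t e; first by have := k2 y t e; lia.
  have := k3 y t e; have [e'|] := eqVneq y r; last lia.
  by case: (nb t); rewrite e e'.
- move=> low t e; have /column_strictP[g1 g2] := h3 low t e.
  apply/column_strictP; split=> [|j jl]; first by move: g1; rewrite !size_cat.
  rewrite (nth_mid _ _ r); case: eqP => [ej|_]; last exact: g2.
  have := g2 j jl; rewrite {1}ej nth_cat ltnn subnn /= => lowj.
  rewrite ltn_neqAle lowj andbT; apply/eqP => elow.
  have sl : sorted leq low.
    by apply: (@ssyt_row t low ((s1 ++ r :: s2) :: ss2)); rewrite -cat_rcons -e.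
  have [k [s0 [es1 hs0]]] : exists k s', s1 = s' ++ nseq k r /\ all (fun c => c < r) s'.
    apply: sorted_run_left; rewrite -cats1; apply/sorted_mid; split=> //.
  have ej' : j = size s0 + k by rewrite ej es1 size_cat size_nseq.
  have run : take k.+1 (drop (size s0) low) = nseq k.+1 r.+1.
    apply: take_run => [|l jlk]; first lia.
    have lowl := sorted_nth_le sl (i := l) (j := j) ltac:(lia).
    rewrite -elow in lowl; apply/eqP; rewrite eqn_leq lowl.
    have := g2 l ltac:(lia); rewrite es1 -catA nth_cat (_ : l < size s0 = false); last lia.
    rewrite nth_cat size_nseq; case: ifP => lk; first by rewrite nth_nseq lk.
    by rewrite (_ : l - size s0 - k = 0) //; lia.
  have c0 : count_mem r (drop (size s0) low) = 0.
    apply/count_memPn/negP => /(nthP 0)[i]; rewrite size_drop => ij.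
    rewrite nth_drop => ei.
    have := sorted_nth_le sl (i := size s0) (j := size s0 + i).
    rewrite leq_addr -ltn_subRL ij => /(_ isT); rewrite ei.
    have : nth 0 (take k.+1 (drop (size s0) low)) 0 = r.+1 by rewrite run.
    by rewrite nth_take // nth_drop addn0 => ->; rewrite ltnn.
  have c1 : count_mem r s0 = 0 by apply/count_memPn/negP => /(allP hs0); lia.
  have := wopens_cat r (flatten t ++ take (size s0) low) (drop (size s0) low ++ s1).
  rewrite -catA (catA (take _ _)) cat_take_drop catA -flatten_rcons -e Eb.
  rewrite !count_cat c0 -(cat_take_drop k.+1 (drop (size s0) low)) run count_cat.
  have e1 : (r == r.+1) = false by apply/eqP; lia.
  have e2 : (r.+1 == r) = false by apply/eqP; lia.
  by rewrite es1 !count_cat c1 !count_nseq /= ?e1 ?e2 ?eqxx /=; lia.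
move=> up t e; have /column_strictP[g1 g2] := h4 up t e.
apply/column_strictP; split=> [|j jl]; first by move: g1; rewrite !size_cat.
have jl' : j < size (s1 ++ r :: s2) by move: jl; rewrite !size_cat.
rewrite (nth_mid _ _ r); case: eqP => [ej|_]; last exact: g2.
have := g2 j jl'; rewrite {2}ej nth_cat ltnn subnn /=; lia.
Qed.

Lemma nth_at (s1 : seq nat) a s2 : nth 0 (s1 ++ a :: s2) (size s1) = a.
Proof. by rewrite nth_cat ltnn subnn. Qed.

Lemma ssyt_raise r T b : ssyt m lam T -> r.+1 < m ->
  minL (size (reading T)) (wpos (reading T) r.+1) (wpos (reading T) r) b ->
  ssyt m lam (of_reading T (set_nth 0 (reading T) b.-1 r)) /\
  reading (of_reading T (set_nth 0 (reading T) b.-1 r)) =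
    set_nth 0 (reading T) b.-1 r.
Proof.
move=> sT rm mb; have [bw eb Eb nb] := minL_word mb.
case: b bw eb Eb nb {mb} => [|b] //= bw eb Eb nb.
have [ss1 [s1 [a [s2 [ss2 [eT ep]]]]]] := flatten_split (bw : b < size (flatten (rev T))).
have eT' : T = rev (ss1 ++ (s1 ++ a :: s2) :: ss2) by rewrite -eT revK.
rewrite {eT bw}eT' in sT eb Eb nb *.
rewrite of_reading_mid // reading_mid ep -size_cat in eb Eb nb *.
rewrite nth_at in eb; subst a; rewrite set_nth_mid reading_mid; split=> //.
apply: raise_ssyt => //.
  by move: Eb; rewrite -cat_rcons -(size_rcons _ r.+1) drop_size_cat.
move=> t es1; move: nb; rewrite es1 -rcons_cat size_rcons cat_rcons nth_at eqxx.
by move=> /(_ isT).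
Qed.

Lemma ssyt_lower r T a : ssyt m lam T -> r.+1 < m ->
  maxR (wpos (reading T) r.+1) (wpos (reading T) r) a ->
  ssyt m lam (of_reading T (set_nth 0 (reading T) a.-1 r.+1)) /\
  reading (of_reading T (set_nth 0 (reading T) a.-1 r.+1)) =
    set_nth 0 (reading T) a.-1 r.+1.
Proof.
move=> sT rm mb; have [bw eb Eb nb] := maxR_word mb.
case: a bw eb Eb nb {mb} => [|b] //= bw eb Eb nb.
have [ss1 [s1 [a [s2 [ss2 [eT ep]]]]]] := flatten_split (bw : b < size (flatten (rev T))).
have eT' : T = rev (ss1 ++ (s1 ++ a :: s2) :: ss2) by rewrite -eT revK.
rewrite {eT bw}eT' in sT eb Eb nb *.
rewrite of_reading_mid // reading_mid ep -size_cat in eb Eb nb *.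
rewrite nth_at in eb; subst a; rewrite set_nth_mid reading_mid; split=> //.
apply: lower_ssyt => //; first by move: Eb; rewrite take_size_cat.
move=> t es2; move: nb; rewrite es2 -cat_rcons -(size_rcons _ r) /= nth_at eqxx.
by rewrite size_cat /= !addnS ltnS leq_addr => /(_ isT).
Qed.

Definition tab_enc T (i : 'I_m) : nat -> bool := wpos (reading T) i.

Lemma size_reading T : ssyt m lam T -> size (reading T) = sumn lam.
Proof.
by move=> [<- _ _ _]; rewrite /reading size_flatten /shape map_rev sumn_rev.
Qed.

Lemma of_readingK T : of_reading T (reading T) = T.
Proof. by rewrite /of_reading /reading flattenK revK. Qed.

Lemma wpos_set_nth w p a (i : nat) : p < size w ->
  wpos (set_nth 0 w p a) i =
  if i == a then ins (wpos w i) p.+1 else rmv (wpos w i) p.+1.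
Proof.
move=> pw; apply: funext => -[|k]; first by case: eqP.
rewrite /wpos size_set_nth (maxn_idPr pw) /= nth_set_nth /=.
have [->|kp] := eqVneq k p.
  by rewrite pw /= eq_sym; case: eqP => _; rewrite /ins /rmv /= eqxx ?orbT ?andbF.
have kp1 : (k.+1 == p.+1) = false by rewrite eqSS (negbTE kp).
by case: (i == a); rewrite /ins /rmv kp1 ?orbF ?andbT.
Qed.

(** An [r + 1] just before the first unmatched one would be unmatched too. Runs are thus trivial,
    and a step of the model changes the letter at a single position. *)
Lemma tab_minL_foot w r b c : minL (size w) (wpos w r.+1) (wpos w r) b ->
  foot (wpos w r.+1) b c -> c = b.
Proof.
move=> mb [cb h _]; have [_ _ _ nb] := minL_word mb.
have [//|nc] := eqVneq c b; have /andP[h1 h2] := h b.-1 ltac:(lia).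
by move: (nb ltac:(lia)); rewrite h2.
Qed.

Lemma tab_maxR_crest w r a c : maxR (wpos w r.+1) (wpos w r) a ->
  crest (wpos w r) a c -> c = a.
Proof.
move=> ma [ac h _]; have [_ _ _ na] := maxR_word ma.
have [//|nc] := eqVneq c a; have /andP[h1 h2] := h a.+1 ltac:(lia).
by move: (na ltac:(lia)); rewrite h2.
Qed.

Lemma bracket_reading T r : let w := reading T in
  (bracket r w 0 [::] [::]).1 =
    rev [seq x <- iota 0 (size w) | unR (wpos w r.+1) (wpos w r) x.+1] /\
  (bracket r w 0 [::] [::]).2 =
    rev [seq x <- iota 0 (size w) | unL (size w) (wpos w r.+1) (wpos w r) x.+1].
Proof.
move=> w; have [] := @bracketE r w w 0 [::] [::] (esym (drop0 w)) (leq0n _) erefl.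
by rewrite !cats0.
Qed.

Lemma tab_model : set_model (sumn lam) (G := tableau_crystal m lam) tab_enc.
Proof.
have hiE (r : 'I_m.-1) T : tab_enc T (hi r) = wpos (reading T) r.+1 by [].
have loE (r : 'I_m.-1) T : tab_enc T (lo r) = wpos (reading T) r by [].
split=> /=.
- by move=> T i sT; rewrite -(size_reading sT); apply: wpos_bounded.
(* Goodness is vacuous: a position of the word carries only one letter. *)
- move=> T r sT c b cb /(_ b); rewrite hiE loE leqnn cb => /(_ isT)/andP[h1 h2].
  by rewrite (wpos_disjoint h1) in h2.
- move=> T r sT; rewrite -(size_reading sT) => n0.
  rewrite /tab_e (bracket_reading T r).2 revK.
  rewrite (eq_filter (a2 := pred0)) ?filter_pred0 // => x.
  by apply/negbTE/nL0 => //; apply: wpos_bounded.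
- move=> T r b c sT; rewrite hiE loE -(size_reading sT) => mb fc.
  have rm : r.+1 < m by exact: hi_proof.
  have [s1 s2] := ssyt_raise sT rm mb; have ecb := tab_minL_foot mb fc.
  have [bw _ _ _] := minL_word mb; have [Lb nb] := mb.
  have eb : b.-1.+1 = b by lia.
  exists (of_reading T (set_nth 0 (reading T) b.-1 r)); split=> //.
    rewrite /tab_e (bracket_reading T r).2 revK.
    have [|||s ->//] := filter_iota_min (n := size (reading T)) (q := b.-1) (P := fun x =>
      unL (size (reading T)) (wpos (reading T) r.+1) (wpos (reading T) r) x.+1).
    + by lia.
    + by rewrite eb.
    + by move=> x xb; apply: nb; lia.
  move=> i; rewrite /tab_enc s2 wpos_set_nth ?eb; last lia.
  rewrite ecb -!val_eqE /=; case: (eqVneq (i : nat) r) => [->|ir].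
    by rewrite (_ : (r : nat) == r.+1 = false) //; apply/eqP; lia.
  case: eqP => [//|ir1]; rewrite rmv_id //.
  have [_ ebr _ _] := minL_word mb.
  by rewrite /wpos ebr; apply/negP => /andP[_ /eqP]; lia.
- move=> T r sT; rewrite -(size_reading sT) => n0.
  rewrite /tab_f (bracket_reading T r).1.
  rewrite (eq_filter (a2 := pred0)) ?filter_pred0 // => x.
  apply/negbTE/negP => h; have := nR_gt0 (@wpos_bounded (reading T) r) h.
  by rewrite lt0n => /eqP.
- move=> T r a c sT; rewrite hiE loE => ma cc.
  have rm : r.+1 < m by exact: hi_proof.
  have [s1 s2] := ssyt_lower sT rm ma; have ecb := tab_maxR_crest ma cc.
  have [bw ea _ _] := maxR_word ma; have [Lb nb] := ma.
  have eb : a.-1.+1 = a by lia.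
  exists (of_reading T (set_nth 0 (reading T) a.-1 r.+1)); split=> //.
    rewrite /tab_f (bracket_reading T r).1.
    have [|||s ->//] := filter_iota_max (n := size (reading T)) (q := a.-1) (P := fun x =>
      unR (wpos (reading T) r.+1) (wpos (reading T) r) x.+1).
    + by lia.
    + by rewrite eb.
    + by move=> x xb; apply: nb; lia.
  move=> i; rewrite /tab_enc s2 wpos_set_nth ?eb; last lia.
  rewrite ecb -!val_eqE /=; case: (eqVneq (i : nat) r.+1) => [//|ir].
  case: eqP => [//|ir1]; rewrite rmv_id //.
  by rewrite /wpos ea; apply/negP => /andP[_ /eqP]; lia.
- move=> T T' i0 sT sT' h.
  (* Once all letters other than [i0] are located, the remaining positions carry [i0]. *)
  suff er : reading T = reading T'.
    rewrite -(of_readingK T) -(of_readingK T') er /of_reading.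
    have [e1 _ _ _] := sT; have [e2 _ _ _] := sT'.
    by rewrite /shape !map_rev -!/(shape _) e1 e2.
  have [_ _ _ a1] := sT; have [_ _ _ a2] := sT'.
  have lt S p : all (all (fun a => a < m)) S -> p < size (reading S) ->
      nth 0 (reading S) p < m.
    move=> aS pS; have /flattenP[s] := mem_nth 0 pS.
    by rewrite mem_rev => /(allP aS) /allP hs /hs.
  have ez : size (reading T) = size (reading T') by rewrite !size_reading.
  apply: (@eq_from_nth _ 0) => // p pT.
  have pT' : p < size (reading T') by rewrite -ez.
  have key S S' (pS : p < size (reading S)) (pS' : p < size (reading S'))
      (aS : all (all (fun a => a < m)) S) :
      (forall i, i != i0 -> tab_enc S i = tab_enc S' i) ->
      nth 0 (reading S) p != i0 -> nth 0 (reading S) p = nth 0 (reading S') p.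
    move=> hS ne; have im := lt _ _ aS pS.
    have /(congr1 (fun f => f p.+1)) := hS (Ordinal im) ne.
    by rewrite /tab_enc /wpos /= pS pS' eqxx => /esym/eqP.
  have [e1|n1] := eqVneq (nth 0 (reading T) p) i0; last exact: key.
  have [e2|n2] := eqVneq (nth 0 (reading T') p) i0; first by rewrite e1 e2.
  by symmetry; apply: key => // i ii; rewrite h.
- move=> T i sT; congr Posz; rewrite -(size_reading sT) /nset /tab_enc.
  have -> : count_mem (i : nat) (flatten T) = count_mem (i : nat) (reading T).
    by rewrite /reading !count_flatten map_rev sumn_rev.
  move: (reading T) => w; rewrite /= {1}/wpos /= add0n.
  have : forall u, count_mem (i : nat) u =
    count (fun k => nth 0 u k.-1 == i) (iota 1 (size u)).
    elim=> //= a u ->; congr (_ + _); rewrite (iotaDl 1 1) count_map.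
    apply: eq_in_count => k; rewrite mem_iota => /andP[k1 _] /=.
    by case: k k1.
  move=> ->; apply: eq_in_count => k; rewrite mem_iota /wpos => kw.
  by rewrite (_ : 0 < k <= size w) //; lia.
Qed.

End TableauOperators.

Lemma model_regular (m N : nat) (G : colored_graph m)
  (enc : G -> 'I_m -> nat -> bool) : set_model N enc -> regular_crystal G.
Proof.
move=> M; split; [exact: model_crystal M|exact: model_stembridge M|].
(* Raising moves one element from position [r + 1] to position [r], so this weighted size drops by
   one. *)
exists (fun y => \sum_(i < m) i * nset N (enc y i)) => r y z vy ez.
have vz := model_e_vert M vy ez.
have w k : (Posz (nset N (enc z k)) = Posz (nset N (enc y k)) + simple_root r k)%R.
  by rewrite -!(sm_wt M) // (model_e_wt M vy ez).
have lh : lo r != hi r by rewrite lo_neq_hi.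
have split_sum (F : 'I_m -> nat) : \sum_(i < m) F i =
    F (hi r) + (F (lo r) + \sum_(i < m | (i != hi r) && (i != lo r)) F i).
  by rewrite (bigD1 (hi r)) // (bigD1 (lo r)).
rewrite (split_sum (fun i => i * nset N (enc y i))).
rewrite (split_sum (fun i => i * nset N (enc z i))).
have -> : \sum_(i < m | (i != hi r) && (i != lo r)) i * nset N (enc z i) =
    \sum_(i < m | (i != hi r) && (i != lo r)) i * nset N (enc y i).
  apply: eq_bigr => i /andP[ih il]; have := w i.
  by rewrite /simple_root (negbTE ih) (negbTE il) => wi; congr (_ * _); lia.
have w1 := w (hi r); have w2 := w (lo r); move: w1 w2.
rewrite /simple_root !eqxx (negbTE lh) eq_sym (negbTE lh).
by set s := \sum_(_ < _ | _) _ => /= w1 w2; nia.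
Qed.

(** * Highest weight tableaux *)

Section HighestTableau.
Variables (m : nat) (lam : seq nat).
Hypotheses (plam : is_partition lam) (slam : size lam <= m).

Definition highest_tableau : seq (seq nat) :=
  [seq nseq (nth 0 lam i) i | i <- iota 0 (size lam)].

Lemma nth_highest_tableau i : i < size lam ->
  nth [::] highest_tableau i = nseq (nth 0 lam i) i.
Proof. by move=> il; rewrite (nth_map 0) ?size_iota // nth_iota. Qed.

Lemma highest_tableau_ssyt : ssyt m lam highest_tableau.
Proof.
have [lamS _] := andP plam.
have sz : size highest_tableau = size lam by rewrite size_map size_iota.
split.
- apply: (@eq_from_nth _ 0); rewrite ?size_map ?size_iota // => i il.
  by rewrite (nth_map [::]) ?sz // nth_highest_tableau // size_nseq.
- apply/allP => s /mapP[i _ ->]; elim: (nth 0 lam i) => //= k.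
  by case: k => //= k ->; rewrite leqnn.
- apply/(sortedP [::]) => i; rewrite sz => il.
  rewrite !nth_highest_tableau //; last lia.
  have lei : nth 0 lam i.+1 <= nth 0 lam i by have /(sortedP 0) := lamS; apply.
  apply/column_strictP; rewrite !size_nseq; split=> // j jl.
  by rewrite !nth_nseq jl (leq_trans jl lei).
- apply/allP => s /mapP[i]; rewrite mem_iota => /andP[_ il] ->.
  by apply/allP => c; rewrite mem_nseq => /andP[_ /eqP->]; lia.
Qed.

Lemma wcloses0 r w : r \notin w -> wcloses r w = 0.
Proof.
elim: w => //= a w IHw; rewrite inE negb_or => /andP[ra /IHw ->].
by rewrite sub0n add0n eq_sym (negbTE ra).
Qed.

(** Rows are treated from the top. If the last entry [a] of row [i] exceeded [i], no [a - 1] would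
    be read after it, since the rows above contain only letters below [i]; so [a] would be
    unmatched. Column strictness gives the other inequality. *)
Lemma highest_tableau_uniq T : ssyt m lam T ->
  (forall r : 'I_m.-1, tab_e r T = None) -> T = highest_tableau.
Proof.
move=> sT hT; have [sh rowS colS ltm] := sT; have [_ lam0] := andP plam.
have sz : size T = size lam by rewrite -sh size_map.
have rowsz i : i < size T -> size (nth [::] T i) = nth 0 lam i.
  by move=> iT; rewrite -sh (nth_map [::]).
have noL (r : 'I_m.-1) p : p < size (reading T) -> nth 0 (reading T) p = r.+1 ->
    wcloses r (drop p.+1 (reading T)) != 0.
  move=> pT ep; apply/negP => E0; have M := @tab_model m lam.
  have : 0 < nL (sumn lam) (tab_enc T (hi r)) (tab_enc T (lo r)).
    rewrite -(size_reading sT).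
    have L : unL (size (reading T)) (wpos (reading T) r.+1) (wpos (reading T) r) p.+1.
      by rewrite /unL closes_word /wpos /= pT ep eqxx.
    exact: (nL_gt0 (@wpos_bounded (reading T) r.+1) L).
  by move=> /(model_eP M (sT : @cvert _ (tableau_crystal m lam) T))[z] /=; rewrite hT.
have rowE i : i < size T -> all (pred1 i) (nth [::] T i).
  elim/ltn_ind: i => i IHi iT.
  have eT : reading T = flatten (rev (drop i.+1 T)) ++
      (nth [::] T i ++ flatten (rev (take i T))).
    rewrite /reading -{1}(cat_take_drop i T) (drop_nth [::] iT) rev_cat rev_cons.
    by rewrite -cats1 !flatten_cat /= cats0 catA.
  set row := nth [::] T i in eT *.
  have row_mem : row \in T by apply: mem_nth.
  have sR : sorted leq row := allP rowS _ row_mem.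
  have up c : c \in row -> c <= i.
    case/lastP: row eT sR row_mem => // s a eT sR row_mem.
    have ai : a <= i.
      rewrite leqNgt; apply/negP => ia.
      have am : a < m by have /allP := allP ltm _ row_mem; apply; rewrite mem_rcons mem_head.
      have rm : a.-1 < m.-1 by lia.
      pose p := size (flatten (rev (drop i.+1 T)) ++ s).
      have eT' : reading T = rcons (flatten (rev (drop i.+1 T)) ++ s) a ++
          flatten (rev (take i T)).
        by rewrite eT catA -rcons_cat.
      have := noL (Ordinal rm) p; rewrite eT' /= => h.
      have /h h1 : p < size (rcons (flatten (rev (drop i.+1 T)) ++ s) a ++
          flatten (rev (take i T))) by rewrite size_cat size_rcons leq_addr.
      have /h1/negP[] : nth 0 (rcons (flatten (rev (drop i.+1 T)) ++ s) a ++
          flatten (rev (take i T))) p = a.-1.+1 by rewrite cat_rcons nth_at; lia.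
      rewrite drop_size_cat ?size_rcons // wcloses0 //.
        apply/negP => /flattenP[s']; rewrite mem_rev => /(nthP [::])[k].
        rewrite size_takel; last exact: ltnW.
        move=> ki; rewrite nth_take // => es' as'.
        have kT : k < size T := ltn_trans ki iT.
        have := IHi k ki kT; rewrite es' => /allP /(_ _ as') /= /eqP; lia.
    move=> /(nthP 0)[k]; rewrite size_rcons ltnS => ks <-.
    apply: leq_trans ai; have := sorted_nth_le sR (i := k) (j := size s).
    by rewrite (nth_rcons _ _ _ (size s)) ltnn eqxx size_rcons ltnSn andbT => /(_ ks).
  have lowb c : c \in row -> i <= c.
    case: i IHi iT {eT up} @row sR row_mem => // i IHi iT row sR row_mem.
    move=> /(nthP 0)[k kr <-]; have iT' : i < size T by apply: ltnW.
    have /column_strictP[g1 g2] : column_strict (nth [::] T i) row.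
      by have /(sortedP [::]) := colS; apply.
    apply: leq_ltn_trans (g2 k kr).
    have ks : k < size (nth [::] T i) by apply: leq_trans g1.
    by have /allP /(_ _ (mem_nth 0 ks)) /= /eqP -> := IHi i (leqnn _) iT'.
  apply/allP => c cr /=; rewrite eqn_leq up //; exact: lowb.
apply: (@eq_from_nth _ [::]); first by rewrite size_map size_iota.
move=> i iT; rewrite nth_highest_tableau -?sz // -rowsz //.
exact/all_pred1P/rowE.
Qed.

(** No bracket is computed: some highest vertex lies above this tableau, and by uniqueness it is
    this tableau. *)
Lemma highest_highest_tableau : @highest m (tableau_crystal m lam) highest_tableau.
Proof.
have R := model_regular (@tab_model m lam).
have [h [[vh eh] _]] := highest_ex R (highest_tableau_ssyt :
  @cvert _ (tableau_crystal m lam) _).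
by rewrite -(highest_tableau_uniq vh eh).
Qed.

Lemma descends_highest_tableau (T : tableau_crystal m lam) : cvert T ->
  @descends m (tableau_crystal m lam) highest_tableau T.
Proof.
move=> vT; have R := model_regular (@tab_model m lam).
have [h [[vh eh] dh]] := highest_ex R vT.
by rewrite -(highest_tableau_uniq vh eh).
Qed.

Lemma highest_tableau_wt (i : 'I_m) :
  @cwt m (tableau_crystal m lam) highest_tableau i = Posz (nth 0 lam i).
Proof.
congr Posz; rewrite /= count_flatten -map_comp.
rewrite (eq_map (g := fun j => (i == j :> nat) * nth 0 lam j)); last first.
  by move=> j /=; rewrite count_nseq /= eq_sym.
have : forall n, sumn [seq (i == j :> nat) * nth 0 lam j | j <- iota 0 n] =
    if i < n then nth 0 lam i else 0.
  elim=> [|n IHn] //; rewrite -addn1 iotaD map_cat sumn_cat IHn /= add0n addn0 addn1 ltnS.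
  by case: (ltngtP (i : nat) n) => [|//|->] /=; rewrite ?mul0n ?mul1n ?addn0.
move=> ->; case: ltnP => // h; by rewrite nth_default.
Qed.

End HighestTableau.

Lemma partition_of_sorted (s : seq nat) : sorted geq s ->
  let lam := [seq x <- s | x != 0] in
  [/\ is_partition lam, size lam <= size s & forall i, nth 0 lam i = nth 0 s i].
Proof.
move=> ss lam; split.
- rewrite /is_partition sorted_filter //=; last by move=> a b c /= h1 h2; lia.
  by rewrite mem_filter.
- by rewrite size_filter count_size.
rewrite /lam; elim: s ss {lam} => //= a s IHs ps i.
have := order_path_min _ ps => /(_ _) as_.
case: eqP => [a0|_] /=; last by case: i => //= i; apply: IHs; apply: path_sorted ps.
have /allP h := as_ ltac:(move=> b c d /= h1 h2; lia).
have z k : nth 0 s k = 0.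
  case: (ltnP k (size s)) => ks; last by rewrite nth_default.
  by have := h _ (mem_nth 0 ks) => /=; lia.
rewrite (IHs (path_sorted ps)) z a0; by case: i => //= i; rewrite z.
Qed.

Theorem model_components (m N : nat) (G : colored_graph m)
  (enc : G -> 'I_m -> nat -> bool) (y : G) : set_model N enc -> cvert y ->
  exists lam : seq nat, [/\ is_partition lam, size lam <= m
    & crystal_iso (component y) (tableau_crystal m lam)].
Proof.
move=> M vy; have R := model_regular M.
have [h [hh dh]] := highest_ex R vy; have [vh eh] := hh.
pose s := [seq nset N (enc h i) | i : 'I_m].
have sE (k : 'I_m) : nth 0 s k = nset N (enc h k).
  by rewrite /s (nth_map k) ?size_enum_ord // nth_ord_enum.
(* Epsilon vanishes at [h], so consecutive weights differ by phi, which is nonnegative. *)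
have ss : sorted geq s.
  apply/(sortedP 0) => i; rewrite size_map size_enum_ord => im.
  have im' : i < m by lia.
  have r1 : i < m.-1 by lia.
  have := crystal_phi_eps (rc_crystal R) (Ordinal r1) vh.
  rewrite !(sm_wt M) // (rc_eps_None (eh _)).
  have := sE (lo (Ordinal r1)); have := sE (hi (Ordinal r1)).
  by rewrite /= => -> -> e; lia.
have [p1 p2 p3] := partition_of_sorted ss.
have sm : size [seq x <- s | x != 0] <= m.
  by rewrite (leq_trans p2) // size_map size_enum_ord.
exists [seq x <- s | x != 0]; split=> //.
apply: (@component_iso m G (tableau_crystal m _) h y (highest_tableau [seq x <- s | x != 0])) => //.
- exact: model_regular (@tab_model m _).
- exact: highest_highest_tableau.
- by move=> k; rewrite highest_tableau_wt // p3 (sm_wt M) // sE.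
- exact: descends_highest_tableau.
Qed.

(** * Reduced words *)

Section Coxeter.
Variable n : nat.
Hypothesis hn : 1 < n.
Implicit Types (s t : seq 'I_n) (i j : 'I_n) (g u : affS n).
Local Open Scope group_scope.

Lemma word_prod_nil : word_prod [::] = 1 :> affS n.
Proof. by rewrite /word_prod big_nil. Qed.

Lemma word_prod_cons i s : word_prod (i :: s) = gen i * word_prod s.
Proof. by rewrite /word_prod big_cons. Qed.

Lemma word_prod_cat s t : word_prod (s ++ t) = word_prod s * word_prod t.
Proof. by rewrite /word_prod big_cat. Qed.

Lemma word_prod1 i : word_prod [:: i] = gen i.
Proof. by rewrite word_prod_cons word_prod_nil mulg1. Qed.

Lemma cox_eq_prod s t : cox_eq s t -> word_prod s = word_prod t.
Proof. by move=> st; rewrite !word_prodE; apply/affS_ofP. Qed.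

Lemma prod_cox_eq s t : word_prod s = word_prod t -> cox_eq s t.
Proof. by rewrite !word_prodE => /affS_ofP. Qed.

Lemma gen_sqr i : gen i * gen i = 1.
Proof.
have := cox_eq_prod (cox_quad i).
by rewrite !word_prod_cons word_prod_nil mulg1.
Qed.

Lemma genV i : (gen i)^-1 = gen i.
Proof. by apply: (mulgI (gen i)); rewrite mulgV gen_sqr. Qed.

Lemma genK i g : gen i * (gen i * g) = g.
Proof. by rewrite mulgA gen_sqr mul1g. Qed.

Lemma gen_braid i : 2 < n ->
  gen i * (gen (ordS i) * gen i) = gen (ordS i) * (gen i * gen (ordS i)).
Proof.
move=> n2; have := cox_eq_prod (cox_braid i n2).
by rewrite !word_prod_cons word_prod_nil !mulg1.
Qed.

Lemma gen_comm i j : i != j -> i != ordS j -> j != ordS i ->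
  gen i * gen j = gen j * gen i.
Proof.
move=> h1 h2 h3; have := cox_eq_prod (cox_comm h1 h2 h3).
by rewrite !word_prod_cons word_prod_nil !mulg1.
Qed.

Lemma word_prodV s : (word_prod s)^-1 = word_prod (rev s).
Proof.
elim: s => [|i s IHs]; first by rewrite word_prod_nil invg1.
by rewrite word_prod_cons invgM IHs genV rev_cons -cats1 word_prod_cat word_prod1.
Qed.

(** The reflections of the word: each letter's generator conjugated by the product of the letters
    before it. *)
Fixpoint refl s : seq (affS n) :=
  if s is i :: s' then gen i :: [seq gen i * (u * gen i) | u <- refl s'] else [::].

Lemma size_refl s : size (refl s) = size s.
Proof. by elim: s => //= i s <-; rewrite size_map. Qed.

Lemma refl_cat s t :
  refl (s ++ t) = refl s ++ [seq word_prod s * (u * (word_prod s)^-1) | u <- refl t].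
Proof.
elim: s => [|i s IHs] /=.
  by rewrite -[LHS]map_id; apply: eq_map => u; rewrite word_prod_nil mul1g invg1 mulg1.
rewrite IHs map_cat -map_comp; congr (_ :: (_ ++ _)); apply: eq_map => u /=.
by rewrite word_prod_cons invgM genV !mulgA.
Qed.

Lemma gen_conj_inj i : injective (fun u => gen i * (u * gen i)).
Proof. by move=> u v /= /mulgI /mulIg. Qed.

Definition nrefl s u := odd (count_mem u (refl s)).

Lemma count_conj g u (l : seq (affS n)) :
  count_mem u [seq g * (v * g^-1) | v <- l] = count_mem (g^-1 * (u * g)) l.
Proof.
rewrite count_map; apply: eq_count => v /=; apply/eqP/eqP => [<-|->].
  by rewrite !mulgA mulVg mul1g mulgVK.
by rewrite !mulgA mulgV mul1g mulgK.
Qed.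

(** Only the parity of a multiplicity is attached to the group element: the quadratic relation adds
    a reflection twice, while the braid and commutation relations permute the sequence. *)
Lemma nrefl_cox s t : cox_eq s t -> nrefl s =1 nrefl t.
Proof.
elim=> {s t} [s|s t _ IH|s t r _ IH1 _ IH2|s s' t t' e1 IH1 e2 IH2|i|i n2|i j h1 h2 h3] u //.
- by rewrite IH1.
- rewrite /nrefl !refl_cat !count_cat !oddD !count_conj (cox_eq_prod e1).
  by have := IH1 u; have := IH2 ((word_prod s')^-1 * (u * word_prod s')); rewrite /nrefl => -> ->.
- by rewrite /nrefl /= genK; case: eqP.
- rewrite /nrefl /= -!mulgA.
  have e : gen i * (gen (ordS i) * (gen i * (gen (ordS i) * gen i))) = gen (ordS i).
    by rewrite gen_braid // !genK.
  have e' : gen (ordS i) * (gen i * (gen (ordS i) * (gen i * gen (ordS i)))) = gen i.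
    by rewrite -gen_braid // !genK.
  by rewrite !e !e' gen_braid // !addn0; congr odd; lia.
- have e : gen i * (gen j * gen i) = gen j by rewrite -gen_comm // genK.
  have e' : gen j * (gen i * gen j) = gen i by rewrite gen_comm // genK.
  by rewrite /nrefl /= e e' !addn0; congr odd; lia.
Qed.

Lemma nrefl_prod s t : word_prod s = word_prod t -> nrefl s =1 nrefl t.
Proof. by move/prod_cox_eq/nrefl_cox. Qed.

(** The exchange condition: multiplying by a reflection of the word deletes the letter it comes
    from. *)
Lemma refl_del u s : u \in refl s -> exists s',
  [/\ size s = (size s').+1, {subset s' <= s} & u * word_prod s = word_prod s'].
Proof.
elim: s u => [|i s IHs] u //=; rewrite inE => /orP[/eqP->|/mapP[v vs ->]].
  exists s; split=> //; first by move=> k ks; rewrite inE ks orbT.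
  by rewrite word_prod_cons genK.
have [s' [h1 h2 h3]] := IHs v vs; exists (i :: s'); split=> /=; first by rewrite h1.
  by move=> k; rewrite !inE => /orP[->|/h2->]; rewrite ?orbT.
by rewrite !word_prod_cons -h3 -!mulgA genK.
Qed.

Lemma refl_not_uniq s : ~~ uniq (refl s) -> exists s',
  [/\ size s' < size s, {subset s' <= s} & word_prod s' = word_prod s].
Proof.
elim: s => [|i s IHs] //=; rewrite negb_and negbK => /orP[|]; last first.
  rewrite (map_inj_uniq (@gen_conj_inj i)) => /IHs[s' [h1 h2 h3]].
  exists (i :: s'); split=> //=; last by rewrite !word_prod_cons h3.
  by move=> k; rewrite !inE => /orP[->|/h2->]; rewrite ?orbT.
move=> /mapP[v vs e].
have ev : v = gen i.
  by apply: (mulIg (gen i)); apply: (mulgI (gen i)); rewrite -e gen_sqr mulg1.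
rewrite ev in vs; have [s' [h1 h2 h3]] := refl_del vs.
exists s'; split; first by rewrite h1; lia.
  by move=> k /h2 ks; rewrite inE ks orbT.
by rewrite word_prod_cons h3.
Qed.

Lemma cox_length_le s : cox_length (word_prod s) <= size s.
Proof.
rewrite /cox_length; case: ex_minnP => k _; apply.
by apply/asboolP; exists s.
Qed.

Lemma cox_length_ex g : exists s, reduced_word g s.
Proof.
rewrite /reduced_word /cox_length; case: ex_minnP => k /asboolP[s sk sg] _.
by exists s.
Qed.

Lemma refl_sub s t : uniq (refl s) -> word_prod s = word_prod t ->
  {subset refl s <= refl t}.
Proof.
move=> us e u us'; have := nrefl_prod e u; rewrite /nrefl count_uniq_mem // us' /=.
by rewrite -has_pred1 has_count; case: (count _ _).
Qed.

(** A reflection occurring an odd number of times in one word occurs in every word for the same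
    element, so distinct reflections bound all lengths from below; a repeated reflection allows the
    word to be shortened. *)
Lemma uniq_refl_length s : uniq (refl s) = (size s == cox_length (word_prod s)).
Proof.
apply/idP/eqP => [us|e].
  apply/eqP; rewrite eqn_leq cox_length_le andbT.
  have [t [et <-]] := cox_length_ex (word_prod s).
  by rewrite -!size_refl; apply: uniq_leq_size => //; apply: refl_sub.
apply: contraT => /refl_not_uniq[s' [h1 _ h3]].
by have := cox_length_le s'; rewrite h3 -e; lia.
Qed.

(* The numbers game gives a representation in which each generator only changes
   its own coordinate. *)
Definition fire i (c : 'I_n -> int) : 'I_n -> int := fun k =>
  if k == i then (c (ordS i) + c (ord_pred i) - c i)%R else c k.

Definition play s c := foldr fire c s.

Lemma ordS_neq i : (ordS i == i) = false.
Proof.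
apply/negbTE/eqP => /(congr1 val) /=; have := ltn_ord i.
case: (ltnP i.+1 n) => h; first by rewrite (modn_small h); lia.
have -> : i.+1 = n by have := ltn_ord i; lia.
by rewrite modnn; lia.
Qed.

Lemma ord_pred_neq i : (ord_pred i == i) = false.
Proof. by rewrite -{2}(ord_predK i) eq_sym ordS_neq. Qed.

Lemma ordSS_neq i : 2 < n -> (ordS (ordS i) == i) = false.
Proof.
move=> n2; apply/negbTE/eqP => /(congr1 val) /=; have := ltn_ord i.
case: (ltnP i.+2 n) => h.
  by rewrite (modn_small (_ : i.+1 < n)) ?modn_small //; lia.
case: (eqVneq i.+1 n) => [e|h'] il.
  by rewrite e modnn (modn_small (ltnW n2)); lia.
have e : i.+2 = n by move: h h' il; lia.
by rewrite (modn_small (_ : i.+1 < n)) ?e ?modnn; lia.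
Qed.

Lemma play_cox s t : cox_eq s t -> forall c, play s c = play t c.
Proof.
rewrite /play.
elim=> {s t} [s|s t _ IH|s t r _ IH1 _ IH2|s s' t t' _ IH1 _ IH2|i|i n2|i j h1 h2 h3] c //.
- by rewrite IH1.
- by rewrite !foldr_cat IH2 IH1.
- apply: funext => k /=; rewrite /fire; case: eqP => [->|//].
  by rewrite eqxx ordS_neq ord_pred_neq; lia.
- have S1 := ordS_neq i; have S2 := ordS_neq (ordS i).
  have S3 := ordSS_neq i n2; have P1 := ord_pred_neq i.
  have P2 : (ord_pred i == ordS i) = false.
    by rewrite -(inj_eq (@ordS_inj n)) ord_predK eq_sym ordSS_neq.
  have S1' : (i == ordS i) = false by rewrite eq_sym.
  apply: funext => k /=; rewrite /fire ordSK.
  have [->|ki] := eqVneq k i.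
    by rewrite ?(S1', eqxx, S1, P1, P2, S2, S3) /=; lia.
  have [_|kj] := eqVneq k (ordS i).
    by rewrite ?(S1', eqxx, S1, P1, P2, S2, S3) /=; lia.
  by [].
- have ij : (j == i) = false by rewrite eq_sym (negbTE h1).
  have a1 : (ordS i == j) = false by rewrite eq_sym (negbTE h3).
  have a2 : (ordS j == i) = false by rewrite eq_sym (negbTE h2).
  have a3 : (ord_pred i == j) = false.
    by rewrite -(inj_eq (@ordS_inj n)) ord_predK (negbTE h2).
  have a4 : (ord_pred j == i) = false.
    by rewrite -(inj_eq (@ordS_inj n)) ord_predK (negbTE h3).
  apply: funext => k /=; rewrite /fire a1 a2 a3 a4 ij (negbTE h1).
  have [e|ki] := eqVneq k i; first by subst k; rewrite (negbTE h1).
  by [].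
Qed.

(** Play from the indicator of [i]: letters other than [i] leave that coordinate equal to 1, whereas
    firing [i] turns it into -1. *)
Lemma gen_notin i s : i \notin s -> word_prod s <> gen i.
Proof.
move=> ins; rewrite -word_prod1 => /prod_cox_eq /play_cox e.
have := congr1 (fun f => f i) (e (fun k => (k == i)%:R%R)).
have -> : play s (fun k : 'I_n => (k == i)%:R%R) i = 1%R.
  elim: s ins {e} => [|j s IHs] /=; first by rewrite eqxx.
  rewrite inE negb_or => /andP[ij /IHs h]; rewrite /fire (negbTE ij).
  exact: h.
by rewrite /= /fire eqxx ordS_neq ord_pred_neq.
Qed.

Lemma refl_word u s : u \in refl s -> exists2 s', {subset s' <= s} & u = word_prod s'.
Proof.
elim: s u => [|i s IHs] u //=; rewrite inE => /orP[/eqP->|/mapP[v /IHs[t ts ->] ->]].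
  by exists [:: i]; [move=> k; rewrite !inE => ->|rewrite word_prod1].
exists (i :: t ++ [:: i]); last by rewrite word_prod_cons word_prod_cat word_prod1.
move=> k; rewrite !(inE, mem_cat) => /or3P[->|/ts->|->]; rewrite ?orbT //.
Qed.

(** Let [i] be the first letter of [s] missing from [t]. Its reflection occurs in [t] by parity,
    hence is a product of letters of [t]; conjugating back by the prefix before [i], whose letters
    are in [t], writes [gen i] without the letter [i]. *)
Lemma content_sub s t : uniq (refl s) -> word_prod s = word_prod t ->
  {subset s <= t}.
Proof.
move=> us e; apply/allP; apply: contraT.
rewrite -has_predC has_find => hf.
set k := find (predC (mem t)) s in hf.
pose i := nth (Ordinal (ltnW hn)) s k.
have it : i \notin t.
  have := nth_find (Ordinal (ltnW hn)) (_ : has (predC (mem t)) s).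
  by apply; rewrite has_find.
have s1t : {subset take k s <= t}.
  move=> j /(nthP (Ordinal (ltnW hn)))[l]; rewrite size_takel; last exact: ltnW.
  move=> lk <-; rewrite nth_take //.
  by have := before_find (Ordinal (ltnW hn)) lk => /= /negbFE.
have es : s = take k s ++ i :: drop k.+1 s by rewrite -drop_nth // cat_take_drop.
pose s1 := take k s.
have rs : word_prod s1 * (gen i * (word_prod s1)^-1) \in refl s.
  by rewrite es refl_cat mem_cat /= inE eqxx orbT.
have [t' t't et'] := refl_word (refl_sub us e rs).
have : word_prod (rev s1 ++ t' ++ s1) = gen i.
  by rewrite !word_prod_cat -et' -word_prodV -!mulgA mulVg mulg1 mulKg.
move=> ew; exfalso; apply: (gen_notin _ ew).
rewrite !mem_cat mem_rev !negb_or; apply/and3P.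
by split; apply: contra it; [apply: s1t|apply: t't|apply: s1t].
Qed.

Lemma con_word s : uniq (refl s) -> con (word_prod s) =i s.
Proof.
move=> us i; rewrite inE; apply/asboolP/idP => [[t [et st] it]|si].
  have ut : uniq (refl t) by rewrite uniq_refl_length st et.
  exact: content_sub ut et _ it.
by exists s => //; split=> //; apply/eqP; rewrite -uniq_refl_length.
Qed.

Lemma uniq_refl s : uniq s -> uniq (refl s).
Proof.
elim: s => //= i s IHs /andP[ins us]; rewrite (map_inj_uniq (@gen_conj_inj i)) IHs // andbT.
apply/negP => /mapP[v vs e].
have ev : v = gen i.
  by apply: (mulIg (gen i)); apply: (mulgI (gen i)); rewrite -e gen_sqr mulg1.
rewrite ev in vs; have [t ts et] := refl_word vs.
by apply: (gen_notin (s := t) (i := i)) => //; apply: contra ins => /ts.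
Qed.

Lemma cox_length_mul g h : cox_length (g * h) <= cox_length g + cox_length h.
Proof.
have [s [<- <-]] := cox_length_ex g; have [t [<- <-]] := cox_length_ex h.
by rewrite -word_prod_cat -size_cat cox_length_le.
Qed.

Lemma cox_length1 : cox_length (1 : affS n) = 0.
Proof. by apply/eqP; rewrite -leqn0 -word_prod_nil cox_length_le. Qed.

End Coxeter.

(** * Products of decreasing words *)

Section BraidIdentity.
Variables (T : groupType) (N : nat) (g : nat -> T).
Local Open Scope group_scope.
Hypothesis gK : forall k, g k * g k = 1.
Hypothesis gC : forall i j, 0 < i -> i.+1 < j -> j <= N -> commute (g i) (g j).
Hypothesis gB : forall k, 0 < k < N -> g k * (g k.+1 * g k) = g k.+1 * (g k * g k.+1).

Definition dprod U a l : T := \prod_(k <- rev (iota a l) | U k) g k.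

Lemma dprod0 U a : dprod U a 0 = 1.
Proof. by rewrite /dprod big_nil. Qed.

Lemma dprodD U a l1 l2 : dprod U a (l1 + l2) = dprod U (a + l1) l2 * dprod U a l1.
Proof. by rewrite /dprod iotaD rev_cat big_cat. Qed.

Lemma dprod1 U a : dprod U a 1 = if U a then g a else 1.
Proof. by rewrite /dprod /= /rev /= big_cons big_nil mulg1. Qed.

Lemma dprodS U a l :
  dprod U a l.+1 = (if U (a + l) then g (a + l) else 1) * dprod U a l.
Proof. by rewrite -addn1 dprodD dprod1. Qed.

Lemma dprodSl U a l : dprod U a l.+1 = dprod U a.+1 l * (if U a then g a else 1).
Proof. by rewrite -add1n dprodD dprod1 addn1. Qed.

Lemma dprod_ext U V a l : (forall k, a <= k < a + l -> U k = V k) ->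
  dprod U a l = dprod V a l.
Proof.
move=> h; rewrite /dprod big_seq_cond [RHS]big_seq_cond; apply: eq_bigl => k.
by rewrite mem_rev mem_iota; case: (boolP (_ <= _ < _)) => // /h ->.
Qed.

Lemma dprod_commute U V a l b k : 0 < a -> b + k <= N.+1 ->
  (forall i j, a <= i < a + l -> b <= j < b + k -> U i -> V j -> i.+1 < j) ->
  commute (dprod U a l) (dprod V b k).
Proof.
move=> a0 bk h; rewrite /dprod big_seq_cond [X in commute _ X]big_seq_cond.
apply: commute_prod => j; rewrite mem_rev mem_iota => /andP[jb Vj].
apply/commute_sym/commute_prod => i; rewrite mem_rev mem_iota => /andP[ia Ui].
by apply/commute_sym/gC; [lia|apply: h|lia].
Qed.

Notation full := (fun _ : nat => true).

(** Conjugation by a decreasing run shifts its inner generators by one: [g j.+1] passes the lower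
    end, one braid relation turns it into [g j], which passes the upper end. *)
Lemma run_shift a l j : 0 < a -> a + l <= N.+1 -> a <= j -> j.+1 < a + l ->
  dprod full a l * g j.+1 = g j * dprod full a l.
Proof.
move=> a0 al aj jl.
have el : l = (j - a) + (2 + (a + l - j.+2)) by lia.
have ej : a + (j - a) = j by lia.
rewrite el !dprodD ej.
have -> : dprod full j 2 = g j.+1 * g j by rewrite dprodS dprod1 addn1.
have jc : commute (g j) (dprod full (j + 2) (a + l - j.+2)).
  have -> : g j = dprod full j 1 by rewrite dprod1.
  by apply: dprod_commute => [||i k]; lia.
have jc' : commute (dprod full a (j - a)) (g j.+1).
  have -> : g j.+1 = dprod full j.+1 1 by rewrite dprod1.
  by apply: dprod_commute => [||i k]; lia.
rewrite -!mulgA jc' [RHS]mulgA jc -!mulgA; congr (_ * _).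
by rewrite !mulgA -(mulgA (g j)) gB ?mulgA //; lia.
Qed.

Lemma run_commute a l : 0 < a -> a + l <= N ->
  dprod full a l.+1 * dprod full a.+1 l = dprod full a l * dprod full a l.+1.
Proof.
move=> a0 al.
suff P k : k <= l -> dprod full a l.+1 * dprod full a.+1 k =
    dprod full a k * dprod full a l.+1 by apply: P.
elim: k => [|k IHk] kl; first by rewrite !dprod0 mulg1 mul1g.
rewrite !(dprodS _ _ k) mulgA addSn run_shift; try lia.
by rewrite -!mulgA IHk //; lia.
Qed.

Definition dfull U := dprod U 1 N.

Lemma dfull_split U c b : 0 < c <= b -> b <= N ->
  dfull U = dprod U b.+1 (N - b) * dprod U c (b - c).+1 * dprod U 1 c.-1.
Proof.
move=> cb bN; rewrite /dfull.
have -> : N = c.-1 + ((b - c).+1 + (N - b)) by lia.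
rewrite !dprodD; have -> : 1 + c.-1 = c by lia.
have -> : c + (b - c).+1 = b.+1 by lia.
by rewrite (_ : _ - b = N - b) //; lia.
Qed.

Section Pair.
Variables (c b : nat).
Hypotheses (cb : 0 < c <= b) (bN : b <= N).

(** The gaps of [U] at [c - 1] and of [V] at [b + 1] let the blocks above, inside and below [[c, b]]
    move past each other, so that an identity on [[c, b]] alone suffices. *)
Lemma dfull_mul U V : U c.-1 = false -> V b.+1 = false ->
  dfull U * dfull V = (dprod U b.+1 (N - b) * dprod V b.+1 (N - b)) *
    (dprod U c (b - c).+1 * dprod V c (b - c).+1) *
    (dprod U 1 c.-1 * dprod V 1 c.-1).
Proof.
move=> Uc Vb; rewrite !(dfull_split _ cb bN).
set A1 := dprod U b.+1 _; set A2 := dprod U c _; set A3 := dprod U 1 _.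
set B1 := dprod V b.+1 _; set B2 := dprod V c _; set B3 := dprod V 1 _.
have c31 : commute A3 B1.
  by apply: dprod_commute => [||i j ia jb Ui Vj]; lia.
have c32 : commute A3 B2.
  apply: dprod_commute => [||i j ia jb Ui Vj]; try lia.
  have [e|?] := eqVneq i c.-1; last lia.
  by move: Ui; rewrite e Uc.
have c21 : commute A2 B1.
  apply: dprod_commute => [||i j ia jb Ui Vj]; try lia.
  have [e|?] := eqVneq j b.+1; last lia.
  by move: Vj; rewrite e Vb.
rewrite -!mulgA; congr (_ * _).
rewrite (mulgA A3) c31 -mulgA (mulgA A2) c21 -mulgA; congr (_ * (_ * _)).
by rewrite !mulgA c32.
Qed.

Variables U V : nat -> bool.
Hypothesis Ucb : forall k, c <= k <= b -> U k.
Hypotheses (Uc : U c.-1 = false) (Vb : V b.+1 = false).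

Let fullU : dprod U c (b - c).+1 = dprod full c (b - c).+1.
Proof. by apply: dprod_ext => k kc; rewrite Ucb //; lia. Qed.

Let rmvE : dprod (rmv U b) c (b - c).+1 = dprod full c (b - c).
Proof.
rewrite dprodS (_ : c + (b - c) = b); last lia.
rewrite /rmv eqxx andbF mul1g; apply: dprod_ext => k kc.
have nkb : k != b by lia.
by rewrite nkb Ucb //; lia.
Qed.

Let rmv_ends : dprod (rmv U b) b.+1 (N - b) = dprod U b.+1 (N - b) /\
  dprod (rmv U b) 1 c.-1 = dprod U 1 c.-1.
Proof. by split; apply: dprod_ext => k kc; rewrite rmv_neq //; lia. Qed.

Let Uc' : rmv U b c.-1 = false. Proof. by rewrite /rmv Uc. Qed.

Lemma dfull_raise : (forall k, c < k <= b -> V k) -> V c = false ->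
  dfull U * dfull V = dfull (rmv U b) * dfull (ins V c).
Proof.
move=> Vcb Vc.
have Vb' : ins V c b.+1 = false by rewrite ins_neq ?Vb //; lia.
rewrite (dfull_mul Uc Vb) (dfull_mul Uc' Vb'); have [-> ->] := rmv_ends.
have -> : dprod (ins V c) b.+1 (N - b) = dprod V b.+1 (N - b).
  by apply: dprod_ext => k kb; rewrite ins_neq //; lia.
have -> : dprod (ins V c) 1 c.-1 = dprod V 1 c.-1.
  by apply: dprod_ext => k kb; rewrite ins_neq //; lia.
have -> : dprod (ins V c) c (b - c).+1 = dprod full c (b - c).+1.
  apply: dprod_ext => k kc; rewrite /ins; have [->|nk] := eqVneq k c.
    by rewrite orbT.
  by rewrite Vcb //; lia.
have -> : dprod V c (b - c).+1 = dprod full c.+1 (b - c).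
  rewrite dprodSl Vc mulg1; apply: dprod_ext => k kc; rewrite Vcb //; lia.
by rewrite fullU rmvE run_commute //; lia.
Qed.

(* Hence the product is not reduced when [U] and [V] contain a common run. *)
Lemma dfull_cancel : (forall k, c <= k <= b -> V k) ->
  dfull U * dfull V = dfull (rmv U b) * dfull (rmv V c).
Proof.
move=> Vcb.
have Vb' : rmv V c b.+1 = false by rewrite /rmv Vb.
rewrite (dfull_mul Uc Vb) (dfull_mul Uc' Vb'); have [-> ->] := rmv_ends.
have -> : dprod (rmv V c) b.+1 (N - b) = dprod V b.+1 (N - b).
  by apply: dprod_ext => k kb; rewrite rmv_neq //; lia.
have -> : dprod (rmv V c) 1 c.-1 = dprod V 1 c.-1.
  by apply: dprod_ext => k kb; rewrite rmv_neq //; lia.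
have -> : dprod V c (b - c).+1 = dprod full c (b - c).+1.
  by apply: dprod_ext => k kc; rewrite Vcb //; lia.
have -> : dprod (rmv V c) c (b - c).+1 = dprod full c.+1 (b - c).
  rewrite dprodSl /rmv eqxx andbF mulg1; apply: dprod_ext => k kc.
  have nkc : k != c by lia.
  by rewrite nkc Vcb //; lia.
rewrite fullU rmvE {2}dprodSl (mulgA (dprod full c _)) run_commute; try lia.
by rewrite {1}dprodSl -!mulgA (mulgA (g c)) gK mul1g.
Qed.

End Pair.

(** The largest letter can be brought to the front: its lower neighbour is not on its left, and
    every other letter there commutes with it. *)
Lemma sort_prod M (ks : seq nat) : M <= N -> uniq ks ->
  (forall k, k \in ks -> 0 < k <= M) -> (forall k, ~~ mem2 ks k k.+1) ->
  \prod_(k <- ks) g k = dprod (fun k => k \in ks) 1 M.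
Proof.
elim: M ks => [|M IHM] ks MN uks hks h2.
  rewrite dprod0; case: ks hks {uks h2} => [|k ks] hks; first by rewrite big_nil.
  by have := hks k (mem_head _ _); lia.
case kM: (M.+1 \in ks); last first.
  rewrite IHM //; [|lia|move=> k kk].
    by rewrite dprodS /= add1n kM mul1g.
  have := hks k kk; have [e|?] := eqVneq k M.+1; last lia.
  by move: kk; rewrite e kM.
have [l1 [l2 eks]] : exists l1 l2, ks = l1 ++ M.+1 :: l2.
  by case/splitPr: kM => l1 l2; exists l1, l2.
have sub : subseq (l1 ++ l2) ks.
  by rewrite eks cat_subseq // subseq_cons.
have nM : M.+1 \notin l1 ++ l2.
  by move: uks; rewrite eks -cat1s uniq_catCA /= => /andP[].
have Ml1 : M \notin l1.
  apply/negP => Ml1; have := h2 M; rewrite eks mem2_cat; case/norP => _.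
  by rewrite Ml1 /= mem_head.
rewrite eks big_cat big_cons /= dprodS add1n mem_cat mem_head orbT.
have c1 : commute (g M.+1) (\prod_(k <- l1) g k).
  rewrite big_seq; apply: commute_prod => k kl; apply/commute_sym/gC => //.
    by have := hks k; rewrite eks mem_cat kl => /(_ isT)/andP[].
  have := hks k; rewrite eks mem_cat kl => /(_ isT).
  have [e|k1] := eqVneq k M; first by rewrite -e kl in Ml1.
  have [e|k2] := eqVneq k M.+1; last lia.
  by move: nM; rewrite -e mem_cat kl.
rewrite mulgA -c1 -mulgA -big_cat IHM.
- congr (_ * _); apply: dprod_ext => k kM'; rewrite /= !mem_cat inE.
  by rewrite (_ : k == M.+1 = false) //; lia.
- lia.
- exact: subseq_uniq sub uks.
- move=> k kk; have := hks k (mem_subseq sub kk).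
  by have [e|?] := eqVneq k M.+1; [rewrite e (negbTE nM) in kk|lia].
- move=> k; apply: contra (h2 k); rewrite !mem2E => h.
  exact: subseq_trans h sub.
Qed.

End BraidIdentity.

(** * Letters and ranks *)

Section Letters.
Variables (n : nat) (x : 'I_n).
Local Notation N := n.-1.
Implicit Types (a b : 'I_n) (A B : {set 'I_n}) (u v g : affS n).

(** Both [letter 0] and [letter n] are [x]: stepping off either end of the ranks [1, ..., n - 1]
    lands on the missing letter. *)
Definition letter k : 'I_n :=
  Ordinal (ltn_pmod (x + k) (leq_ltn_trans (leq0n x) (ltn_ord x))).

(* Ranks are shifted by one, so that they are positive; x has rank n. *)
Definition rk a := (xrank x a).+1.

Lemma letterE k : k <= n -> letter k = (if x + k < n then x + k else x + k - n) :> nat.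
Proof.
move=> kn /=; have := ltn_ord x; case: (ltnP (x + k) n) => h xn; first by rewrite modn_small.
have -> : x + k = (x + k - n) + n by lia.
by rewrite modnDr modn_small; lia.
Qed.

Lemma rkE a : rk a = if a <= x then a + n - x else a - x.
Proof.
rewrite /rk /xrank; have := ltn_ord a; have := ltn_ord x; case: (leqP a x) => h xn an.
  by rewrite modn_small; lia.
have -> : a + n - x.+1 = (a - x.+1) + n by lia.
by rewrite modnDr modn_small; lia.
Qed.

Lemma rk_bounds a : 0 < rk a <= n.
Proof. by rewrite rkE; have := ltn_ord a; have := ltn_ord x; case: (leqP a x); lia. Qed.

Lemma rkK a : letter (rk a) = a.
Proof.
apply: val_inj; have rb := rk_bounds a.
have e := letterE (k := rk a) ltac:(lia); have r := rkE a.
rewrite [LHS]e /=; have := ltn_ord a; have := ltn_ord x; move: r rb {e}.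
by case: (leqP a x); case: (ltnP (x + rk a) n); lia.
Qed.

Lemma letterK k : 0 < k <= n -> rk (letter k) = k.
Proof.
move=> kn; rewrite rkE letterE; last lia.
have := ltn_ord x; case: (ltnP (x + k) n) => h1 xn.
  by case: (leqP (x + k) x); lia.
by case: (leqP (x + k - n) x); lia.
Qed.

Lemma rk_inj : injective rk.
Proof. by move=> a b e; rewrite -(rkK a) e rkK. Qed.

Lemma rk_x : rk x = n.
Proof. by rewrite rkE leqnn addKn. Qed.

Lemma letter0 : letter 0 = x.
Proof. by apply: val_inj; rewrite /= addn0 modn_small. Qed.

Lemma ordS_letter k : ordS (letter k) = letter k.+1.
Proof. by apply: val_inj; rewrite /= -addn1 modnDml addnAC addn1 addnS. Qed.

Lemma ord_pred_letter k : ord_pred (letter k.+1) = letter k.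
Proof. by rewrite -ordS_letter ordSK. Qed.

Definition gl k := gen (letter k).

Lemma letter_neq i j : 0 < i <= n -> 0 < j <= n -> i != j -> letter i != letter j.
Proof. by move=> hi hj; apply: contra => /eqP/(congr1 rk); rewrite !letterK // => ->. Qed.

Hypothesis hn : 1 < n.
Local Open Scope group_scope.

Lemma gl_sqr k : gl k * gl k = 1. Proof. exact: gen_sqr. Qed.

Lemma gl_comm i j : 0 < i -> i.+1 < j -> j <= N -> commute (gl i) (gl j).
Proof.
move=> i0 ij jN; apply: gen_comm; rewrite ?ordS_letter; apply: letter_neq; lia.
Qed.

Lemma gl_braid k : 0 < k < N ->
  gl k * (gl k.+1 * gl k) = gl k.+1 * (gl k * gl k.+1).
Proof. by move=> kN; rewrite /gl -ordS_letter gen_braid //; lia. Qed.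

Definition ranks A : nat -> bool := fun k => (0 < k <= n) && (letter k \in A).
Definition cyc U := dfull N gl U.

Lemma ranks_rk A a : ranks A (rk a) = (a \in A).
Proof. by rewrite /ranks rk_bounds rkK. Qed.

Lemma ranks_bounded A : x \notin A -> bounded N (ranks A).
Proof.
move=> xA k /andP[kn kA]; suff : k != n by lia.
have lx : letter n = x by have := rkK x; rewrite rk_x.
by apply: contraNneq xA => e; rewrite e lx in kA.
Qed.

Lemma letter_eq k a : 0 < k <= n -> (letter k == a) = (k == rk a).
Proof. by move=> kn; apply/eqP/eqP => [<-|->]; rewrite ?letterK ?rkK. Qed.

Lemma ranksD1 A b : ranks (A :\ b) = rmv (ranks A) (rk b).
Proof.
apply: funext => k; rewrite /ranks /rmv; case: (boolP (0 < k <= n)) => //= kn.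
by rewrite !inE letter_eq // andbC.
Qed.

Lemma ranksU1 A b : ranks (b |: A) = ins (ranks A) (rk b).
Proof.
apply: funext => k; rewrite /ranks /ins; case: (boolP (0 < k <= n)) => kn /=.
  by rewrite !inE letter_eq // orbC.
by symmetry; apply/eqP => e; move: kn; rewrite e rk_bounds.
Qed.

Lemma nset_ranks A : x \notin A -> nset N (ranks A) = #|A|.
Proof.
move=> xA; rewrite cardE -(size_map rk) /nset -size_filter; apply: perm_size.
apply: uniq_perm; rewrite ?filter_uniq ?iota_uniq //.
  by rewrite map_inj_uniq ?enum_uniq //; apply: rk_inj.
move=> k; rewrite mem_filter mem_iota; apply/idP/mapP => [/andP[/andP[kn kA] _]|[a]].
  by exists (letter k); rewrite ?mem_enum ?letterK.
rewrite mem_enum => aA ->; rewrite ranks_rk aA /=.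
by have /(ranks_bounded xA) : ranks A (rk a) by rewrite ranks_rk.
Qed.

Lemma cyc_word s : cyc_decreasing_word s -> x \notin s ->
  word_prod s = cyc (ranks [set a in s]).
Proof.
move=> [us h2] xs; have rkN a : a \in s -> 0 < rk a <= N.
  move=> as_; have /(ranks_bounded (A := [set a in s])) : ranks [set a in s] (rk a).
    by rewrite ranks_rk inE.
  by apply; rewrite inE.
have -> : word_prod s = \prod_(k <- map rk s) gl k.
  by rewrite big_map /word_prod; apply: eq_bigr => a _; rewrite /gl rkK.
rewrite (sort_prod gl_comm (leqnn N)).
- apply: dprod_ext => k kN; rewrite /ranks inE; apply/mapP/andP => [[a as_ ->]|[kn ks]].
    by rewrite rk_bounds rkK.
  by exists (letter k); rewrite ?letterK.
- by rewrite map_inj_uniq //; apply: rk_inj.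
- by move=> k /mapP[a /rkN ? ->].
move=> k; apply/negP => m2.
have [k1 k2] : k \in map rk s /\ k.+1 \in map rk s.
  by have /mem2l := m2; have /mem2r := m2.
have /mapP[a as_ ea] := k1; have /mapP[b bs eb] := k2.
have := h2 b; rewrite (_ : ord_pred b = a); last first.
  by rewrite -(rkK b) -eb ord_pred_letter ea rkK.
by rewrite -(mem2_map rk_inj) -ea -eb m2.
Qed.

Lemma cyc_set A : x \notin A -> [/\ cyc_decreasing (cyc (ranks A)),
  con (cyc (ranks A)) = A & cox_length (cyc (ranks A)) = #|A| ].
Proof.
move=> xA; pose ks := [seq k <- rev (iota 1 N) | ranks A k].
pose s := map letter ks.
have ksP k : k \in ks = ranks A k.
  rewrite mem_filter mem_rev mem_iota; case e: (ranks A k) => //=.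
  by have := ranks_bounded xA e; lia.
have rks : map rk s = ks.
  rewrite -map_comp -[RHS]map_id; apply/eq_in_map => k; rewrite ksP => /andP[kn _].
  by rewrite /= letterK.
have sP : [set a in s] = A.
  apply/setP => a; rewrite inE -(mem_map rk_inj) rks ksP; exact: ranks_rk.
have us : uniq s.
  rewrite -(map_inj_uniq rk_inj) rks filter_uniq // rev_uniq; exact: iota_uniq.
have xs : x \notin s by rewrite -sP inE in xA.
have cs : cyc_decreasing_word s.
  split=> // j; apply/negP => m2.
  have js : j \in s by exact: mem2r m2.
  have ps : ord_pred j \in s by exact: mem2l m2.
  have ej : rk j = (rk (ord_pred j)).+1.
    case ek: (rk j) => [|k]; first by have := rk_bounds j; rewrite ek.
    have ek' : ord_pred j = letter k by rewrite -(rkK j) ek ord_pred_letter.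
    (* The predecessor of the letter of rank 1 is [x], which does not occur in [s]; cyclic decrease
       thus becomes decrease of ranks. *)
    case: k ek ek' => [|k] ek ek'; first by rewrite ek' letter0 (negbTE xs) in ps.
    by rewrite ek' letterK //; have := rk_bounds j; lia.
  have : mem2 (map rk s) (rk (ord_pred j)) (rk j) by rewrite (mem2_map rk_inj).
  rewrite rks mem2E (_ : _ == _ = false) ?ej; last by apply/eqP; lia.
  have sk : sorted gtn ks.
    apply: sorted_filter => [a b c h1 h2|]; first exact: ltn_trans h2 h1.
    rewrite rev_sorted; exact: iota_ltn_sorted.
  have gtn_trans : transitive gtn by move=> a b c h1 h2; exact: ltn_trans h2 h1.
  by move=> /(subseq_sorted gtn_trans) /(_ sk); rewrite /= andbT; lia.
have -> : cyc (ranks A) = word_prod s by rewrite cyc_word // sP.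
split.
- by exists s.
- by rewrite -[RHS]sP; apply/setP => a; rewrite (con_word hn (uniq_refl hn us)) inE.
- have /eqP <- : size s == cox_length (word_prod s).
    by rewrite -(uniq_refl_length hn) (uniq_refl hn us).
  by rewrite -[in RHS]sP -(card_uniqP us); apply: eq_card => a; rewrite inE.
Qed.

Lemma cyc_char g : cyc_decreasing g -> x \notin con g -> g = cyc (ranks (con g)).
Proof.
move=> [s cs ->]; have us : uniq s by case: cs.
have cE := con_word hn (uniq_refl hn us); rewrite cE => xs.
rewrite {1}cyc_word //; congr (cyc (ranks _)).
by apply/setP => a; rewrite inE cE.
Qed.

Lemma cyc_ofE A : x \notin A -> cyc_of A = cyc (ranks A).
Proof.
move=> xA; have [c1 c2 _] := cyc_set xA; rewrite /cyc_of.
case: xgetP => [g _ [d1 d2]|/(_ (cyc (ranks A)))[]] //.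
by rewrite {1}(cyc_char d1) d2.
Qed.

End Letters.

Lemma closes_noU N (U V : nat -> bool) k : bounded N U -> bounded N V ->
  (forall j, k <= j -> U j = false) -> closes N U V k = count V (iota k (N.+1 - k)).
Proof.
move=> bU bV; move Em : (N.+1 - k) => l; elim: l k Em => [|l IHl] k Em hU.
  by rewrite closes_big //; lia.
rewrite (closes_rec k bU bV) IHl ?hU //=; [by rewrite subn0 addnC|lia|].
by move=> j kj; apply: hU; lia.
Qed.

Lemma opens_above (U V U' V' : nat -> bool) j : (forall k, j <= k -> U' k = U k) ->
  (forall k, j <= k -> V' k = V k) -> opens U' V' j = opens U V j ->
  forall k, j <= k -> opens U' V' k = opens U V k.
Proof.
move=> eU eV ej; elim=> [|k IHk] kj; first by have -> : 0 = j by lia.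
have [<-//|nk] := eqVneq j k.+1.
by rewrite !opensS IHk ?eU ?eV //; lia.
Qed.

Lemma find_iota (P : pred nat) n k : k < n -> P k -> (forall i, i < k -> ~~ P i) ->
  find P (iota 0 n) = k.
Proof.
move=> kn Pk nP; have -> : n = k + (1 + (n - k.+1)) by lia.
rewrite !iotaD find_cat size_iota ifN; first by rewrite /= add0n Pk addn0.
by apply/hasPn => i; rewrite mem_iota => ?; apply: nP; lia.
Qed.

(** * The pairing as a parenthesis matching *)

Section Pairing.
Variables (n : nat) (x : 'I_n).
Hypothesis hn : 1 < n.
Local Notation N := n.-1.
Local Notation rk := (rk x).
Local Notation letter := (letter x).
Implicit Types (a b : 'I_n) (A B : {set 'I_n}) (u v g : affS n) (bs av : seq 'I_n).

Definition pos bs : nat -> bool := fun k => k \in map rk bs.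

Lemma pos_bounded bs : x \notin bs -> bounded N (pos bs).
Proof.
move=> xb k /mapP[b bb ->]; have := rk_bounds x b.
have [e|] := eqVneq (rk b) n; last lia.
by move: xb; rewrite -(rk_inj (etrans e (esym (rk_x x)))) bb.
Qed.

Lemma pos_rk bs b : pos bs (rk b) = (b \in bs).
Proof. by rewrite /pos (mem_map (@rk_inj n x)). Qed.

Lemma posP bs k : pos bs k -> exists2 b, b \in bs & k = rk b.
Proof. by move/mapP. Qed.

Definition decreasing bs := sorted (fun a b => rk b < rk a) bs.
Definition increasing bs := sorted (fun a b => rk a < rk b) bs.

Let dec_trans : transitive (fun a b => rk b < rk a).
Proof. by move=> a b c /= h1 h2; apply: ltn_trans h2 h1. Qed.
Let inc_trans : transitive (fun a b => rk a < rk b).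
Proof. by move=> a b c /= h1 h2; apply: ltn_trans h1 h2. Qed.

Lemma increasing_uniq bs : increasing bs -> uniq bs.
Proof. by apply: sorted_uniq => // a; rewrite ltnn. Qed.

(** Induction on the openings from the largest one [b]. No opening lies between [b] and the nearest
    closing [a0] above it, so this pair belongs to the parenthesis matching; deleting both leaves
    the counts unchanged elsewhere. *)
Lemma pair_upP bs av : decreasing bs -> increasing av ->
  x \notin bs -> x \notin av ->
  [/\ {subset unzip1 (pair_up x bs av) <= bs},
      forall b, b \in bs -> (b \notin unzip1 (pair_up x bs av)) =
        (closes N (pos bs) (pos av) (rk b).+1 == 0) &
      forall a, a \in av -> (a \notin unzip2 (pair_up x bs av)) =
        (opens (pos bs) (pos av) (rk a) == 0)].
Proof.
elim: bs av => [|b bs IHbs] av db da xb xa.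
  split=> // a aa /=.
  have : forall k, opens (pos [::]) (pos av) k = 0 by elim=> // k IHk; rewrite opensS IHk.
  by move=> ->.
have [db' blt] : decreasing bs /\ forall c, c \in bs -> rk c < rk b.
  split; first exact: path_sorted db.
  by move=> c cb; have /allP := order_path_min dec_trans db; apply.
have xb' : x \notin bs by move: xb; rewrite inE negb_or => /andP[].
have bnb : b \notin bs by apply/negP => /blt; rewrite ltnn.
have bU := pos_bounded xb; have bU' := pos_bounded xb'; have bV := pos_bounded xa.
have UE k : pos (b :: bs) k = (k == rk b) || pos bs k by rewrite /pos inE.
have U'lt k : pos bs k -> k < rk b by move=> /posP[c /blt h ->].
have Ulow k : k < rk b -> pos (b :: bs) k = pos bs k.
  by move=> kb; rewrite UE (_ : k == rk b = false) //; nlia.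
have U'high k : rk b <= k -> pos bs k = false.
  by move=> kb; apply/negP => /U'lt; nlia.
have Uhigh k : rk b < k -> pos (b :: bs) k = false.
  by move=> kb; rewrite UE U'high ?orbF; nlia.
have Ub : pos (b :: bs) (rk b) by rewrite UE eqxx.
have Eb1 : closes N (pos (b :: bs)) (pos av) (rk b).+1 =
    count (pos av) (iota (rk b).+1 (N.+1 - (rk b).+1)).
  by apply: closes_noU => // k; apply: Uhigh.
rewrite /=; case ef : [seq a <- av | xlt x b a] => [|a0 fl] /=.
  have noA a : a \in av -> rk a <= rk b.
    move=> aa; rewrite leqNgt; apply/negP => h.
    have : a \in [seq a <- av | xlt x b a] by rewrite mem_filter aa andbT.
    by rewrite ef.
  have c0 : count (pos av) (iota (rk b).+1 (N.+1 - (rk b).+1)) = 0.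
    rewrite (eq_in_count (a2 := pred0)) ?count_pred0 // => k; rewrite mem_iota => kb.
    by apply/negP => /posP[a /noA h e]; nlia.
  have [h1 h2 h3] := IHbs av db' da xb' xa.
  have Eb : closes N (pos bs) (pos av) (rk b) = closes N (pos (b :: bs)) (pos av) (rk b).
    rewrite !(closes_rec (rk b)) // Eb1 c0 closes_noU ?c0 ?sub0n //.
    by move=> k kb; apply: U'high; nlia.
  have Ebl := closes_below bU bV bU' bV (fun k kb => esym (Ulow k kb)) (fun k _ => erefl) Eb.
  split.
  - by move=> c /h1 cb; rewrite inE cb orbT.
  - move=> c; rewrite inE => /orP[/eqP->|cb].
      by rewrite Eb1 c0 eqxx; apply: contra bnb => /h1.
    by rewrite h2 // Ebl //; apply: blt.
  - move=> a aa; rewrite h3 //; congr (_ == _).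
    by apply: (opens_below (j := rk b)) (noA _ aa) => // k kb; rewrite Ulow.
have a0f : a0 \in [seq a <- av | xlt x b a] by rewrite ef mem_head.
have [ba0 a0a] : rk b < rk a0 /\ a0 \in av by move: a0f; rewrite mem_filter => /andP[].
have a0min a : a \in av -> rk b < rk a -> a != a0 -> rk a0 < rk a.
  move=> aa ba; have : a \in [seq a <- av | xlt x b a] by rewrite mem_filter aa andbT.
  have : increasing (a0 :: fl) by rewrite -ef; apply: sorted_filter.
  rewrite ef inE => /(order_path_min inc_trans) /allP h /orP[->//|af _].
  exact: h.
have ua := increasing_uniq da.
have remE : pos (rem a0 av) = rmv (pos av) (rk a0).
  apply: funext => k; rewrite /rmv; apply/idP/andP.
    move=> /posP[a]; rewrite mem_rem_uniq // inE => /andP[h1 h2] ->.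
    by rewrite pos_rk h2 (inj_eq (@rk_inj n x)).
  move=> [/posP[a aa ->]]; rewrite (inj_eq (@rk_inj n x)) => h.
  by rewrite pos_rk mem_rem_uniq // inE h.
have da' : increasing (rem a0 av) by apply: subseq_sorted (rem_subseq _ _) da.
have xa' : x \notin rem a0 av by apply: contra xa => /mem_rem.
have [h1 h2 h3] := IHbs (rem a0 av) db' da' xb' xa'.
have bV' := pos_bounded xa'; rewrite remE in h2 h3 bV'.
have noV k : rk b < k < rk a0 -> pos av k = false.
  move=> kb; apply/negP => /posP[a aa e].
  have aa0 : a != a0 by apply/eqP => ea; move: kb; rewrite e ea ltnn andbF.
  by have := a0min a aa ltac:(nlia) aa0; nlia.
have Va0 : pos av (rk a0) by rewrite pos_rk.
have a0N := bV _ Va0.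
have cS : count (pos av) (iota (rk b).+1 (N.+1 - (rk b).+1)) =
    (count (rmv (pos av) (rk a0)) (iota (rk b).+1 (N.+1 - (rk b).+1))).+1.
  apply: (count_add1 (q := rk a0)); rewrite ?iota_uniq ?mem_iota //; first nlia.
    by rewrite /rmv eqxx andbF.
  by move=> k; rewrite /rmv; case: eqP => [->|_]; rewrite ?Va0 ?andbT ?orbF.
have Eb : closes N (pos bs) (rmv (pos av) (rk a0)) (rk b) =
    closes N (pos (b :: bs)) (pos av) (rk b).
  rewrite !(closes_rec (rk b)) // Eb1 cS closes_noU //; last first.
    by move=> k kb; apply: U'high; nlia.
  by rewrite Ub U'high // rmv_neq ?subn0 ?subn1 //; nlia.
have Vlow k : k < rk b -> rmv (pos av) (rk a0) k = pos av k.
  by move=> kb; rewrite rmv_neq //; nlia.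
have Ebl := closes_below bU bV bU' bV' (fun k kb => esym (Ulow k kb)) Vlow Eb.
have Dlow := opens_below (j := rk b) (fun k kb => esym (Ulow k kb)) Vlow.
(* From just above [b] up to its partner, exactly one more opening is pending, namely [b]. *)
have Dmid k : rk b < k <= rk a0 ->
    opens (pos (b :: bs)) (pos av) k = (opens (pos bs) (rmv (pos av) (rk a0)) k).+1.
  elim: k => [|k IHk] // kb; rewrite !opensS.
  have [ek|nk] := eqVneq k (rk b).
    rewrite ek Dlow // Ub U'high // rmv_neq; last nlia.
    by rewrite addn0 addn1.
  rewrite IHk; last nlia.
  by rewrite rmv_neq ?noV ?Uhigh ?U'high //; nlia.
split.
- by move=> c; rewrite !inE => /orP[->//|/h1->]; rewrite orbT.
- move=> c; rewrite !inE => /orP[/eqP->|cb]; first by rewrite eqxx Eb1 cS.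
  have cnb : (c == b) = false by apply/eqP => e; move: bnb; rewrite -e cb.
  by rewrite cnb /= h2 // Ebl //; apply: blt.
- move=> a aa; rewrite inE negb_or; have [->|na] /= := eqVneq a a0.
    by rewrite Dmid //; nlia.
  rewrite h3; last by rewrite mem_rem_uniq // inE na.
  congr (_ == _); case: (leqP (rk a) (rk b)) => rab; first exact: Dlow.
  have ra0 := a0min a aa rab na.
  apply: (opens_above (j := (rk a0).+1)) => // [k ka|k ka|].
  + by rewrite U'high ?Uhigh //; nlia.
  + by rewrite rmv_neq //; nlia.
    have Dk := Dmid (rk a0) ltac:(nlia).
    rewrite (opensS (pos bs) _ (rk a0)) (opensS (pos (b :: bs)) _ (rk a0)) Dk Va0.
    by rewrite U'high ?Uhigh ?[rmv _ _ (rk a0)]/rmv ?eqxx ?andbF ?subn0 ?subn1 //; nlia.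
Qed.

End Pairing.

(** * The operators on pairs *)

Section PairOperators.
Variables (n : nat) (x : 'I_n).
Hypothesis hn : 1 < n.
Local Notation N := n.-1.
Local Notation rk := (rk x).
Local Notation letter := (letter x).
Local Notation cyc := (cyc x).
Implicit Types (a b : 'I_n) (A B : {set 'I_n}).

Lemma mem_xincr A : xincr x A =i A.
Proof. by move=> a; rewrite mem_sort mem_enum. Qed.

Lemma mem_xdecr A : xdecr x A =i A.
Proof. by move=> a; rewrite mem_rev mem_xincr. Qed.

Lemma xincr_increasing A : increasing x (xincr x A).
Proof.
rewrite -[increasing x _]/(sorted (relpre rk ltn) _) -sorted_map ltn_sorted_uniq_leq.
rewrite (map_inj_uniq (@rk_inj n x)) sort_uniq enum_uniq /= sorted_map.
by apply: sort_sorted => a b; apply: leq_total.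
Qed.

Lemma xdecr_decreasing A : decreasing x (xdecr x A).
Proof. by rewrite /decreasing rev_sorted; apply: xincr_increasing. Qed.

Lemma pos_ranks A (bs : seq 'I_n) : bs =i A -> pos x bs = ranks x A.
Proof.
move=> e; apply: funext => k; rewrite /pos /ranks; apply/mapP/andP.
  by move=> [b bb ->]; rewrite rk_bounds rkK -e.
by move=> [kn kA]; exists (letter k); rewrite ?e ?letterK.
Qed.

Lemma xincr_min A b : b \in A -> (forall c, c \in A -> rk b <= rk c) ->
  exists s, xincr x A = b :: s.
Proof.
move=> bA bmin; case e: (xincr x A) (mem_xincr A) (xincr_increasing A) => [|h s] m i.
  by move: bA; rewrite -m.
exists s; congr (_ :: _); apply/eqP; rewrite -(inj_eq (@rk_inj n x)) eqn_leq bmin ?andbT.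
  have : b \in h :: s by rewrite m.
  rewrite inE => /orP[/eqP-> //|bs].
  have tr : transitive (fun a b => rk a < rk b).
    by move=> ? ? ? /= h1 h2; apply: ltn_trans h1 h2.
  by have /allP/(_ _ bs)/ltnW := order_path_min tr i.
by rewrite -m mem_head.
Qed.

Lemma xdecr_max A b : b \in A -> (forall c, c \in A -> rk c <= rk b) ->
  exists s, xdecr x A = b :: s.
Proof.
move=> bA bmin; case e: (xdecr x A) (mem_xdecr A) (xdecr_decreasing A) => [|h s] m i.
  by move: bA; rewrite -m.
exists s; congr (_ :: _); apply/eqP; rewrite -(inj_eq (@rk_inj n x)) eqn_leq bmin /=.
  have : b \in h :: s by rewrite m.
  rewrite inE => /orP[/eqP-> //|bs].
  have tr : transitive (fun a b => rk b < rk a).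
    by move=> ? ? ? /= h1 h2; apply: ltn_trans h2 h1.
  by have /allP/(_ _ bs)/ltnW := order_path_min tr i.
by rewrite -m mem_head.
Qed.

Lemma xincr0 : xincr x finset.set0 = [::].
Proof.
by case: (xincr x finset.set0) (mem_xincr finset.set0) => [|h s] // /(_ h);
  rewrite mem_head inE.
Qed.

Lemma xdecr0 : xdecr x finset.set0 = [::].
Proof. by rewrite /xdecr xincr0. Qed.

Section Operators.
Variables u v : affS n.
Hypotheses (xu : x \notin con u) (xv : x \notin con v).
Local Notation U := (ranks x (con u)).
Local Notation V := (ranks x (con v)).

Let bU : bounded N U. Proof. exact: ranks_bounded. Qed.
Let bV : bounded N V. Proof. exact: ranks_bounded. Qed.

Let pairP := pair_upP hn (xdecr_decreasing (con u)) (xincr_increasing (con v))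
  (contraNN (fun h => eq_ind _ is_true h _ (mem_xdecr (con u) x)) xu)
  (contraNN (fun h => eq_ind _ is_true h _ (mem_xincr (con v) x)) xv).

Lemma unpairedL_unL b : (b \in unpairedL x u v) = unL N U V (rk b).
Proof.
rewrite inE /unL ranks_rk; case: (boolP (b \in con u)) => //= bu.
have [_ h _] := pairP.
by rewrite /uv_pairing h ?mem_xdecr // !(pos_ranks (mem_xdecr _)) (pos_ranks (mem_xincr _)).
Qed.

Lemma unpairedR_unR a : (a \in unpairedR x u v) = unR U V (rk a).
Proof.
rewrite inE /unR ranks_rk; case: (boolP (a \in con v)) => //= av.
have [_ _ h] := pairP.
by rewrite /uv_pairing h ?mem_xincr // !(pos_ranks (mem_xdecr _)) (pos_ranks (mem_xincr _)).
Qed.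

Let iter_pred k i : i <= k -> iter i (@ord_pred n) (letter k) = letter (k - i).
Proof.
elim: i => [|i IHi] ik; first by rewrite subn0.
rewrite iterS IHi; last exact: ltnW.
by rewrite (_ : k - i = (k - i.+1).+1) ?ord_pred_letter //; lia.
Qed.

Let iter_succ k i : iter i (@ordS n) (letter k) = letter (k + i).
Proof.
by elim: i => [|i IHi]; [rewrite addn0|rewrite iterS IHi ordS_letter addnS].
Qed.

Let notin (w : affS n) k : x \notin con w -> 0 < k <= n \/ k = 0 ->
  ~~ ranks x (con w) k -> letter k \notin con w.
Proof.
by move=> xw [kn|->]; rewrite /ranks ?letter0 // kn.
Qed.

Lemma e_pair_None : nL N U V = 0 -> e_pair x u v = None.
Proof.
move=> n0; rewrite /e_pair (_ : unpairedL x u v = finset.set0) ?xincr0 //.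
by apply/setP => b; rewrite unpairedL_unL inE; apply/negbTE/nL0.
Qed.

Lemma f_pair_None : nR N U V = 0 -> f_pair x u v = None.
Proof.
move=> n0; rewrite /f_pair (_ : unpairedR x u v = finset.set0) ?xdecr0 //.
apply/setP => b; rewrite unpairedR_unR inE; apply/negP => h.
by have := nR_gt0 bV h; rewrite n0.
Qed.

Lemma e_pair_Some (b c : nat) : minL N U V b -> foot U b c ->
  e_pair x u v = Some (cyc (rmv U b), cyc (ins V c)).
Proof.
move=> [Lb nb] [cb hU nU]; have /andP[Ub _] := Lb; have bN := bU Ub.
have Uc : U c by apply: hU; lia.
have cN := bU Uc.
have bn : 0 < b <= n by lia.
have cn : 0 < c <= n by lia.
have [s es] : exists s, xincr x (unpairedL x u v) = letter b :: s.
  apply: xincr_min; first by rewrite unpairedL_unL letterK.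
  move=> a; rewrite unpairedL_unL letterK // => La.
  by rewrite leqNgt; apply/negP => /nb; rewrite La.
rewrite /e_pair es /least (@find_iota _ _ (b - c)); first last.
- move=> i ic; rewrite negbK iter_pred; last lia.
  by have /andP[_] := hU (b - i.+1) ltac:(lia).
- rewrite iter_pred; last lia.
  (* For [c = 1] this is position 0, that is the letter [x], which is not in [con u]; so the search
     stops there as well. *)
  have -> : b - (b - c).+1 = c.-1 by lia.
  by apply: notin => //; lia.
- lia.
rewrite iter_pred; last lia.
have -> : b - (b - c) = c by lia.
rewrite !(@cyc_ofE n x hn); first by rewrite ranksD1 ranksU1 !letterK.
  rewrite in_setU1 negb_or xv andbT; apply/eqP => /(congr1 rk).
  by rewrite rk_x letterK //; lia.
by rewrite in_setD1 negb_and xu orbT.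
Qed.

Lemma f_pair_Some (a c : nat) : maxR U V a -> crest V a c ->
  f_pair x u v = Some (cyc (ins U c), cyc (rmv V a)).
Proof.
move=> [Ra na] [ac hV nV]; have /andP[Va _] := Ra; have aN := bV Va.
have Vc : V c by apply: hV; lia.
have cN := bV Vc.
have an : 0 < a <= n by lia.
have cn : 0 < c <= n by lia.
have [s es] : exists s, xdecr x (unpairedR x u v) = letter a :: s.
  apply: xdecr_max; first by rewrite unpairedR_unR letterK.
  move=> b; rewrite unpairedR_unR letterK // => Lb.
  by rewrite leqNgt; apply/negP => /na; rewrite Lb.
rewrite /f_pair es /least (@find_iota _ _ (c - a)); first last.
- move=> i ic; rewrite negbK iter_succ.
  by have /andP[_] := hV (a + i.+1) ltac:(lia).
- rewrite iter_succ; have -> : a + (c - a).+1 = c.+1 by lia.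
  by apply: notin => //; lia.
- lia.
rewrite iter_succ; have -> : a + (c - a) = c by lia.
rewrite !(@cyc_ofE n x hn); first by rewrite ranksD1 ranksU1 !letterK.
  by rewrite in_setD1 negb_and xv orbT.
rewrite in_setU1 negb_or xu andbT; apply/eqP => /(congr1 rk).
by rewrite rk_x letterK //; lia.
Qed.

End Operators.
End PairOperators.

(** * Affine factorizations *)

Section Factors.
Variables (n m : nat).
Local Open Scope group_scope.
Implicit Types (y F : 'I_m -> affS n) (r : 'I_m.-1).

Definition fprod F : affS n := \prod_(i < m) F (rev_ord i).
Definition flen F : nat := (\sum_(i < m) cox_length (F i))%N.

Let rs := [seq rev_ord i | i <- index_enum 'I_m].

Let fprodE F : fprod F = \prod_(i <- rs) F i.
Proof. by rewrite /rs big_map. Qed.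

Let flenE F : flen F = (\sum_(i <- rs) cox_length (F i))%N.
Proof. by rewrite /rs big_map /flen (reindex_inj rev_ord_inj). Qed.

Let rs_uniq : uniq rs.
Proof. by rewrite (map_inj_uniq rev_ord_inj) index_enum_uniq. Qed.

Let mem_rs i : i \in rs.
Proof. by rewrite -(rev_ordK i) (mem_map rev_ord_inj) mem_index_enum. Qed.

Let rs_nth i0 i : nth i0 rs (rev_ord i) = i.
Proof.
by rewrite /rs [index_enum _]unlock -enumT (nth_map i0) ?nth_ord_enum ?rev_ordK //
  size_enum_ord ltn_ord.
Qed.

Lemma fprod_one y i0 : exists g h, forall F, (forall i, i != i0 -> F i = y i) ->
  fprod F = g * (F i0 * h).
Proof.
have [s1 [s2 es]] : exists s1 s2, rs = s1 ++ i0 :: s2.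
  by have := mem_rs i0; case/splitPr => s1 s2; exists s1, s2.
have us : i0 \notin s1 ++ s2.
  by have := rs_uniq; rewrite es -cat1s uniq_catCA /= => /andP[].
exists (\prod_(i <- s1) y i), (\prod_(i <- s2) y i) => F eF.
have e i : i \in s1 ++ s2 -> F i = y i.
  by move=> si; apply: eF; apply: contraNneq us => <-.
rewrite fprodE es big_cat big_cons /=; congr (_ * (_ * _)); apply: eq_big_seq => i si;
  by rewrite e // mem_cat si ?orbT.
Qed.

Lemma fprod_pair y r : exists g h k, forall F,
  (forall i, i != hi r -> i != lo r -> F i = y i) ->
  fprod F = g * (F (hi r) * F (lo r) * h) /\
  flen F = (k + (cox_length (F (hi r)) + cox_length (F (lo r))))%N.
Proof.
have [s1 [s2 es]] : exists s1 s2, rs = s1 ++ hi r :: lo r :: s2.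
  exists (take (rev_ord (hi r)) rs), (drop (rev_ord (lo r)).+1 rs).
  have e : (rev_ord (hi r)).+1 = rev_ord (lo r) by rewrite /=; have := ltn_ord (hi r) => /=; lia.
  have sz (i : 'I_m) : rev_ord i < size rs.
    by rewrite /rs size_map [index_enum _]unlock -enumT size_enum_ord; exact: ltn_ord.
  rewrite -[LHS](cat_take_drop (rev_ord (hi r))) (drop_nth (hi r)) // rs_nth e.
  by rewrite (drop_nth (hi r)) // rs_nth.
have us : uniq [:: hi r, lo r & s1 ++ s2].
  have := rs_uniq; rewrite es -(cat1s (hi r)) uniq_catCA /= -(cat1s (lo r)) => /andP[h1].
  by rewrite uniq_catCA /= => ->; rewrite andbT; move: h1; rewrite !(inE, mem_cat) orbCA.
exists (\prod_(i <- s1) y i), (\prod_(i <- s2) y i).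
exists (\sum_(i <- s1) cox_length (y i) + \sum_(i <- s2) cox_length (y i))%N => F eF.
have e i : i \in s1 ++ s2 -> F i = y i.
  move=> si; move: us => /= /andP[h1 /andP[h2 _]]; apply: eF.
    by apply: contraNneq h1 => <-; rewrite inE si orbT.
  by apply: contraNneq h2 => <-.
have e1 i : i \in s1 -> F i = y i by move=> si; rewrite e // mem_cat si.
have e2 i : i \in s2 -> F i = y i by move=> si; rewrite e // mem_cat si orbT.
rewrite fprodE flenE es !big_cat !big_cons /= -!mulgA (eq_big_seq _ e1) (eq_big_seq _ e2).
have E (t : seq 'I_m) : {in t, F =1 y} ->
    (\sum_(i <- t) cox_length (F i) = \sum_(i <- t) cox_length (y i))%N.
  by move=> et; apply: eq_big_seq => i /et->.
by split=> //; rewrite (E _ e1) (E _ e2) -[RHS]addnA; congr addn; rewrite [RHS]addnC addnA.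
Qed.

Lemma fprod_length F : cox_length (fprod F) <= flen F.
Proof.
rewrite fprodE flenE; elim: rs => [|i s IHs]; first by rewrite !big_nil cox_length1.
rewrite !big_cons; apply: leq_trans (cox_length_mul _ _) _.
by rewrite leq_add2l.
Qed.

Lemma fprod_word F : exists s, [/\ word_prod s = fprod F, size s = flen F &
  forall i, exists2 t, reduced_word (F i) t & {subset t <= s}].
Proof.
have [t ht] := choice (fun i => cox_length_ex (F i)).
exists (flatten [seq t i | i <- rs]); split.
- rewrite fprodE; elim: rs => [|i s IHs]; first by rewrite big_nil word_prod_nil.
  by rewrite /= word_prod_cat IHs big_cons; have [-> _] := ht i.
- rewrite flenE; elim: rs => [|i s IHs]; first by rewrite big_nil.
  by rewrite /= size_cat IHs big_cons; have [_ ->] := ht i.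
- move=> i; exists (t i) => // a ai; apply/flattenP; exists (t i) => //.
  by apply: map_f.
Qed.

End Factors.

Section FactorizationModel.
Variables (n : nat) (x : 'I_n) (w : affS n) (m : nat).
Hypotheses (hn : 1 < n) (hw : in_parabolic x w).
Local Notation N := n.-1.
Local Notation G := (fact_graph m x w).
Local Notation cyc := (cyc x).
Implicit Types (y z : {ffun 'I_m -> affS n}) (r : 'I_m.-1) (i : 'I_m).
Local Open Scope group_scope.

Definition fact_enc y i : nat -> bool := ranks x (con (y i)).

Lemma cvert_fact y : @cvert m G y <->
  [/\ flen y = cox_length w, forall i, cyc_decreasing (y i) & fprod y = w].
Proof.
split=> [[alpha [h1 h2 h3 h4]]|[h1 h2 h3]].
  by split=> //; rewrite -h1; apply: eq_bigr => i _; rewrite h3.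
exists [ffun i => cox_length (y i)]; split=> //; last by move=> i; rewrite ffunE.
by rewrite -h1; apply: eq_bigr => i _; rewrite ffunE.
Qed.

Lemma cyc_bounded U : bounded N U -> exists2 A : {set 'I_n}, x \notin A & ranks x A = U.
Proof.
move=> bU; exists (finset (fun a => U (rk x a))).
  by rewrite inE rk_x; apply/negP => /bU; lia.
apply: funext => k; rewrite /ranks; case: (boolP (0 < k <= n)) => kn.
  by rewrite inE letterK.
by symmetry; apply/negP => /bU; lia.
Qed.

Lemma cycP U : bounded N U -> [/\ cyc_decreasing (cyc U),
  ranks x (con (cyc U)) = U & cox_length (cyc U) = nset N U].
Proof.
move=> /cyc_bounded[A xA <-]; have [h1 h2 h3] := cyc_set hn xA.
by rewrite h2 h3 (nset_ranks hn xA).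
Qed.

Lemma cyc_raise c b U V : 0 < c <= b -> b <= N ->
  (forall k, c <= k <= b -> U k) -> U c.-1 = false -> V b.+1 = false ->
  (forall k, c < k <= b -> V k) -> V c = false ->
  cyc U * cyc V = cyc (rmv U b) * cyc (ins V c).
Proof.
by move=> cb bN *; apply: (dfull_raise (@gl_comm n x hn) (@gl_braid n x hn) cb bN).
Qed.

Lemma cyc_cancel c b U V : 0 < c <= b -> b <= N ->
  (forall k, c <= k <= b -> U k) -> U c.-1 = false -> V b.+1 = false ->
  (forall k, c <= k <= b -> V k) ->
  cyc U * cyc V = cyc (rmv U b) * cyc (rmv V c).
Proof.
move=> cb bN *.
by apply: (dfull_cancel (@gl_sqr n x) (@gl_comm n x hn) (@gl_braid n x hn) cb bN).
Qed.

Section Vertex.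
Variable y : {ffun 'I_m -> affS n}.
Hypothesis vy : @cvert m G y.

(** Lengths add up, so concatenating reduced words of the factors gives a reduced word of [w]; its
    letters occur in every word for [w], in particular in one that avoids [x]. *)
Lemma vert_notin i : x \notin con (y i).
Proof.
have [h1 h2 h3] := (cvert_fact y).1 vy; have [s0 xs0 ew] := hw.
have [s [s1 s2 s3]] := fprod_word y; have [t [t1 t2] ts] := s3 i.
have us : uniq (refl s) by rewrite (uniq_refl_length hn) s1 s2 h1 h3.
have ut : uniq (refl t) by rewrite (uniq_refl_length hn) t1 t2.
rewrite -t1 (con_word hn ut); apply: contra xs0 => /ts.
by apply: (content_sub hn us); rewrite s1 h3.
Qed.

Lemma vert_bounded i : bounded N (fact_enc y i).
Proof. by apply: ranks_bounded => //; apply: vert_notin. Qed.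

Lemma vert_cyc i : y i = cyc (fact_enc y i).
Proof.
by have [_ h2 _] := (cvert_fact y).1 vy; apply: cyc_char => //; apply: vert_notin.
Qed.

Lemma vert_length i : cox_length (y i) = nset N (fact_enc y i).
Proof. by rewrite {1}vert_cyc; have [] := cycP (@vert_bounded i). Qed.

Lemma vert_set_factors r U V : bounded N U -> bounded N V ->
  cyc U * cyc V = y (hi r) * y (lo r) ->
  nset N U + nset N V = nset N (fact_enc y (hi r)) + nset N (fact_enc y (lo r)) ->
  let z := set_factors r y (cyc U, cyc V) in
  @cvert m G z /\ forall i, fact_enc z i =
    if i == hi r then U else if i == lo r then V else fact_enc y i.
Proof.
move=> bU bV eg el z; have [h1 h2 h3] := (cvert_fact y).1 vy.
have [cU rU lU] := cycP bU; have [cV rV lV] := cycP bV.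
have zE i : z i = if i == hi r then cyc U else if i == lo r then cyc V else y i.
  by rewrite ffunE.
split; last by move=> i; rewrite /fact_enc zE; do 2?case: eqP.
have [g [h [k hp]]] := fprod_pair y r.
have [zp zl] : fprod z = g * (z (hi r) * z (lo r) * h) /\
  flen z = (k + (cox_length (z (hi r)) + cox_length (z (lo r))))%N.
  by apply: hp => i /negbTE n1 /negbTE n2; rewrite zE n1 n2.
have [yp yl] := hp y (fun i _ _ => erefl).
rewrite !zE !eqxx lo_neq_hi in zp zl.
apply/cvert_fact; split.
- by rewrite zl lU lV el -h1 yl !vert_length.
- by move=> i; rewrite zE; do 2?case: eqP.
- by rewrite zp eg -yp.
Qed.

(** A violation would let [dfull_cancel] write [w] as a product of factors of total length smaller
    by two. *)
Lemma vert_good r : good (fact_enc y (hi r)) (fact_enc y (lo r)).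
Proof.
move=> c b cb hUV; apply: contraT => /norP[/negbTE Uc /negbTE Vb].
have [h1 h2 h3] := (cvert_fact y).1 vy.
set U := fact_enc y (hi r) in hUV Uc *; set V := fact_enc y (lo r) in hUV Vb *.
have bU : bounded N U by apply: vert_bounded.
have bV : bounded N V by apply: vert_bounded.
have Ucb k : c <= k <= b -> U k by move/hUV => /andP[].
have Vcb k : c <= k <= b -> V k by move/hUV => /andP[].
have /bU cN : U c by apply: Ucb; rewrite leqnn.
have /bU bN : U b by apply: Ucb; rewrite leqnn cb.
have e : cyc U * cyc V = cyc (rmv U b) * cyc (rmv V c).
  by apply: cyc_cancel => //; lia.
have [_ _ lU] := cycP (rmv_bounded (b := b) bU).
have [_ _ lV] := cycP (rmv_bounded (b := c) bV).
have [g [h [k hp]]] := fprod_pair y r.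
pose z := set_factors r y (cyc (rmv U b), cyc (rmv V c)).
have [zp zl] : fprod z = g * (z (hi r) * z (lo r) * h) /\
  flen z = (k + (cox_length (z (hi r)) + cox_length (z (lo r))))%N.
  by apply: hp => i /negbTE n1 /negbTE n2; rewrite ffunE n1 n2.
have [yp yl] := hp y (fun i _ _ => erefl).
rewrite !ffunE !eqxx lo_neq_hi /= in zp zl.
have := fprod_length z; rewrite zp -e -!vert_cyc -yp h3 -h1 yl zl lU lV !vert_length.
rewrite -/U -/V (nset_rmv bU (b := b)) ?(nset_rmv bV (b := c)) //; first lia.
  by apply: Vcb; rewrite leqnn.
by apply: Ucb; rewrite leqnn cb.
Qed.

End Vertex.

Arguments vert_bounded {y} vy i _ _.
Arguments vert_good {y} vy r _ _ _ _.

Lemma fact_model : set_model N (G := G) fact_enc.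
Proof.
split.
- by move=> y i vy; apply: vert_bounded.
- by move=> y r vy; apply: vert_good.
- move=> y r vy n0 /=; rewrite /e_op e_pair_None //; exact: vert_notin.
- move=> y r b c vy mb fc; have bU := vert_bounded vy (hi r).
  have bV := vert_bounded vy (lo r); have gUV := vert_good vy r.
  have [xU xV] := (vert_notin vy (hi r), vert_notin vy (lo r)).
  have [c0 cb bN Ub] := minL_bounds bU mb fc.
  have [_ chain Vc _ _] := minL_chain bU bV gUV mb fc.
  have [_ _ Vb] := estep_crest bU bV gUV mb fc; have [_ cU nU] := fc.
  rewrite ins_neq in Vb; last lia.
  have bU' := rmv_bounded (b := b) bU.
  have bV' := ins_bounded (b := c) bV ltac:(lia).
  have [||vz ez] := vert_set_factors vy bU' bV' (r := r).
  + rewrite -(@cyc_raise c b).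
    * by rewrite !(vert_cyc vy).
    * lia.
    * lia.
    * exact: cU.
    * exact: negbTE.
    * exact: negbTE.
    * by move=> k /chain[].
    * exact: Vc.
  + by rewrite (nset_rmv bU Ub) nset_ins //; lia.
  exists (set_factors r y (cyc (rmv (fact_enc y (hi r)) b), cyc (ins (fact_enc y (lo r)) c))).
  split=> //.
    by rewrite /= /e_op (e_pair_Some hn xU xV mb fc).
  by move=> i; rewrite ez; case: eqP => [->|] //; case: eqP => [->|].
- move=> y r vy n0 /=; rewrite /f_op f_pair_None //; exact: vert_notin.
- move=> y r a c vy ma fa; have bU := vert_bounded vy (hi r).
  have bV := vert_bounded vy (lo r); have gUV := vert_good vy r.
  have [xU xV] := (vert_notin vy (hi r), vert_notin vy (lo r)).
  have [ac hV nV] := fa.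
  have /bV aN : fact_enc y (lo r) a by apply: hV; rewrite leqnn.
  have /bV cN : fact_enc y (lo r) c by apply: hV; rewrite leqnn ac.
  (* After reversal the lowering data are raising data, so the chain property yields the run of the
     left factor matched by the run from [a] to [c]. *)
  have mb := maxR_flip bU bV ma.
  have fc := crest_flip (N := N) (a := a) (c := c) ltac:(lia) ltac:(lia) fa.
  have [bU' bV'] := (flip_bounded bU, flip_bounded bV).
  have [_ chain Uc _ _] := minL_chain bV' bU' (good_flip bV gUV) mb fc.
  have [_ _ Ua] := estep_crest bV' bU' (good_flip bV gUV) mb fc.
  rewrite ins_neq /flip in Ua; last lia.
  rewrite (_ : N.+1 - (N.+1 - a).+1 = a.-1) in Ua; last lia.
  rewrite /flip (_ : N.+1 - (N.+1 - c) = c) in Uc; last lia.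
  have Uac k : a <= k < c -> fact_enc y (hi r) k.
    move=> kac; have [] := chain (N.+1 - k) ltac:(lia).
    by rewrite /flip (_ : N.+1 - (N.+1 - k) = k) //; lia.
  have Va : fact_enc y (lo r) a by apply: hV; rewrite leqnn.
  have [||vz ez] := vert_set_factors vy (ins_bounded (b := c) bU ltac:(lia))
    (rmv_bounded (b := a) bV) (r := r).
  (* The braid identity is applied at the lowered pair, where it leads back to the given one. *)
  + rewrite (@cyc_raise a c).
    * rewrite !(vert_cyc vy); congr (cyc _ * cyc _); apply: funext => k.
        by rewrite /rmv /ins; case: eqP => [->|]; rewrite ?Uc ?andbT ?orbF.
      by rewrite /rmv /ins; case: eqP => [->|]; rewrite ?Va ?andbT ?orbF.
    * lia.
    * lia.
    * move=> k kac; rewrite /ins; have [|nk] := eqVneq k c; first by rewrite orbT.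
      by rewrite Uac //; lia.
    * by rewrite ins_neq ?(negbTE Ua) //; lia.
    * by rewrite rmv_neq ?(negbTE nV) //; lia.
    * by move=> k kac; rewrite rmv_neq ?hV //; lia.
    * by rewrite /rmv eqxx andbF.
  + by rewrite nset_ins ?(nset_rmv bV Va) //; lia.
  exists (set_factors r y (cyc (ins (fact_enc y (hi r)) c), cyc (rmv (fact_enc y (lo r)) a))).
  split=> //.
    by rewrite /= /f_op (f_pair_Some hn xU xV ma fa).
  by move=> i; rewrite ez; case: eqP => [->|] //; case: eqP => [->|].
(* In a group the product and all factors but one determine the remaining factor. *)
- move=> y z i0 vy vz e; apply/ffunP => i.
  have [->|ni] := eqVneq i i0; last by rewrite (vert_cyc vy) (vert_cyc vz) e.
  have [_ _ py] := (cvert_fact y).1 vy; have [_ _ pz] := (cvert_fact z).1 vz.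
  have [g [h hp]] := fprod_one y i0.
  move: pz; rewrite -py (hp y) // (hp z); first by move=> /mulgI/mulIg.
  by move=> j nj; rewrite (vert_cyc vy) (vert_cyc vz) e.
- by move=> y i vy /=; rewrite (vert_length vy).
Qed.

End FactorizationModel.

Theorem theorem3p5 (n : nat) (hn : 1 < n) (x : 'I_n) (w : affS n)
    (hw : in_parabolic x w) (m : nat) (hm : 0 < m) :
  is_UqA_crystal (fact_graph m x w).
Proof.
have M := fact_model m hn hw; split.
- exact: model_crystal M.
- exact: model_stembridge M.
- by move=> y vy; apply: model_components M vy.
Qed.
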